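(* Let $\mathcal{K}(t)\subset U\subset V$, $t\in[0,T]$, be closed subsets satisfying, for each $t\in[0,T]$: (III) $\mathcal{K}(t)$ is invariant under parallel translation defined by the connection $\nabla(t)$; (IV) for every $x\in M$ the set $\mathcal{K}_x(t)=\mathcal{K}(t)\cap V_x$ is nonempty, closed and convex. Let $\mathcal{A}(t)\subset\mathcal{K}(t)$, $t\in[0,T]$, be subsets (avoidance sets), put $\mathcal{A}_x(t)=\mathcal{A}(t)\cap V_x$, and suppose that the space-time track $\mathcal{T}=\{(v,t)\in V\times[0,T]:v\in\mathcal{K}(t)\}$ and the avoidance space-time track $\mathcal{AT}=\{(v,t)\in V\times[0,T]:v\in\mathcal{A}(t)\}$ are closed. Assume that $u(x,t):V_x\times T_xM^*\to V_x$ is a smooth family of bundle maps of diagonal form and that the fiber-preserving map $F(x,\sigma,t)$ is continuous in $x,t$ and Lipschitz in $\sigma$. Suppose that for any $x\in M$, any $t_0\in[0,T)$ and any solution $\sigma_x(t)$ of the ODE $$\frac{d}{dt}\sigma_x(t)=F(x,\sigma_x(t),t)$$ in $V_x$ with initial condition $\sigma_x(t_0)\in\mathcal{K}_x(t_0)\setminus\mathcal{A}_x(t_0)$, either $\sigma_x(t)\in\mathcal{K}_x(t)$ for all $t\ge t_0$, or there is a time $t_1$ such that $\sigma_x(t)\in\mathcal{K}_x(t)\setminus\mathcal{A}_x(t)$ for all $t_0\le t<t_1$ and $\sigma_x(t_1)\in\mathcal{A}_x(t_1)$. Then for any $t_0\in[0,T)$ and any solution $\sigma(x,t)$, $t\in[t_0,T]$,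 of the PDE $$\frac{\partial}{\partial t}\sigma(x,t)=\Delta(t)\sigma(x,t)+u(x,t)(\nabla(t)\sigma(x,t))+F(x,\sigma(x,t),t)$$ satisfying the initial condition $\sigma(x,t_0)\in\mathcal{K}_x(t_0)\setminus\mathcal{A}_x(t_0)$ for all $x\in M$ and satisfying $\sigma(x,t)\notin\mathcal{A}_x(t)$ for all $x\in M$ and all $t\ge t_0$, the solution $\sigma(x,t)$ will remain in $\mathcal{K}(t)$ for later times, i.e. $\sigma(x,t)\in\mathcal{K}_x(t)$ for all $x\in M$ and all $t\in[t_0,T]$.
   Context: $M^n$ is a closed oriented $n$-dimensional manifold with a smooth family of Riemannian metrics $g(t)$, $t\in[0,T]$. $V\to M$ is a real vector bundle with a time-independent bundle metric $h$; $V_x$ is the fiber over $x$; $\Gamma(V)$ is the space of $C^\infty$ sections. $\nabla(t):\Gamma(V)\to\Gamma(V\otimes TM^* )$, $t\in[0,T]$, is a smooth family of connections compatible with $h$: $X[h(\sigma,\tau)]=h(\nabla(t)_X\sigma,\tau)+h(\sigma,\nabla(t)_X\tau)$. The time-dependent Laplacian is $\Delta(t)\sigma=\mathrm{trace}_{g(t)}(\widehat\nabla(t)(\nabla(t)\sigma))$, where $\widehat\nabla(t):\Gamma(V\otimes TM^* )\to\Gamma(V\otimes TM^*\otimes TM^* )$ is given by $\widehat\nabla(t)_X(\sigma\otimes\alpha)=(\nabla(t)_X\sigma)\otimes\alpha+\sigma\otimes(D(t)_X\alpha)$, with $D(t)$ the Levi-Civita connection of $g(t)$ on $TM^*$. $U$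 is an open subset of $V$. $F:U\times[0,T]\to V$ is a fiber-preserving map, i.e. a time-dependent vector field on $U$ tangent to the fibers: $F(x,\sigma,t)\in V_x$ for $\sigma\in U\cap V_x$. ''Diagonal form'' for $u$ means that $u(x,t)(\sigma,dx^i)=u^i(x,t)\cdot\sigma$ in local coordinates, with $u^i(x,t)$ smooth functions, so that $u(x,t)(\nabla(t)\sigma)=\sum_i u^i(x,t)\nabla(t)_{\partial/\partial x^i}\sigma$. A solution of the PDE is a time-dependent section of $V$ with values in $U$. A solution of the ODE with initial time $t_0$ takes values in $U\cap V_x$ and is considered on any time interval in $[t_0,T]$ starting at $t_0$ on which it is defined; ''for all $t\ge t_0$'' for it refers to all those times. *)

(* Defs.v *)
From HB Require Import structures.
From mathcomp Require Import all_boot all_order all_algebra.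
From mathcomp Require Import all_classical all_reals all_analysis.
Import Order.TTheory GRing.Theory Num.Theory.
Import numFieldNormedType.Exports.

Set Implicit Arguments.
Unset Strict Implicit.
Unset Printing Implicit Defensive.

Local Open Scope classical_set_scope.
Local Open Scope ring_scope.

Section differentiability.
Context (R : realType) (W : normedModType R).

(* Derivative at p along v, taken within D: two-sided where p + h v stays in
   D, one-sided at the end points of a closed time interval.  Along a
   direction that leaves D at once the condition is vacuous; this does not
   occur for the sets used below (an open set, an interval with more than one
   point, or a product of the two). *)
Definition deriv_within (D : set W) (f : W -> R) (p v : W) (l : R) : Prop :=
  (fun h : R => h^-1 * (f (p + h *: v) - f p))
    @ within [set h : R | D (p + h *: v)] 0^' --> l.

(* All iterated derivatives up to order k along directions in S exist and are
   continuous on D. *)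
Fixpoint Ck_along (S : set W) (k : nat) (D : set W) (f : W -> R) : Prop :=
  {within D, continuous f} /\
  match k with
  | 0%N => True
  | k'.+1 => forall v : W, S v -> exists2 f' : W -> R,
      Ck_along S k' D f' & forall p, D p -> deriv_within D f p v (f' p)
  end.

Definition Ck (k : nat) (D : set W) (f : W -> R) : Prop :=
  Ck_along setT k D f.

Definition Cinf (D : set W) (f : W -> R) : Prop := forall k, Ck k D f.

End differentiability.

Arguments deriv_within {R} W D f p v l.
Arguments Ck_along {R} W S k D f.
Arguments Ck {R} W k D f.
Arguments Cinf {R} W D f.

(* Second countability is not listed: it follows from compactness. *)
Record closed_oriented_manifold (R : realType) (n : nat) := Manifold {
  carrier :> topologicalType ;
  manifold_hausdorff : hausdorff_space carrier ;
  manifold_compact : compact [set: carrier] ;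
  chart : Type ;
  dom : chart -> set carrier ;
  coord : chart -> carrier -> 'rV[R]_n ;
  param : chart -> 'rV[R]_n -> carrier ;
  dom_open : forall i, open (dom i) ;
  dom_cover : forall x, exists i, dom i x ;
  coordK : forall i x, dom i x -> param i (coord i x) = x ;
  coord_image_open : forall i, open (coord i @` dom i) ;
  coord_continuous : forall i, {within dom i, continuous (coord i)} ;
  param_continuous : forall i,
    {within coord i @` dom i, continuous (param i)} ;
  transition_smooth : forall i j (c : 'I_n),
    Cinf 'rV[R]_n (coord i @` (dom i `&` dom j))
      (fun y => coord j (param i y) 0 c) ;
  transition_oriented : forall i j x, dom i x -> dom j x ->
    0 < \det (jacobian (coord j \o param i) (coord i x))
}.

Section manifold.
Context (R : realType) (n : nat) (M : closed_oriented_manifold R n).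

(* Row c, column d: the derivative of the d-th coordinate of chart j with
   respect to the c-th coordinate of chart i. *)
Definition chart_jac (i j : chart M) (x : M) : 'M[R]_n :=
  jacobian (coord j \o param i) (coord i x).

Definition partial (i : chart M) (c : 'I_n) (f : M -> R) (x : M) : R :=
  'D_(delta_mx 0 c) (fun y : 'rV[R]_n => f (param i y)) (coord i x).

Definition fun_Ck (k : nat) (O : set M) (f : M -> R) : Prop :=
  forall i : chart M,
    Ck 'rV[R]_n k (coord i @` (O `&` dom i)) (fun y => f (param i y)).

(* The corner points of a cylinder O x [a, b] are covered by the one-sided
   time derivatives of deriv_within. *)
Definition fun_time_Cinf (a b : R) (O : set M) (f : R -> M -> R) : Prop :=
  forall i : chart M,
    Cinf ('rV[R]_n * R^o)%type ((coord i @` (O `&` dom i)) `*` `[a, b])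
      (fun p => f p.2 (param i p.1)).

End manifold.

(* A family of Riemannian metrics g(t), t in [0, T], given by its matrices
   (g_cd) in the charts, with the transformation law of a covariant tensor. *)
Record metric_family (R : realType) (n : nat)
    (M : closed_oriented_manifold R n) (T : R) := MetricFamily {
  gmx :> R -> chart M -> M -> 'M[R]_n ;
  gmx_sym : forall t i x, 0 <= t <= T -> dom i x ->
    (gmx t i x)^T = gmx t i x ;
  gmx_pos : forall t i x (v : 'rV[R]_n), 0 <= t <= T -> dom i x -> v != 0 ->
    0 < (v *m gmx t i x *m v^T) 0 0 ;
  gmx_tensor : forall t i j x, 0 <= t <= T -> dom i x -> dom j x ->
    gmx t i x = chart_jac i j x *m gmx t j x *m (chart_jac i j x)^T ;
  gmx_smooth : forall i c d,
    fun_time_Cinf 0 T (dom i) (fun t x => gmx t i x c d)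
}.

(* Coefficients of an affine connection D(t) on TM:
   D_b (d/dx^c) = \sum_d Gam t i x b c d (d/dx^d) in the chart i; on T^*M this
   reads D_b (dx^d) = - \sum_c Gam t i x b c d dx^c. *)
Definition christoffel (R : realType) (n : nat)
    (M : closed_oriented_manifold R n) : Type :=
  R -> chart M -> M -> 'I_n -> 'I_n -> 'I_n -> R.

(* Torsion-free and metric; this determines the coefficients on the charts,
   hence also their transformation law and their smoothness. *)
Definition levi_civita (R : realType) (n : nat)
    (M : closed_oriented_manifold R n) (T : R) (g : metric_family M T)
    (Gam : christoffel M) : Prop :=
  forall t i x, 0 <= t <= T -> dom i x ->
    (forall b c d, Gam t i x b c d = Gam t i x c b d) /\
    (forall b c d,
      partial i b (fun y => g t i y c d) x =
        \sum_e (Gam t i x b c e * g t i x e d) +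
        \sum_e (Gam t i x b d e * g t i x c e)).

Record vector_bundle (R : realType) (n : nat)
    (M : closed_oriented_manifold R n) (k : nat) := VectorBundle {
  fiber :> M -> lmodType R ;
  tindex : Type ;
  tdom : tindex -> set M ;
  triv : tindex -> forall x, fiber x -> 'rV[R]_k ;
  frame : tindex -> forall x, 'rV[R]_k -> fiber x ;
  tdom_open : forall a, open (tdom a) ;
  tdom_cover : forall x, exists a, tdom a x ;
  triv_linear : forall a x (c : R) (v w : fiber x), tdom a x ->
    triv a (c *: v + w) = c *: triv a v + triv a w ;
  trivK : forall a x, tdom a x -> cancel (@triv a x) (@frame a x) ;
  frameK : forall a x, tdom a x -> cancel (@frame a x) (@triv a x) ;
  cocycle_smooth : forall a b (d e : 'I_k) (i : chart M),
    Cinf 'rV[R]_n (coord i @` (tdom a `&` tdom b `&` dom i))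
      (fun y => triv b (frame a (param i y) (delta_mx 0 d)) 0 e)
}.

Arguments triv {R n M k} v a {x} : rename.
Arguments frame {R n M k} v a x : rename.
Arguments tdom {R n M k} v a : rename.

Record total_space (R : realType) (n k : nat) (M : closed_oriented_manifold R n)
    (V : vector_bundle M k) := Vec { base : M ; vec : V base }.

Arguments Vec {R n k M V} base vec.

Section total_topology.
Context (R : realType) (n k : nat) (M : closed_oriented_manifold R n).
Context (V : vector_bundle M k).

HB.instance Definition _ := gen_eqMixin (total_space V).
HB.instance Definition _ := gen_choiceMixin (total_space V).

(* The topology glued from the products (tdom a) x R^k. *)
Definition total_open (S : set (total_space V)) : Prop :=
  forall a : tindex V, open [set p : M * 'rV[R]_k |
    tdom V a p.1 /\ S (Vec p.1 (frame V a p.1 p.2))].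

Lemma total_openT : total_open setT.
Proof.
move=> a; rewrite (_ : [set _ | _] = fst @^-1` tdom V a).
  apply: open_comp; last exact: tdom_open.
  by move=> ? _; exact: cvg_fst.
by apply/seteqP; split => p //= [].
Qed.

Lemma total_openI : setI_closed total_open.
Proof.
move=> A B oA oB a; have := openI (oA a) (oB a).
by congr open; apply/seteqP; split => p /=; tauto.
Qed.

Lemma total_open_bigU (J : Type) (f : J -> set (total_space V)) :
  (forall j, total_open (f j)) -> total_open (\bigcup_j f j).
Proof.
move=> of_ a; have := bigcup_open (fun j (_ : setT j) => of_ j a).
congr open; apply/seteqP; split => p /=; first by move=> [j _ [? ?]]; split => //; exists j.
by move=> [? [j _ ?]]; exists j.
Qed.

HB.instance Definition _ := isOpenTopological.Build (total_space V)
  total_openT total_openI total_open_bigU.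

Definition section_of : Type := forall x : M, V x.

(* Only the restriction of s to the open set O matters. *)
Definition sec_Ck (m : nat) (O : set M) (s : section_of) : Prop :=
  forall i (a : tindex V) (e : 'I_k),
    Ck 'rV[R]_n m (coord i @` (O `&` tdom V a `&` dom i))
      (fun y => triv V a (s (param i y)) 0 e).

Definition sec_Cinf (O : set M) (s : section_of) : Prop :=
  forall m, sec_Ck m O s.

Definition sec_time_Cinf (a b : R) (O : set M) (s : R -> section_of) : Prop :=
  forall i (al : tindex V) (e : 'I_k),
    Cinf ('rV[R]_n * R^o)%type
      ((coord i @` (O `&` tdom V al `&` dom i)) `*` `[a, b])
      (fun p => triv V al (s p.2 (param i p.1)) 0 e).

(* C^2 in space, C^1 in time, jointly continuous with these derivatives, up to
   the end points of [a, b]. *)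
Definition sec_C21 (a b : R) (s : R -> section_of) : Prop :=
  forall i (al : tindex V) (e : 'I_k),
    let D := (coord i @` (tdom V al `&` dom i)) `*` `[a, b] in
    let f := fun p : 'rV[R]_n * R^o => triv V al (s p.2 (param i p.1)) 0 e in
    Ck_along ('rV[R]_n * R^o)%type [set v | v.2 = 0] 2 D f /\
    Ck ('rV[R]_n * R^o)%type 1 D f.

Definition frame_section (a : tindex V) (d : 'I_k) : section_of :=
  fun x => frame V a x (delta_mx 0 d).

(* Sections of V (x) T^*M: w i c is the value on the c-th coordinate field of
   the chart i, meaningful on dom i. *)
Definition form1 : Type := chart M -> 'I_n -> section_of.

End total_topology.

Record bundle_metric (R : realType) (n k : nat)
    (M : closed_oriented_manifold R n) (V : vector_bundle M k) := BundleMetric {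
  hprod :> forall x, V x -> V x -> R ;
  hprod_sym : forall x (v w : V x), hprod v w = hprod w v ;
  hprod_linear : forall x (c : R) (v v' w : V x),
    hprod (c *: v + v') w = c * hprod v w + hprod v' w ;
  hprod_pos : forall x (v : V x), v != 0 -> 0 < hprod v v ;
  hprod_smooth : forall (a : tindex V) (d e : 'I_k) m,
    fun_Ck m (tdom V a)
      (fun x => hprod (frame_section a d x) (frame_section a e x))
}.

Definition hnorm (R : realType) (n k : nat) (M : closed_oriented_manifold R n)
    (V : vector_bundle M k) (h : bundle_metric V) (x : M) (v : V x) : R :=
  Num.sqrt (h x v v).

(* A smooth family of connections nabla(t) : Gamma(V) -> Gamma(V (x) T^*M);
   cov t s i c is the derivative of s along the c-th coordinate field of the
   chart i.  As usual the operator is extended, uniquely, from global smooth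
   sections to C^1 sections over open subsets O of M.  Sections are total
   functions and O is arbitrary, so locality is part of the Leibniz rule (take
   f to be the indicator function of O). *)
Record connection_family (R : realType) (n k : nat)
    (M : closed_oriented_manifold R n) (V : vector_bundle M k) (T : R) :=
  ConnectionFamily {
  cov :> R -> section_of V -> form1 V ;
  cov_tensor : forall t (O : set M) s i j c x, 0 <= t <= T ->
    open O -> sec_Ck 1 O s -> O x -> dom i x -> dom j x ->
    cov t s i c x = \sum_d chart_jac i j x c d *: cov t s j d x ;
  cov_add : forall t (O : set M) s s' i c x, 0 <= t <= T ->
    open O -> sec_Ck 1 O s -> sec_Ck 1 O s' -> O x -> dom i x ->
    cov t (fun y => s y + s' y) i c x = cov t s i c x + cov t s' i c x ;
  cov_leibniz : forall t (O : set M) f s i c x, 0 <= t <= T ->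
    open O -> fun_Ck 1 O f -> sec_Ck 1 O s -> O x -> dom i x ->
    cov t (fun y => f y *: s y) i c x =
      partial i c f x *: s x + f x *: cov t s i c x ;
  cov_smooth : forall (O : set M) s i c, open O -> sec_Cinf O s ->
    sec_time_Cinf 0 T (O `&` dom i) (fun t => cov t s i c)
}.

Section heat_equation.
Context (R : realType) (n k : nat) (M : closed_oriented_manifold R n).
Context (V : vector_bundle M k) (T : R).

Definition compatible (nabla : connection_family V T) (h : bundle_metric V) :
    Prop :=
  forall t (O : set M) (s s' : section_of V) i c x, 0 <= t <= T ->
    open O -> sec_Cinf O s -> sec_Cinf O s' -> O x -> dom i x ->
    partial i c (fun y => h y (s y) (s' y)) x =
      h x (nabla t s i c x) (s' x) + h x (s x) (nabla t s' i c x).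

(* Component (b, c) of the covariant derivative of w, for the connection
   induced on V (x) T^*M by nabla(t) and the affine connection Gam. *)
Definition nabla_hat (nabla : connection_family V T) (Gam : christoffel M)
    (t : R) (w : form1 V) (i : chart M) (b c : 'I_n) (x : M) : V x :=
  nabla t (w i c) i b x - \sum_d Gam t i x b c d *: w i d x.

(* The trace is taken with the inverse matrix (g^bc); it does not depend on
   the chart i around x. *)
Definition laplacian (g : metric_family M T) (nabla : connection_family V T)
    (Gam : christoffel M) (t : R) (s : section_of V) (i : chart M) (x : M) :
    V x :=
  \sum_b \sum_c
    invmx (g t i x) b c *: nabla_hat nabla Gam t (nabla t s) i b c x.

Definition smooth_curve (a b : R) (gam : R -> M) : Prop :=
  {within `[a, b], continuous gam} /\
  forall (i : chart M) (c : 'I_n),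
    Cinf R^o (`[a, b] `&` gam @^-1` dom i) (fun r => coord i (gam r) 0 c).

(* w is the covariant derivative at r of the section s along gam:  if
   s = \sum_d s^d e_d in a local frame, it is
   \sum_d (s^d)' e_d + \sum_c \sum_d (gam^c)' s^d nabla_c e_d. *)
Definition cov_along (nabla : connection_family V T) (t a b : R) (gam : R -> M)
    (s : forall r, V (gam r)) (r : R) (w : V (gam r)) : Prop :=
  forall (i : chart M) (al : tindex V),
    dom i (gam r) -> tdom V al (gam r) ->
    exists (dgam : 'rV[R]_n) (ds : 'rV[R]_k),
    [/\ forall c, deriv_within R^o `[a, b]
          (fun q => coord i (gam q) 0 c) r 1 (dgam 0 c),
        forall e, deriv_within R^o `[a, b]
          (fun q => triv V al (s q) 0 e) r 1 (ds 0 e) &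
        w = frame V al (gam r) ds +
          \sum_c \sum_d (dgam 0 c * triv V al (s r) 0 d) *:
            nabla t (frame_section al d) i c (gam r)].

Definition parallel_along (nabla : connection_family V T) (t a b : R)
    (gam : R -> M) (s : forall r, V (gam r)) : Prop :=
  forall r, a <= r <= b -> cov_along nabla t a b s (0 : V (gam r)).

Definition parallel_invariant (nabla : connection_family V T) (t : R)
    (K : set (total_space V)) : Prop :=
  forall (a b : R) (gam : R -> M) (s : forall r, V (gam r)), a < b ->
    smooth_curve a b gam -> parallel_along nabla t a b s ->
    K (Vec (gam a) (s a)) -> K (Vec (gam b) (s b)).

Definition fiber_of (K : set (total_space V)) (x : M) : set (V x) :=
  [set v | K (Vec x v)].

Definition fiber_closed (x : M) (C : set (V x)) : Prop :=
  forall a : tindex V, tdom V a x -> closed (triv V a @` C).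

(* u t i c x v stands for u(x,t)(v, dx^c), with dx^c in the chart i.  The first
   clause says that u is defined on V_x x T_x^*M, the second that it is of
   diagonal form with smooth coefficients. *)
Definition smooth_diagonal
    (u : R -> chart M -> 'I_n -> forall x, V x -> V x) : Prop :=
  (forall t i j c x (v : V x), 0 <= t <= T -> dom i x -> dom j x ->
    u t j c x v = \sum_d chart_jac i j x d c *: u t i d x v) /\
  forall i, exists uc : 'I_n -> R -> M -> R,
    (forall c, fun_time_Cinf 0 T (dom i) (uc c)) /\
    (forall t c x (v : V x), 0 <= t <= T -> dom i x ->
      u t i c x v = uc c t x *: v).

(* F(x, v, t) matters only for (x, v) in U and t in [0, T]. *)
Definition continuous_field (U : set (total_space V))
    (F : forall x, V x -> R -> V x) : Prop :=
  {within [set p : total_space V * R | U p.1 /\ 0 <= p.2 <= T],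
    continuous (fun p => Vec (base p.1) (F (base p.1) (vec p.1) p.2))}.

(* Lipschitz along the fibres, locally uniformly on U x [0, T]. *)
Definition lipschitz_field (h : bundle_metric V) (U : set (total_space V))
    (F : forall x, V x -> R -> V x) : Prop :=
  forall p : total_space V * R, U p.1 -> 0 <= p.2 <= T ->
  exists2 N : set (total_space V * R), nbhs p N & exists L : R,
    forall x (v w : V x) t, 0 <= t <= T ->
      U (Vec x v) -> U (Vec x w) -> N (Vec x v, t) -> N (Vec x w, t) ->
      hnorm h (F x v t - F x w t) <= L * hnorm h (v - w).

Definition fiber_deriv (J : set R) (x : M) (s : R -> V x) (t : R) (w : V x) :
    Prop :=
  forall (a : tindex V) (e : 'I_k), tdom V a x ->
    deriv_within R^o J (fun q => triv V a (s q) 0 e) t 1 (triv V a w 0 e).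

Definition ode_solution (U : set (total_space V)) (F : forall x, V x -> R -> V x)
    (J : set R) (x : M) (s : R -> V x) : Prop :=
  forall t, J t -> U (Vec x (s t)) /\ fiber_deriv J s t (F x (s t) t).

Definition pde_solution (U : set (total_space V)) (g : metric_family M T)
    (Gam : christoffel M) (nabla : connection_family V T)
    (u : R -> chart M -> 'I_n -> forall x, V x -> V x)
    (F : forall x, V x -> R -> V x) (t0 : R) (s : R -> section_of V) : Prop :=
  [/\ sec_C21 t0 T s,
      forall t x, t0 <= t <= T -> U (Vec x (s t x)) &
      forall t i x, t0 <= t <= T -> dom i x ->
        fiber_deriv `[t0, T] (fun q => s q x) t
          (laplacian g nabla Gam t (s t) i x +
           \sum_c u t i c x (nabla t (s t) i c x) +
           F x (s t x) t)].

End heat_equation.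

Arguments fiber_of {R n k M V} K x.

(* Main.v *)
(* For small E > 0 put rho(t) = E exp(c (t - t0)), where c exceeds a constant
   given by the Lipschitz bound of F near the graph of sigma.  The claim is that
   at every time t each sigma(x, t) lies within squared distance rho(t) of
   K_x(t); letting E tend to 0 gives the theorem.

   The claim propagates from the left because the track of K is closed.  It
   propagates to the right from t1 by an argument local in x0, and then by
   compactness of M.  Since sigma keeps a positive distance from the avoidance
   sets, an ODE solution starting in K_x(t1) near sigma(x, t1) stays in K as long
   as it stays near sigma.
   - If K_x0(t1) has a point at squared distance < rho(t1), parallel translation
     carries it to the nearby fibres; flowing it by the ODE and continuity give
     the bound for a short time.
   - Otherwise let y be the nearest point of K_x0(t1) and N = sigma - y.  As K_x0
     is convex, y is unique and points of K_x(t1) within the bound are close to y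
     when x is close to x0.  Translating N parallelly along a line through x0, the
     function <sigma, N> is maximal at x0, since K is invariant under parallel
     translation and sigma has distance at most |N| from K.  Hence
     <nabla sigma, N> = 0 and <Delta sigma, N> <= 0 at x0, which together with the
     Lipschitz bound gives d/dt |sigma - Y|^2 < c rho for ODE solutions Y starting
     near y. *)

Require Import Defs.
From HB Require Import structures.
From mathcomp Require Import all_boot all_order all_algebra.
From mathcomp Require Import all_classical all_reals all_analysis.
From mathcomp Require Import zify ring lra.
Import Order.TTheory GRing.Theory Num.Theory.
Import numFieldNormedType.Exports.
(* Imported again: vector.coord would hide the chart map coord. *)
Require Import Defs.

Set Implicit Arguments.
Unset Strict Implicit.
Unset Printing Implicit Defensive.

Local Open Scope classical_set_scope.
Local Open Scope ring_scope.

(** * Derivatives within a set *)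

(** Of the time dependence of K(t) only the closedness of the track is known, so the distance to
    K_x(t) cannot be differentiated in time, and the hypothesis on the motion of K(t) speaks of ODE
    solutions only. The barrier is therefore expressed by witnesses: a point of K_x(t) close to
    sigma, obtained by flowing a point of K_x(t1). Only the distance between two known curves in one
    fibre is ever differentiated. The Laplacian is controlled only at a base point x0 where the
    bound is attained. At the other x the slope estimate is transferred by continuity, so existence
    times and estimates have to be uniform for x near x0. The avoidance sets restrict E: the
    argument works only in a tube of squared radius delta around sigma, so rho has to stay below
    delta up to time T. The constant is c = 1/delta + 2. The term 2<F(sigma) - F(y), N> is at most
    |F(sigma) - F(y)|^2 + |N|^2, which yields 1/delta + 1 times rho; the last 1 is the room for
    passing from (x0, t1) to nearby points. *)

Section deriv_within_theory.
Context (R : realType) (W : normedModType R).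
Implicit Types (D : set W) (f g : W -> R) (p v : W) (l : R).

(** Multiplying the difference quotient by h turns the limit into a bound on a remainder. The
    calculus rules below are proved in this division-free form. *)
Lemma deriv_withinP D f p v l : deriv_within W D f p v l <->
  forall e : R, 0 < e -> \forall h \near (0 : R)^',
    D (p + h *: v) -> `|f (p + h *: v) - f p - h * l| <= e * `|h|.
Proof.
rewrite /deriv_within; split => [/cvgrPdist_le H e e0|H].
  have := H _ e0; rewrite nearE /within /= => He.
  near=> h => Dh.
  have h0 : h != 0 by near: h; exact: nbhs_dnbhs_neq.
  have Hh : `|h^-1 * (f (p + h *: v) - f p) - l| <= e.
    by rewrite distrC; apply: (near He h).
  have -> : f (p + h *: v) - f p - h * l =
      h * (h^-1 * (f (p + h *: v) - f p) - l).
    by field.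
  by rewrite normrM mulrC ler_pM2r ?normr_gt0.
apply/cvgrPdist_le => e e0; rewrite nearE /within /=.
have He := H _ e0; near=> h => Dh.
have h0 : h != 0 by near: h; exact: nbhs_dnbhs_neq.
have Hh : `|f (p + h *: v) - f p - h * l| <= e * `|h| by apply: (near He h).
have -> : l - h^-1 * (f (p + h *: v) - f p) =
    - (h^-1 * (f (p + h *: v) - f p - h * l)).
  by field.
by rewrite normrN normrM normfV ler_pdivrMl ?normr_gt0// (mulrC `|h|).
Unshelve. all: by end_near. Qed.

Lemma deriv_within_sub D D' f g p v l : D' `<=` D -> D' p ->
  (forall q, D' q -> f q = g q) ->
  deriv_within W D f p v l -> deriv_within W D' g p v l.
Proof.
move=> DD Dp fg /deriv_withinP H; apply/deriv_withinP => e /H.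
by apply: filterS => h + Dh; rewrite -!fg//; apply; exact: DD.
Qed.

Lemma deriv_within_cst D (c : R) p v : deriv_within W D (fun=> c) p v 0.
Proof.
apply/deriv_withinP => e e0; apply: nearW => h _.
by rewrite subrr mulr0 subr0 normr0 mulr_ge0// ltW.
Qed.

Lemma deriv_withinD D f g p v l m : deriv_within W D f p v l ->
  deriv_within W D g p v m ->
  deriv_within W D (fun q => f q + g q) p v (l + m).
Proof.
move=> /deriv_withinP Hf /deriv_withinP Hg; apply/deriv_withinP => e e0.
have e20 : 0 < e / 2 by rewrite divr_gt0.
have Hf' := Hf _ e20; have Hg' := Hg _ e20.
near=> h => Dh.
have A : `|f (p + h *: v) - f p - h * l| <= e / 2 * `|h| by apply: (near Hf' h).
have B : `|g (p + h *: v) - g p - h * m| <= e / 2 * `|h| by apply: (near Hg' h).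
rewrite [X in `|X|](_ : _ = (f (p + h *: v) - f p - h * l) +
  (g (p + h *: v) - g p - h * m)); last by ring.
by rewrite (le_trans (ler_normD _ _))//; lra.
Unshelve. all: by end_near. Qed.

Lemma deriv_within_along D f p v l : deriv_within W D f p v l ->
  forall e : R, 0 < e -> \forall h \near (0 : R)^',
    D (p + h *: v) -> `|f (p + h *: v) - f p| <= e.
Proof.
move=> /deriv_withinP Hf e e0; have Hf' := Hf _ ltr01.
near=> h => Dh.
have A : `|f (p + h *: v) - f p - h * l| <= 1 * `|h| by apply: (near Hf' h).
have -> : f (p + h *: v) - f p = (f (p + h *: v) - f p - h * l) + h * l by ring.
rewrite (le_trans (ler_normD _ _))// normrM.
apply: (@le_trans _ _ (`|h| * (1 + `|l|))); first by lra.
rewrite -ler_pdivlMr; last by rewrite ltr_pwDl.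
near: h; apply: dnbhs0_le; rewrite divr_gt0// ltr_pwDl//.
Unshelve. all: by end_near. Qed.

Lemma deriv_withinM D f g p v l m : deriv_within W D f p v l ->
  deriv_within W D g p v m ->
  deriv_within W D (fun q => f q * g q) p v (l * g p + f p * m).
Proof.
move=> Hf Hg; apply/deriv_withinP => e e0.
(* [C] dominates the coefficients of the remainder terms in the splitting of F G - f g below;
   [e' <= 1] is needed for the term that is a product of two small factors. *)
set C := 1 + `|f p| + `|g p| + `|m|.
have C0 : 0 < C by rewrite /C; have := normr_ge0 (f p); have := normr_ge0 (g p);
  have := normr_ge0 m; lra.
set e' := Num.min 1 (e / (3 * C)).
have e'0 : 0 < e' by rewrite /e' lt_min ltr01/= divr_gt0// mulr_gt0.
have He' : 3 * C * e' <= e.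
  by rewrite -ler_pdivlMl ?mulr_gt0// mulrC /e' ge_min lexx orbT.
have He'1 : e' <= 1 by rewrite /e' ge_min lexx.
have Hf' := (deriv_withinP _ _ _ _ _).1 Hf _ e'0.
have Hg' := (deriv_withinP _ _ _ _ _).1 Hg _ e'0.
have Hc := deriv_within_along Hf e'0.
near=> h => Dh.
have A : `|f (p + h *: v) - f p - h * l| <= e' * `|h| by apply: (near Hf' h).
have B : `|g (p + h *: v) - g p - h * m| <= e' * `|h| by apply: (near Hg' h).
have E : `|f (p + h *: v) - f p| <= e' by apply: (near Hc h).
set F := f (p + h *: v) in A E *; set G := g (p + h *: v) in B *.
have -> : F * G - f p * g p - h * (l * g p + f p * m) =
   (F - f p - h * l) * g p + (F - f p) * (G - g p - h * m)
   + (f p * (G - g p - h * m) + (F - f p) * (h * m)) by ring.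
have h0 := normr_ge0 h.
have t1 : `|(F - f p - h * l) * g p| <= e' * C * `|h|.
  rewrite normrM (_ : e' * C * `|h| = e' * `|h| * C); last by ring.
  apply: ler_pM => //; rewrite /C;
  have := normr_ge0 (f p); have := normr_ge0 m; lra.
have t2 : `|(F - f p) * (G - g p - h * m)| + `|f p * (G - g p - h * m)|
    <= e' * `|h| * (1 + `|f p|).
  rewrite !normrM -mulrDl mulrC.
  by rewrite ler_pM// ?addr_ge0// lerD2r (le_trans E).
have t3 : `|(F - f p) * (h * m)| <= e' * `|h| * `|m|.
  by rewrite !normrM mulrA ler_wpM2r// ler_wpM2r.
have t4 : 3 * C * e' * `|h| <= e * `|h| by rewrite ler_wpM2r.
have t5 : e' * `|h| * (1 + `|f p|) + e' * `|h| * `|m| <= e' * `|h| * C.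
  rewrite -mulrDr ler_wpM2l// ?mulr_ge0 ?(ltW e'0)// /C.
  by have := normr_ge0 (g p); lra.
have t6 : 0 <= e' * C * `|h| by rewrite !mulr_ge0// ltW.
rewrite (le_trans (ler_normD _ _))//.
apply: (@le_trans _ _ ((`|(F - f p - h * l) * g p| +
  `|(F - f p) * (G - g p - h * m)|) + (`|f p * (G - g p - h * m)| +
  `|(F - f p) * (h * m)|))).
  by rewrite lerD// ler_normD.
lra.
Unshelve. all: by end_near. Qed.

Lemma deriv_withinZ D f p v l (c : R) : deriv_within W D f p v l ->
  deriv_within W D (fun q => c * f q) p v (c * l).
Proof.
move=> Hf; have := deriv_withinM (deriv_within_cst D c p v) Hf.
by rewrite mul0r add0r.
Qed.

Lemma deriv_withinB D f g p v l m : deriv_within W D f p v l ->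
  deriv_within W D g p v m ->
  deriv_within W D (fun q => f q - g q) p v (l - m).
Proof.
move=> Hf /(deriv_withinZ (c := -1)) /(deriv_withinD Hf).
by rewrite mulN1r; under eq_fun do rewrite mulN1r.
Qed.

Lemma deriv_within_sum (I : Type) (r : seq I) (P : pred I) D
    (f : I -> W -> R) p v (l : I -> R) :
  (forall i, deriv_within W D (f i) p v (l i)) ->
  deriv_within W D (fun q => \sum_(i <- r | P i) f i q) p v
    (\sum_(i <- r | P i) l i).
Proof.
move=> H; elim: r => [|i r IH].
  by under eq_fun do rewrite big_nil; rewrite big_nil; exact: deriv_within_cst.
under eq_fun do rewrite big_cons; rewrite big_cons.
by case: (P i) => //; exact: (deriv_withinD (H i) IH).
Qed.

Lemma deriv_within_dirZ D f p v l (c : R) : deriv_within W D f p v l ->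
  deriv_within W D f p (c *: v) (c * l).
Proof.
move=> /deriv_withinP H; apply/deriv_withinP => e e0.
have [->|c0] := eqVneq c 0.
  apply: nearW => h _; rewrite scale0r scaler0 addr0 subrr mul0r mulr0 subr0.
  by rewrite normr0 mulr_ge0// ltW.
have e'0 : 0 < e / `|c| by rewrite divr_gt0// normr_gt0.
have [d /= d0 Hd] := (H _ e'0).
exists (d / `|c|) => /=; first by rewrite divr_gt0// normr_gt0.
move=> h; rewrite /= sub0r normrN ltr_pdivlMr ?normr_gt0// => hd h0.
have := Hd (h * c); rewrite /= sub0r normrN normrM => /(_ hd).
rewrite mulf_neq0// scalerA => /(_ isT) /[apply].
have -> : e * `|h| = e / `|c| * (`|h| * `|c|) by field; rewrite normr_eq0.
by rewrite (mulrA h c l).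
Qed.

Lemma deriv_within_unique D f p v l m :
  ProperFilter (within [set h : R | D (p + h *: v)] 0^') ->
  deriv_within W D f p v l -> deriv_within W D f p v m -> l = m.
Proof. by move=> PF; exact: cvg_unique. Qed.

End deriv_within_theory.

Lemma deriv_within_affine (R : realType) (W W' : normedModType R)
    (D : set W) (D' : set W') (phi : W' -> W) (f : W -> R)
    (q v' : W') (v : W) (l : R) :
  (forall h, phi (q + h *: v') = phi q + h *: v) ->
  (forall q', D' q' -> D (phi q')) ->
  deriv_within W D f (phi q) v l -> deriv_within W' D' (f \o phi) q v' l.
Proof.
move=> phiE DD /deriv_withinP H; apply/deriv_withinP => e /H.
apply: filterS => h + /DD; rewrite /= phiE; exact.
Qed.

(** Near a point of an open set the restriction to [D] is void. This gives access to the mean value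
    theorem and to the fundamental theorem of calculus. *)
Lemma deriv_within_openP (R : realType) (W : normedModType R) (D : set W)
    (f : W -> R) (p v : W) (l : R) : open D -> D p ->
  deriv_within W D f p v l <-> is_derive p v f l.
Proof.
move=> oD Dp.
have nD : \forall h \near (0 : R), D (p + h *: v).
  have cont : (fun h : R => p + h *: v) @ (0 : R) --> p.
    rewrite -[X in _ --> X]addr0 -[X in _ --> _ + X](scale0r v).
    by apply: cvgD; [exact: cvg_cst|apply: cvgZr_tmp; exact: cvg_id].
  by apply: cont; rewrite -/(nbhs p D); exact: open_nbhs_nbhs.
have nD' : (0 : R)^' [set h | D (p + h *: v)] by exact: nbhs_dnbhs.
split=> [H|[df dfl]].
  have : (fun h : R => h^-1 *: ((f \o shift p) (h *: v) - f p)) @ (0 : R)^' --> l.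
    move/deriv_withinP : H => H; apply/cvgrPdist_le => e /H {}H.
    near=> h.
    have h0 : h != 0 by near: h; exact: nbhs_dnbhs_neq.
    have Dh : D (p + h *: v) by near: h.
    have Hh : `|f (p + h *: v) - f p - h * l| <= e * `|h| by apply: (near H h).
    have -> : l - h^-1 *: ((f \o shift p) (h *: v) - f p) =
        - (h^-1 * (f (p + h *: v) - f p - h * l)).
      by rewrite /= (addrC _ p) /GRing.scale /=; field.
    by rewrite normrN normrM normfV ler_pdivrMl ?normr_gt0// (mulrC `|h|).
  move=> Hl; split; first by apply/cvg_ex; exists l.
  exact: cvg_lim.
have : (fun h : R => h^-1 *: ((f \o shift p) (h *: v) - f p)) @ (0 : R)^' --> l.
  by rewrite -dfl.
move/cvgrPdist_le => H; apply/deriv_withinP => e /H {}H; near=> h => Dh.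
have h0 : h != 0 by near: h; exact: nbhs_dnbhs_neq.
have Hh : `|l - h^-1 *: ((f \o shift p) (h *: v) - f p)| <= e by apply: (near H h).
have -> : f (p + h *: v) - f p - h * l =
    - (h * (l - h^-1 *: ((f \o shift p) (h *: v) - f p))).
  by rewrite /= (addrC _ p) /GRing.scale /=; field.
by rewrite normrN normrM mulrC ler_wpM2r.
Unshelve. all: by end_near. Qed.

(** * Derivatives on a closed interval, one-sided at the end points *)

Section segment.
Context (R : realType) (a b : R).
Implicit Types f g : R -> R.

Lemma segment_deriv_proper (r : R) : a < b -> a <= r <= b ->
  ProperFilter (within [set h : R | `[a, b]%classic (r + h *: (1 : R^o))] 0^').
Proof.
move=> ab /andP[ar rb]; apply: Build_ProperFilter_ex => A.
rewrite /within /= => -[d /= d0 Hd].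
(* With [m] at most half the length of the segment, at least one of r + m and r - m stays in it,
   also when r is an end point. *)
pose m := Num.min (d / 2) ((b - a) / 2).
have m0 : 0 < m by rewrite lt_min !divr_gt0// subr_gt0.
have [md mb] : m <= d / 2 /\ m <= (b - a) / 2.
  by rewrite /m !ge_min !lexx orbT.
have dd : d / 2 < d by rewrite ltr_pdivrMr// ltr_pMr// ltr1n.
have Hm : forall h, `|h| = m -> h != 0 -> a <= r + h <= b -> A h.
  move=> h hm h0 hab; apply: (Hd h) => //=.
    by rewrite sub0r normrN hm (le_lt_trans md).
  by rewrite in_itv/= /GRing.scale/= mulr1.
have [rm|rm] := lerP (r + m) b.
  exists m; apply: Hm; rewrite ?gtr0_norm ?gt_eqF//; lra.
exists (- m); apply: Hm; rewrite ?normrN ?gtr0_norm ?oppr_eq0 ?gt_eqF//; lra.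
Qed.

Lemma segment_deriv_unique f (r l m : R) : a < b -> a <= r <= b ->
  deriv_within R^o `[a, b] f r 1 l -> deriv_within R^o `[a, b] f r 1 m -> l = m.
Proof.
by move=> ab rab; apply: deriv_within_unique; exact: segment_deriv_proper.
Qed.

Lemma segment_deriv_continuous f f' :
  (forall r, a <= r <= b -> deriv_within R^o `[a, b] f r 1 (f' r)) ->
  {within `[a, b], continuous f}.
Proof.
move=> H; apply/subspace_continuousP => r /=; rewrite in_itv/= => rab.
have /deriv_within_along {}H := H r rab.
apply/cvgrPdist_le => e e0; have [d /= d0 Hd] := H e e0.
rewrite nearE /within /=; exists d => //= s; rewrite /= distrC => rsd.
rewrite in_itv/= => sab.
have [->|srn] := eqVneq s r; first by rewrite subrr normr0 ltW.
rewrite distrC; have := Hd (s - r); rewrite /= sub0r normrN => /(_ rsd).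
rewrite subr_eq0 => /(_ srn); rewrite in_itv/= /GRing.scale/= mulr1 subrKC; exact.
Qed.

Lemma segment_deriv_interior f (r l : R) : a < r < b ->
  deriv_within R^o `[a, b] f r 1 l -> is_derive (r : R^o) (1 : R^o) f l.
Proof.
move=> rab H; have oI : open (`]a, b[%classic : set R^o) by exact: interval_open.
have rI : (`]a, b[%classic : set R^o) r by rewrite /= in_itv.
apply: (@deriv_within_openP R R^o _ f r 1 l oI rI).1.
apply: deriv_within_sub H => //.
by move=> s /=; rewrite !in_itv/= => /andP[? ?]; apply/andP; split; exact: ltW.
Qed.

Lemma segment_mean_value f f' : a < b ->
  (forall r, a <= r <= b -> deriv_within R^o `[a, b] f r 1 (f' r)) ->
  exists2 c, a < c < b & f b - f a = f' c * (b - a).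
Proof.
move=> ab H.
have [|c cab ->] := @MVT R f f' a b ab _ (segment_deriv_continuous H).
  move=> r; rewrite in_itv/= => /[dup] rab /andP[ar rb].
  by apply: segment_deriv_interior => //; apply: H; rewrite !ltW.
by exists c.
Qed.

Lemma segment_deriv_le f f' (c : R) : a <= b ->
  (forall r, a <= r <= b -> deriv_within R^o `[a, b] f r 1 (f' r)) ->
  (forall r, a <= r <= b -> f' r <= c) -> f b - f a <= c * (b - a).
Proof.
rewrite le_eqVlt => /predU1P[->|ab H Hc]; first by rewrite !subrr mulr0.
have [r /andP[ar rb] ->] := segment_mean_value ab H.
by apply: ler_wpM2r; [rewrite subr_ge0 ltW|apply: Hc; rewrite !ltW].
Qed.

Lemma segment_deriv_dist f f' (c : R) : a <= b ->
  (forall r, a <= r <= b -> deriv_within R^o `[a, b] f r 1 (f' r)) ->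
  (forall r, a <= r <= b -> `|f' r| <= c) -> `|f b - f a| <= c * (b - a).
Proof.
rewrite le_eqVlt => /predU1P[->|ab H Hc]; first by rewrite !subrr mulr0 normr0.
have [r /andP[ar rb] ->] := segment_mean_value ab H.
rewrite normrM [X in _ * X]ger0_norm; last by rewrite subr_ge0 ltW.
by apply: ler_wpM2r; [rewrite subr_ge0 ltW|apply: Hc; rewrite !ltW].
Qed.

End segment.

Lemma segment_deriv_sub (R : realType) (a b c d : R) (f : R -> R) (r l : R) :
  a <= c -> d <= b -> c <= r <= d ->
  deriv_within R^o `[a, b] f r 1 l -> deriv_within R^o `[c, d] f r 1 l.
Proof.
move=> ac db rcd; apply: deriv_within_sub => //.
  by move=> s /=; rewrite !in_itv/= => /andP[? ?]; apply/andP; split; lra.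
Qed.

(* If the second derivative at the maximum were positive, the first derivative
   would be positive just after 0 and f would increase. *)
Lemma deriv2_le0_at_max (R : realType) (f f' : R -> R) (l : R) :
  (forall r, 0 <= r <= 1 -> deriv_within R^o `[0, 1] f r 1 (f' r)) ->
  f' 0 = 0 -> deriv_within R^o `[0, 1] f' 0 1 l ->
  (forall r, 0 <= r <= 1 -> f r <= f 0) -> l <= 0.
Proof.
move=> Hf f'0 /deriv_withinP Hl fmax; rewrite leNgt; apply/negP => l0.
have l20 : 0 < l / 2 by rewrite divr_gt0.
have [d /= d0 Hd] := Hl _ l20.
pose e := Num.min (d / 2) 1.
have e0 : 0 < e by rewrite lt_min ltr01 divr_gt0.
have [ed e1] : e <= d / 2 /\ e <= 1 by rewrite /e !ge_min !lexx orbT.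
have dd : d / 2 < d by rewrite ltr_pdivrMr// ltr_pMr// ltr1n.
have [|r /andP[r0 re]] := @segment_mean_value R 0 e f f' e0.
  by move=> r re; apply: (@segment_deriv_sub _ 0 1) => //; apply: Hf; lra.
have : f e - f 0 <= 0 by rewrite subr_le0 fmax// e1 ltW.
move=> /[swap] ->; rewrite subr0 pmulr_lle0// => f'r.
have := Hd r; rewrite /= sub0r normrN gtr0_norm// => /(_ _ (lt0r_neq0 r0)).
rewrite in_itv/= !add0r /GRing.scale/= mulr1 f'0 subr0 => /(_ _ _)/ler_normlP[||h _].
- by rewrite (lt_trans re)// (le_lt_trans ed).
- by apply/andP; split; lra.
- have : 0 < r * l by rewrite mulr_gt0.
  lra.
Qed.

Lemma deriv_le0_at_max (R : realType) (f : R -> R) (l : R) :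
  deriv_within R^o `[0, 1] f 0 1 l ->
  (forall r, 0 <= r <= 1 -> f r <= f 0) -> l <= 0.
Proof.
move=> /deriv_withinP Hl fmax; rewrite leNgt; apply/negP => l0.
have l20 : 0 < l / 2 by rewrite divr_gt0.
have [d /= d0 Hd] := Hl _ l20.
pose e := Num.min (d / 2) 1.
have e0 : 0 < e by rewrite lt_min ltr01 divr_gt0.
have [ed e1] : e <= d / 2 /\ e <= 1 by rewrite /e !ge_min !lexx orbT.
have dd : d / 2 < d by rewrite ltr_pdivrMr// ltr_pMr// ltr1n.
have := Hd e; rewrite /= sub0r normrN gtr0_norm// => /(_ _ (lt0r_neq0 e0)).
rewrite in_itv/= !add0r /GRing.scale/= mulr1 => /(_ _ _)/ler_normlP[||h _].
- by rewrite (le_lt_trans ed).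
- by apply/andP; split; lra.
- have : 0 < e * l by rewrite mulr_gt0.
  have : f e <= f 0 by rewrite fmax// e1 ltW.
  lra.
Qed.

(** * The Picard-Lindelof theorem *)

(** Row vectors carry the maximum norm, so vector estimates reduce to mean value estimates for real
    coordinates. *)
Lemma rV_norm_leP (R : realType) (k : nat) (v : 'rV[R]_k) (c : R) : 0 <= c ->
  `|v| <= c <-> forall e, `|v 0 e| <= c.
Proof.
move=> c0; rewrite [X in X <= _]/Num.norm/= mx_normrE; split=> [H e|H].
  by apply: le_trans H; apply: (le_bigmax _ (fun ij => `|v ij.1 ij.2|) (0, e)).
by rewrite bigmax_le// => -[i e] _ /=; rewrite (ord1 i).
Qed.

Lemma rV_norm_coord (R : realType) (k : nat) (v : 'rV[R]_k) e :
  `|v 0 e| <= `|v|.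
Proof. exact: (rV_norm_leP v (normr_ge0 v)).1. Qed.

(** Lets the geometric error of the Picard iterates tend to 0 inside an inequality. *)
Lemma le_half_powers (R : realType) (x y C : R) :
  (forall n : nat, x <= y + C * 2^-1 ^+ n) -> x <= y.
Proof.
move=> H; apply/ler_addgt0Pl => e e0.
have : geometric C (2^-1 : R) @ \oo --> (0 : R).
  by apply: cvg_geometric; rewrite ger0_norm ?invr_ge0// invf_lt1// ltr1n.
move/cvgrPdist_le => /(_ _ e0)[N _ HN]; have := HN N (leqnn N).
rewrite /= sub0r normrN => /ler_normlP[_ HNe].
by apply: (le_trans (H N)); rewrite addrC lerD2r.
Qed.

(** The retraction of the line onto [a, b]; composing with it extends a function continuous on the
    segment to one continuous on the whole line. *)
Definition clamp (R : realType) (a b r : R) : R := Num.min b (Num.max a r).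

Lemma clamp_itv (R : realType) (a b r : R) : a <= b -> a <= clamp a b r <= b.
Proof.
move=> ab; rewrite /clamp ge_min lexx/= andbT le_min ab/=.
by rewrite le_max lexx.
Qed.

Lemma clamp_id (R : realType) (a b r : R) : a <= r <= b -> clamp a b r = r.
Proof. by case/andP=> ar rb; rewrite /clamp max_r// min_r. Qed.

Lemma clamp_continuous (R : realType) (a b : R) : continuous (clamp a b).
Proof.
move=> r; apply: (@continuous_min R R (fun=> b) (fun r => Num.max a r)).
  exact: cst_continuous.
apply: (@continuous_max R R (fun=> a) id); first exact: cst_continuous.
by move=> ?; exact: cvg_id.
Qed.

Lemma segment_antiderivative (R : realType) (a b : R) (g : R -> R) : a <= b ->
  {within `[a, b], continuous g} ->
  exists G : R -> R, forall r, a <= r <= b ->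
    deriv_within R^o `[a, b] G r 1 (g r).
Proof.
move=> ab /subspace_continuousP gc.
have gcc : continuous (g \o clamp a b : R -> R).
  move=> r; have cr : (`[a, b]%classic : set R) (clamp a b r).
    by rewrite /= in_itv/= clamp_itv.
  have := gc _ cr; move/cvgrPdist_le => H; apply/cvgrPdist_le => e /H.
  rewrite nearE /within /= => {}H.
  have := @clamp_continuous R a b r; move=> /(_ _ H) Hn.
  have {}Hn : \forall s \near (r : R), clamp a b s \in `[a, b] ->
    `|g (clamp a b r) - g (clamp a b s)| <= e by exact: Hn.
  suff : \forall s \near (r : R), `|g (clamp a b r) - g (clamp a b s)| <= e by [].
  by apply: filterS Hn => s; apply; rewrite in_itv/= clamp_itv.
pose mu := @lebesgue_measure R.
(* Integrating from a - 1, and below up to b + 1, makes every r in [a, b] an interior point, so the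
   derivative is two-sided and can then be restricted. *)
pose G r : R := (\int[mu]_(t in `[a - 1, r]) (g \o clamp a b) t)%R.
exists G => r rab.
have [||||dG GE] := @continuous_FTC1_closed R (g \o clamp a b) (a - 1) r (b + 1).
- by case/andP: rab => _ rb; rewrite (le_lt_trans rb)// ltrDl.
- apply: continuous_compact_integrable; first exact: segment_compact.
  exact: continuous_subspaceT.
- by case/andP: rab => ar _; rewrite (lt_le_trans _ ar)// gtrDl oppr_lt0.
- exact: gcc.
have : is_derive (r : R^o) (1 : R^o) G (g r).
  apply: DeriveDef => //.
  by rewrite -derive1E GE /= clamp_id.
move/(@deriv_within_openP R R^o setT G r 1 (g r) openT I).2.
by apply: deriv_within_sub => //=; rewrite in_itv.
Qed.

Section picard.
Context (R : realType) (k : nat) (a b rho Mf L : R) (v0 : 'rV[R]_k).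
Context (f : R -> 'rV[R]_k -> 'rV[R]_k).
Hypotheses (ab : a <= b) (rho0 : 0 <= rho) (Mf0 : 0 <= Mf) (L0 : 0 <= L).
Hypothesis f_cont : forall v, `|v - v0| <= rho ->
  {within `[a, b], continuous (f^~ v)}.
Hypothesis f_lip : forall r v w, a <= r <= b -> `|v - v0| <= rho ->
  `|w - v0| <= rho -> `|f r v - f r w| <= L * `|v - w|.
Hypothesis f_bound : forall r v, a <= r <= b -> `|v - v0| <= rho ->
  `|f r v| <= Mf.
Hypotheses (Mf_small : Mf * (b - a) <= rho) (L_small : L * (b - a) <= 2^-1).

(** The curves on which the iteration acts. The Lipschitz bound in time makes [f r (Y r)] continuous
    in r, although [f] is assumed continuous in time only for a fixed vector. *)
Let admissible (Y : R -> 'rV[R]_k) :=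
  [/\ Y a = v0,
      forall r, a <= r <= b -> `|Y r - v0| <= Mf * (r - a) &
      forall r s, a <= r <= b -> a <= s <= b -> `|Y r - Y s| <= Mf * `|r - s|].

Let solves (Y Z : R -> 'rV[R]_k) := forall r e, a <= r <= b ->
  deriv_within R^o `[a, b] (fun q => Z q 0 e) r 1 (f r (Y r) 0 e).

Let admissible_ball Y : admissible Y -> forall r, a <= r <= b ->
  `|Y r - v0| <= rho.
Proof.
move=> [_ H _] r rab; apply: le_trans (H _ rab) _.
apply: le_trans Mf_small; apply: ler_wpM2l => //; lra.
Qed.

Let solves_le (y z : R -> R) (y' : R -> R) (c s : R) : a <= s <= b ->
  z a = y a ->
  (forall r, a <= r <= b ->
    deriv_within R^o `[a, b] (fun q => z q - y q) r 1 (y' r)) ->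
  (forall r, a <= r <= b -> `|y' r| <= c) -> `|z s - y s| <= c * (s - a).
Proof.
move=> /andP[as_ sb] za Hd Hc.
have := @segment_deriv_dist R a s (fun q => z q - y q) y' c as_.
rewrite za subrr subr0; apply=> r /andP[ar rs]; last by apply: Hc; lra.
by apply: (@segment_deriv_sub _ a b) => //; [lra|apply: Hd; lra].
Qed.

Let picard_step Y : admissible Y -> exists Z, admissible Z /\ solves Y Z.
Proof.
move=> aY; have [Ya Yb Yl] := aY.
have Yc e : {within `[a, b], continuous (fun r => f r (Y r) 0 e)}.
  apply/subspace_continuousP => r /= rab; move: (rab); rewrite in_itv/= => rab'.
  have /subspace_continuousP/(_ r rab) := f_cont (admissible_ball aY rab').
  move=> /cvgrPdist_le H; apply/cvgrPdist_le => d d0.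
  have d2 : 0 < d / 2 by rewrite divr_gt0.
  have := H _ d2; rewrite !nearE /within /= => {}H.
  have Ns : \forall s \near r, L * (Mf * `|r - s|) <= d / 2.
    have p0 : 0 < L * Mf + 1 by rewrite ltr_wpDl// mulr_ge0.
    have : \forall s \near r, `|r - s| < d / 2 / (L * Mf + 1).
      have := @cvg_id _ (nbhs (r : R)); move/cvgrPdist_lt; apply.
      by rewrite divr_gt0.
    apply: filterS => s; rewrite ltr_pdivlMr// => /ltW; apply: le_trans.
    by rewrite mulrA mulrC ler_wpM2l// lerDl.
  apply: filterS2 H Ns => s Hs Ls sab.
  have := rV_norm_coord (f r (Y r) - f s (Y s)) e.
  rewrite !mxE => /le_trans; apply.
  have sab' : a <= s <= b by move: sab; rewrite in_itv.
  rewrite -(subrKA (f s (Y r))) (le_trans (ler_normD _ _))// [leRHS](splitr d).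
  rewrite lerD ?Hs//; apply: le_trans Ls.
  apply: le_trans (f_lip sab' (admissible_ball aY rab') (admissible_ball aY sab')) _.
  by rewrite ler_wpM2l// Yl.
have G e := cid (segment_antiderivative ab (Yc e)).
pose Z r := \row_e (v0 0 e + (sval (G e) r - sval (G e) a)).
have ZE q e : Z q 0 e = v0 0 e + (sval (G e) q - sval (G e) a).
  by rewrite /Z mxE.
have HZ r e : a <= r <= b ->
    deriv_within R^o `[a, b] (fun q => Z q 0 e) r 1 (f r (Y r) 0 e).
  move=> rab.
  have := deriv_withinD (deriv_within_cst `[a, b] (v0 0 e - sval (G e) a) (r : R^o) 1)
    (svalP (G e) r rab).
  rewrite add0r; congr deriv_within; apply/funext => q; rewrite ZE; lra.
have Za : Z a = v0 by apply/rowP => e; rewrite ZE subrr addr0.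
have fY r e : a <= r <= b -> `|f r (Y r) 0 e| <= Mf.
  move=> rab; apply: le_trans (rV_norm_coord _ e) _.
  by apply: f_bound => //; exact: admissible_ball.
have Zl r s : a <= r -> r <= s -> s <= b -> `|Z s - Z r| <= Mf * `|s - r|.
  move=> ar rs sb; rewrite (ger0_norm (_ : 0 <= s - r)) ?subr_ge0//.
  apply/rV_norm_leP; first by rewrite mulr_ge0// subr_ge0.
  move=> e; rewrite !mxE.
  have := @segment_deriv_dist R r s (fun q => Z q 0 e) (fun q => f q (Y q) 0 e)
    Mf rs; rewrite !mxE; apply.
    by move=> q rqs; apply: (@segment_deriv_sub _ a b) => //; apply: HZ; lra.
  by move=> q rqs; apply: fY; lra.
exists Z; split=> [|r e]; last exact: HZ.
split=> [//|r /andP[ar rb]|r s /andP[ar rb] /andP[as_ sb]].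
  by rewrite -Za -[X in _ * X]ger0_norm ?subr_ge0// Zl.
by have [rs|/ltW sr] := leP r s; [rewrite distrC (distrC r)|]; exact: Zl.
Qed.

(** A chosen integral curve of [f r (Y r)] starting at [v0]. On curves that are not admissible the
    value [Y] is a placeholder. *)
Let step (Y : R -> 'rV[R]_k) : R -> 'rV[R]_k :=
  if pselect (admissible Y) is left aY then sval (cid (picard_step aY)) else Y.

Let stepP Y : admissible Y -> admissible (step Y) /\ solves Y (step Y).
Proof.
move=> aY; rewrite /step; case: pselect => // aY'.
exact: (svalP (cid (picard_step aY'))).
Qed.

(** Both images start at [v0] and their derivatives differ by at most L c, so after time b - a they
    differ by at most L (b - a) c, where L (b - a) is at most 1/2. *)
Let step_contraction Y Z (c : R) : admissible Y -> admissible Z -> 0 <= c ->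
  (forall r, a <= r <= b -> `|Y r - Z r| <= c) ->
  forall r, a <= r <= b -> `|step Y r - step Z r| <= c * 2^-1.
Proof.
move=> aY aZ c0 YZ s sab.
have [[Y'a _ _] Ys] := stepP aY; have [[Z'a _ _] Zs] := stepP aZ.
apply/rV_norm_leP; first by rewrite mulr_ge0.
move=> e; rewrite !mxE.
have := @solves_le (fun r => step Z r 0 e) (fun r => step Y r 0 e)
  (fun r => f r (Y r) 0 e - f r (Z r) 0 e) (L * c) s sab.
rewrite Y'a Z'a => /(_ erefl) H; apply: le_trans (H _ _) _.
- by move=> r rab; apply: deriv_withinB; [exact: Ys|exact: Zs].
- move=> r rab; have := rV_norm_coord (f r (Y r) - f r (Z r)) e.
  rewrite !mxE => /le_trans; apply.
  apply: le_trans (f_lip rab (admissible_ball aY rab) (admissible_ball aZ rab)) _.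
  by rewrite ler_wpM2l// YZ.
- rewrite mulrAC mulrC ler_wpM2l//; apply: le_trans L_small.
  by rewrite ler_wpM2l//; lra.
Qed.

Let y n := iter n step (fun=> v0).

Let y_admissible n : admissible (y n).
Proof.
elim: n => [|n /stepP[]//]; split=> //= [r /andP[ar _]|r s _ _].
  by rewrite subrr normr0 mulr_ge0// subr_ge0.
by rewrite subrr normr0 mulr_ge0.
Qed.

Let y_near n m r : a <= r <= b -> `|y n r - y (n + m) r| <= rho * 2^-1 ^+ n.
Proof.
move=> rab; elim: n r rab => [|n IH] r rab.
  rewrite add0n expr0 mulr1 distrC; exact: (admissible_ball (y_admissible m)).
rewrite addSn exprSr mulrA; apply: step_contraction rab => //.
by rewrite mulr_ge0// exprn_ge0// invr_ge0.
Qed.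

Let y_cvg r : a <= r <= b -> exists l, forall n, `|y n r - l| <= rho * 2^-1 ^+ n.
Proof.
move=> rab.
have geo : geometric rho (2^-1 : R) @ \oo --> (0 : R).
  by apply: cvg_geometric; rewrite ger0_norm ?invr_ge0// invf_lt1// ltr1n.
have : cvg ((fun n => y n r) @ \oo).
  apply: cauchy_cvg; apply/cauchy_exP => e e0.
  move/cvgrPdist_lt : geo => /(_ _ e0)[N _ HN].
  exists (y N r); exists N => // m /= Nm.
  rewrite -ball_normE /= -(subnKC Nm); apply: le_lt_trans (y_near _ _ rab) _.
  by have := HN N (leqnn N); rewrite /= sub0r normrN; exact: le_lt_trans (ler_norm _).
move=> /cvg_ex[l yl]; exists l => n; apply/ler_addgt0Pr => e e0.
move/cvgrPdist_le : yl => /(_ _ e0)[N _ HN].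
have /= := HN (n + N)%N (leq_addl _ _); rewrite distrC => HNl.
by rewrite -(subrKA (y (n + N) r)) (le_trans (ler_normD _ _))// lerD// y_near.
Qed.

Lemma picard_lindelof : exists Y : R -> 'rV[R]_k,
  [/\ Y a = v0,
      forall r, a <= r <= b -> `|Y r - v0| <= Mf * (r - a) &
      forall r e, a <= r <= b ->
        deriv_within R^o `[a, b] (fun q => Y q 0 e) r 1 (f r (Y r) 0 e)].
Proof.
have aa : a <= a <= b by rewrite lexx.
(* The pointwise limit of the iterates on [a, b]; [v0] is a placeholder elsewhere. *)
pose Y r := if pselect (a <= r <= b) is left rab then sval (cid (y_cvg rab)) else v0.
have yY n r : a <= r <= b -> `|y n r - Y r| <= rho * 2^-1 ^+ n.
  move=> rab; rewrite /Y; case: pselect => // rab'.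
  exact: (svalP (cid (y_cvg rab'))).
have aY : admissible Y.
  split.
  - apply/eqP; rewrite eq_sym -subr_eq0 -normr_le0; apply: (le_half_powers (C := rho)) => n.
    by rewrite add0r; have [ya _ _] := y_admissible n; have := yY n a aa; rewrite ya.
  - move=> r rab; apply: (le_half_powers (C := rho)) => n.
    have [_ yb _] := y_admissible n.
    rewrite -(subrKA (y n r)) (le_trans (ler_normD _ _))// addrC lerD//.
      exact: yb.
    by rewrite distrC yY.
  - move=> r s rab sab; apply: (le_half_powers (C := rho + rho)) => n.
    have [_ _ yl] := y_admissible n.
    have -> : Y r - Y s = (y n r - y n s) + ((Y r - y n r) + (y n s - Y s)).
      by apply/rowP => e; rewrite !mxE; ring.
    rewrite (le_trans (ler_normD _ _))// lerD ?yl// (le_trans (ler_normD _ _))//.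
    by rewrite mulrDl lerD ?yY// distrC yY.
have [[Z1 Z2 Z3] ZY] := stepP aY.
have ZE r : a <= r <= b -> step Y r = Y r.
  move=> rab; apply/eqP; rewrite -subr_eq0 -normr_le0.
  apply: (le_half_powers (C := rho)) => n; rewrite add0r.
  rewrite -(subrKA (y n.+1 r)) (le_trans (ler_normD _ _))//.
  apply: (@le_trans _ _ (rho * 2^-1 ^+ n * 2^-1 + rho * 2^-1 ^+ n.+1)).
    rewrite lerD// ?yY//; apply: (step_contraction aY (y_admissible n)) rab.
      by rewrite mulr_ge0// exprn_ge0// invr_ge0.
    by move=> s sab; rewrite distrC yY.
  by rewrite exprSr; lra.
(* The image [step Y] is returned instead of the limit [Y]: it is differentiable by construction and
   agrees with [Y] on [a, b], but possibly not outside, where a derivative within [a, b] does not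
   look. *)
exists (step Y); split=> // r e rab; rewrite ZE//; exact: ZY.
Qed.

End picard.

(** * Functions of class C^1 on open subsets of R^n *)

(** Frechet differentiability with gradient [g]. Directional derivatives alone would not be enough
    for a chain rule along curves. *)
Definition first_order (R : realType) (n : nat) (f : 'rV[R]_n -> R)
    (p : 'rV[R]_n) (g : 'I_n -> R) :=
  forall e : R, 0 < e -> \forall v \near (0 : 'rV[R]_n),
    `|f (p + v) - f p - \sum_c v 0 c * g c| <= e * `|v|.

Lemma deriv_within_linear (R : realType) (D : set R^o) (r c : R) :
  deriv_within R^o D (fun s => s * c) r 1 c.
Proof.
apply/deriv_withinP => e e0; apply: nearW => h _.
rewrite /GRing.scale/= mulr1 mulrDl (addrC (r * c)) addrK subrr normr0.
by rewrite mulr_ge0// ltW.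
Qed.

(** The coordinates of v are switched on one at a time, and on each leg the mean value theorem
    compares the partial derivative with its value at p. The n errors add up, hence the tolerance e
    / (n + 1), whose denominator is positive even for n = 0. *)
Lemma partials_first_order (R : realType) (n : nat) (D : set 'rV[R]_n)
    (f : 'rV[R]_n -> R) (f' : 'I_n -> 'rV[R]_n -> R) : open D ->
  (forall c p, D p -> deriv_within 'rV[R]_n D f p (delta_mx 0 c) (f' c p)) ->
  (forall c, {within D, continuous (f' c)}) ->
  forall p, D p -> first_order f p (f' ^~ p).
Proof.
move=> oD Hf Hc p Dp e e0.
pose e' := e / n.+1%:R.
have e'0 : 0 < e' by rewrite divr_gt0.
have Nc : \forall q \near p, D q /\ forall c, `|f' c q - f' c p| <= e'.
  have nD : nbhs p D by exact: open_nbhs_nbhs.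
  apply: filterS2 nD (_ : \forall q \near p, forall c, D q -> `|f' c q - f' c p| <= e').
    by move=> q Dq H; split=> // c; exact: H.
  have := @filter_forall 'rV[R]_n 'I_n
    (fun c q => D q -> `|f' c q - f' c p| <= e') (nbhs p) _.
  apply=> c.
  have /subspace_continuousP/(_ _ Dp) := Hc c.
  move=> /cvgrPdist_le/(_ _ e'0); rewrite nearE /within /=.
  by apply: filterS => q + Dq => /(_ Dq); rewrite distrC.
move: Nc => /nbhs_ballP[d /= d0 Hd].
apply/nbhs_ballP; exists d => //= v; rewrite -ball_normE /= sub0r normrN => vd.
(* The first m coordinates of [v]. In the maximum norm all intermediate points stay within |v| of
   p. *)
pose u m : 'rV[R]_n := \row_j (if (j < m)%N then v 0 j else 0).
have uS (m : 'I_n) : u m.+1 = u m + v 0 m *: delta_mx 0 m.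
  apply/rowP => j; rewrite !mxE eqxx/= ltnS leq_eqVlt (_ : (j == m :> nat) = (j == m))//.
  by have [->|] := eqVneq j m; rewrite ?ltnn ?add0r ?mulr1 ?mulr0 ?addr0.
have u0 : u 0%N = 0 by apply/rowP => j; rewrite !mxE.
have un : u n = v by apply/rowP => j; rewrite !mxE ltn_ord.
have nu (m : 'I_n) (s : R) : 0 <= s <= 1 -> `|u m + (s * v 0 m) *: delta_mx 0 m| <= `|v|.
  move=> /andP[s0 s1]; apply/rV_norm_leP => // j; rewrite !mxE eqxx/=.
  have [->|] := eqVneq j m; rewrite ?ltnn ?add0r ?mulr1 ?mulr0 ?addr0.
    rewrite normrM ger0_norm// (le_trans _ (rV_norm_coord v m))//.
    by rewrite -[leRHS]mul1r ler_wpM2r.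
  by move=> _; case: ifP => _; rewrite ?normr0// rV_norm_coord.
have st (m : 'I_n) : `|f (p + u m.+1) - f (p + u m) - v 0 m * f' m p| <= e' * `|v|.
  pose q (s : R) := p + u m + (s * v 0 m) *: delta_mx 0 m.
  have qd s : 0 <= s <= 1 -> `|p - q s| < d.
    move=> /(nu m) Hs; apply: le_lt_trans vd.
    by rewrite /q -addrA opprD addrA subrr add0r normrN.
  pose g (s : R) := f (q s) - s * (v 0 m * f' m p).
  have -> : f (p + u m.+1) - f (p + u m) - v 0 m * f' m p = g 1 - g 0.
    rewrite /g /q uS !mul0r !mul1r scale0r addr0 subr0 (addrA p).
    by ring.
  have -> : e' * `|v| = e' * `|v| * (1 - 0) by rewrite subr0 mulr1.
  apply: (@segment_deriv_dist R 0 1 g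
    (fun s => v 0 m * f' m (q s) - v 0 m * f' m p)) => // s s01.
    apply: deriv_withinB.
      have := Hd (q s); rewrite -ball_normE /= => /(_ (qd s s01))[Dq _].
      have {}H := deriv_within_sub (g := f) (D' := [set x | D x /\ `|p - x| < d])
        (fun x => @proj1 _ _) (conj Dq (qd s s01)) (fun _ _ => erefl)
        (deriv_within_dirZ (c := v 0 m) (Hf m _ Dq)).
      apply: (deriv_within_affine (phi := q) _ _ H).
        move=> h; rewrite /q -[RHS]addrA; congr (_ + _).
        by rewrite scalerA -scalerDl /GRing.scale /= mulr1 mulrDl.
      move=> r /=; rewrite in_itv/= => r01; have := qd r r01; split=> //.
      by have := Hd (q r); rewrite -ball_normE /= => /(_ (qd r r01))[].
    exact: deriv_within_linear.
  rewrite -mulrBr normrM mulrC ler_pM ?rV_norm_coord//.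
  by have := Hd (q s); rewrite -ball_normE /= => /(_ (qd s s01))[].
have -> : f (p + v) - f p - \sum_c v 0 c * f' c p =
    \sum_(m < n) (f (p + u m.+1) - f (p + u m) - v 0 m * f' m p).
  rewrite sumrB; congr (_ - _).
  by rewrite -(big_mkord xpredT (fun m => f (p + u m.+1) - f (p + u m)))
    telescope_sumr// un u0 addr0.
apply: (le_trans (ler_norm_sum _ _ _)).
apply: (@le_trans _ _ (\sum_(m < n) e' * `|v|)); first exact: ler_sum.
rewrite sumr_const card_ord -mulrnAl ler_wpM2r// /e' -mulrnAl -mulr_natr.
rewrite ler_pdivrMr//; apply: ler_wpM2l; first exact: ltW.
by rewrite ler_nat.
Qed.

Section within_continuity.
Context (R : realType) (T : topologicalType) (D : set T).
Implicit Types f g : T -> R.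

Lemma within_continuous_cst (c : R) : {within D, continuous (fun=> c)}.
Proof. by apply/subspace_continuousP => x _; exact: cvg_cst. Qed.

Lemma within_continuous_add f g : {within D, continuous f} ->
  {within D, continuous g} -> {within D, continuous (fun x => f x + g x)}.
Proof.
move=> /subspace_continuousP Hf /subspace_continuousP Hg.
apply/subspace_continuousP => x Dx.
exact: (cvgD (Hf x Dx) (Hg x Dx)).
Qed.

Lemma within_continuous_mul f g : {within D, continuous f} ->
  {within D, continuous g} -> {within D, continuous (fun x => f x * g x)}.
Proof.
move=> /subspace_continuousP Hf /subspace_continuousP Hg.
apply/subspace_continuousP => x Dx.
exact: (cvgM (Hf x Dx) (Hg x Dx)).
Qed.

Lemma within_continuous_sum (I : Type) (r : seq I) (P : pred I)
    (f : I -> T -> R) : (forall i, {within D, continuous (f i)}) ->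
  {within D, continuous (fun x => \sum_(i <- r | P i) f i x)}.
Proof.
move=> Hf; elim: r => [|i r IH].
  under eq_fun do rewrite big_nil; exact: within_continuous_cst.
under eq_fun do rewrite big_cons.
by case: (P i) => //; exact: (within_continuous_add (Hf i) IH).
Qed.

Lemma within_continuous_ext (Y : topologicalType) (f g : T -> Y) :
  (forall x, D x -> f x = g x) ->
  {within D, continuous f} -> {within D, continuous g}.
Proof.
move=> fg /subspace_continuousP Hf; apply/subspace_continuousP => x Dx.
move=> A HA; have := Hf x Dx A; rewrite /from_subspace (fg x Dx) => /(_ HA).
rewrite /nbhs /= /within /=; apply: filterS => y Hy Dy.
by rewrite -fg//; exact: Hy.
Qed.

Lemma within_continuous_sub (Y : topologicalType) (D' : set T) (f : T -> Y) :
  D' `<=` D -> {within D, continuous f} -> {within D', continuous f}.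
Proof. exact: continuous_subspaceW. Qed.

Lemma within_continuous_map (T' Y : topologicalType) (D' : set T')
    (phi : T' -> T) (f : T -> Y) :
  {within D', continuous phi} -> (forall x, D' x -> D (phi x)) ->
  {within D, continuous f} -> {within D', continuous (f \o phi)}.
Proof.
move=> /subspace_continuousP Hp DD /subspace_continuousP Hf.
apply/subspace_continuousP => x Dx.
apply: cvg_trans (Hf _ (DD x Dx)) => A /= HA.
have := Hp x Dx _ HA; rewrite /within /= !nbhs_simpl /=.
apply: filterS => y Hy D'y; exact: Hy (DD _ D'y).
Qed.

End within_continuity.

Lemma cvg_rV (R : realType) (T : Type) (F : set_system T) (n : nat)
    (f : T -> 'rV[R]_n) (l : 'rV[R]_n) : Filter F ->
  (forall c, f x 0 c @[x --> F] --> l 0 c) -> f x @[x --> F] --> l.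
Proof.
move=> FF H; apply/cvgrPdist_le => e e0.
have := @filter_forall T 'I_n (fun c x => `|l 0 c - f x 0 c| <= e) F _; move=> /(_ _)/(_ _).
move=> Hf; near=> x; apply/rV_norm_leP; first exact: ltW.
move=> c; rewrite !mxE; move: c; near: x; apply: Hf => c.
by have := H c; move/cvgrPdist_le; apply.
Unshelve. all: by end_near. Qed.

Lemma within_continuous_rV (R : realType) (T : topologicalType) (D : set T)
    (n : nat) (f : T -> 'rV[R]_n) :
  {within D, continuous f} <-> forall c, {within D, continuous (fun x => f x 0 c)}.
Proof.
split=> [H c|H].
  apply: (within_continuous_map (D := setT) (f := fun v : 'rV[R]_n => v 0 c) H) => //.
  by apply: continuous_subspaceT; exact: matrix_normedtype.coord_continuous.
apply/subspace_continuousP => x Dx; apply: cvg_rV => c.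
by have /subspace_continuousP := H c; apply.
Qed.


Lemma deriv_within_chain (R : realType) (W : normedModType R) (D : set W)
    (n : nat) (psi : W -> 'rV[R]_n) (f : 'rV[R]_n -> R) (q v : W)
    (l g : 'I_n -> R) : first_order f (psi q) g ->
  (forall c, deriv_within W D (fun x => psi x 0 c) q v (l c)) ->
  deriv_within W D (f \o psi) q v (\sum_c l c * g c).
Proof.
move=> Hf Hpsi; apply/deriv_withinP => e e0.
(* [G] bounds the effect on f of the error made in [psi], and [L] the displacement of [psi] per unit
   of h. Since [e1 <= 1], the increment [w] has norm at most L |h|. *)
pose G := 1 + \sum_c `|g c|; pose L := 1 + \sum_c `|l c|.
have G1 : 1 <= G by rewrite lerDl sumr_ge0.
have L1 : 1 <= L by rewrite lerDl sumr_ge0.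
have G0 := lt_le_trans ltr01 G1; have L0 := lt_le_trans ltr01 L1.
pose e1 := Num.min 1 (e / (2 * G)); pose e2 := e / (2 * L).
have e20 : 0 < e2 by rewrite divr_gt0// mulr_gt0.
have e10 : 0 < e1 by rewrite lt_min ltr01 divr_gt0// mulr_gt0.
have e11 : e1 <= 1 by rewrite /e1 ge_min lexx.
have e1G : e1 * G <= e / 2.
  apply: (@le_trans _ _ (e / (2 * G) * G)).
    by rewrite ler_wpM2r ?(ltW G0)// /e1 ge_min lexx orbT.
  by rewrite le_eqVlt; apply/orP; left; apply/eqP; field; rewrite gt_eqF.
have /nbhs_ballP[d /= d0 Hd] := Hf _ e20.
have Hc : \forall h \near (0 : R)^', forall c, D (q + h *: v) ->
    `|psi (q + h *: v) 0 c - psi q 0 c - h * l c| <= e1 * `|h|.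
  have := @filter_forall R 'I_n (fun c h => D (q + h *: v) ->
    `|psi (q + h *: v) 0 c - psi q 0 c - h * l c| <= e1 * `|h|) (0 : R)^' _.
  by apply=> c; move/deriv_withinP : (Hpsi c); apply.
have Hh : \forall h \near (0 : R)^', L * `|h| < d.
  near=> h; rewrite -ltr_pdivlMl// mulrC; near: h.
  by apply: dnbhs0_lt; rewrite divr_gt0.
near=> h => Dh.
have Hc' : forall c, D (q + h *: v) ->
  `|psi (q + h *: v) 0 c - psi q 0 c - h * l c| <= e1 * `|h| by near: h.
have Hh' : L * `|h| < d by near: h.
pose w := psi (q + h *: v) - psi q.
have wL : `|w| <= L * `|h|.
  apply/rV_norm_leP; first by rewrite mulr_ge0// ltW.
  move=> c; rewrite !mxE -(subrK (h * l c) (_ - _)).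
  rewrite (le_trans (ler_normD _ _))// mulrDl lerD//.
    by apply: le_trans (Hc' c Dh) _; rewrite ler_wpM2r.
  rewrite normrM mulrC ler_wpM2r// (bigD1 c)//= lerDl sumr_ge0//.
have wd : ball (0 : 'rV[R]_n) d w.
  by rewrite -ball_normE/= sub0r normrN (le_lt_trans wL Hh').
have /= := Hd w wd; rewrite {1}/w subrKC => Hw.
rewrite /= (_ : _ - _ - _ = (f (psi (q + h *: v)) - f (psi q) -
   \sum_c w 0 c * g c) + \sum_c (w 0 c - h * l c) * g c); last first.
  have -> : \sum_c (w 0 c - h * l c) * g c =
      \sum_c w 0 c * g c - h * \sum_c l c * g c.
    by rewrite mulr_sumr -sumrB; apply: eq_bigr => c _; ring.
  by rewrite addrA subrK.
rewrite (le_trans (ler_normD _ _))// [e]splitr mulrDl lerD//.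
  apply: le_trans Hw _; apply: (@le_trans _ _ (e2 * (L * `|h|))).
    by rewrite ler_wpM2l// ltW.
  by rewrite mulrA ler_wpM2r// le_eqVlt; apply/orP; left; apply/eqP;
    rewrite /e2; field; rewrite gt_eqF.
apply: (@le_trans _ _ (e1 * `|h| * G)); last first.
  by rewrite mulrAC ler_wpM2r.
apply: le_trans (ler_norm_sum _ _ _) _.
rewrite /G mulrDr mulr_sumr -[leLHS]add0r lerD//.
  by rewrite mulr1 mulr_ge0// ltW.
apply: ler_sum => c _; rewrite normrM ler_wpM2r//.
by have := Hc' c Dh; rewrite /w !mxE.
Unshelve. all: by end_near. Qed.

Lemma first_order_deriv (R : realType) (n : nat) (D : set 'rV[R]_n)
    (f : 'rV[R]_n -> R) (p v : 'rV[R]_n) (g : 'I_n -> R) : first_order f p g ->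
  deriv_within 'rV[R]_n D f p v (\sum_c v 0 c * g c).
Proof.
move=> Hf; apply: (@deriv_within_chain R _ D n id f p v (fun c => v 0 c) g Hf) => c.
apply/deriv_withinP => e e0; apply: nearW => h _.
by rewrite !mxE [X in X - _]addrC addKr subrr normr0 mulr_ge0// ltW.
Qed.

(** By uniqueness of the differential. The row index of the Jacobian is the source coordinate, hence
    the exchange of the indices. *)
Lemma first_order_jacobian (R : realType) (m n : nat)
    (psi : 'rV[R]_n -> 'rV[R]_m) (p : 'rV[R]_n) (g : 'I_m -> 'I_n -> R) :
  (forall e, first_order (fun q => psi q 0 e) p (g e)) ->
  forall c e, jacobian psi p c e = g e c.
Proof.
move=> H; pose J : 'M[R]_(n, m) := \matrix_(c, e) g e c.
have Jc : continuous (mulmxr J : 'rV[R]_n -> 'rV[R]_m).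
  have : {within setT, continuous (mulmxr J : 'rV[R]_n -> 'rV[R]_m)}; last first.
    move/subspace_continuousP => Jc v A HA; have := Jc v I A HA.
    by rewrite /within /=; apply: (@filterS _ (nbhs v)) => w; apply.
  apply/within_continuous_rV => e.
  apply: (within_continuous_ext (f := fun v : 'rV[R]_n => \sum_c v 0 c * J c e)).
    by move=> v _; rewrite !mxE.
  apply: within_continuous_sum => c; apply: within_continuous_mul.
    by apply: continuous_subspaceT; exact: matrix_normedtype.coord_continuous.
  exact: within_continuous_cst.
have E : psi \o shift p = cst (psi p) + (mulmxr J) +o_ (0 : 'rV[R]_n) id.
  apply/eqaddoE/eqaddoP => d d0.
  have Hn : \forall v \near (0 : 'rV[R]_n), forall e,
      `|psi (p + v) 0 e - psi p 0 e - \sum_c v 0 c * g e c| <= d * `|v|.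
    have := @filter_forall _ 'I_m (fun e v => `|psi (p + v) 0 e - psi p 0 e -
      \sum_c v 0 c * g e c| <= d * `|v|) (nbhs (0 : 'rV[R]_n)) _.
    by apply=> e; exact: H.
  suff : \forall v \near (0 : 'rV[R]_n),
    `|(psi \o shift p - (cst (psi p) + mulmxr J)) v| <= d * `|v| by [].
  apply: filterS Hn => v Hv; apply/rV_norm_leP; first by rewrite mulr_ge0// ltW.
  move=> e; rewrite !fctE /= !mxE (addrC v) opprD addrA.
  by under eq_bigr do rewrite mxE; exact: Hv.
have := diff_unique Jc E => dE c e.
by rewrite /jacobian mxE dE /= /mulmxr -rowE !mxE.
Qed.

(** * Rules for functions of class C^k *)

Section Ck_theory.
Context (R : realType) (W : normedModType R).
Implicit Types (S : set W) (D : set W) (f g : W -> R).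

Lemma Ck_along_continuous S k D f : Ck_along W S k D f -> {within D, continuous f}.
Proof. by case: k => [|k] []. Qed.

Lemma Ck_along_sub S S' k D D' f g : S' `<=` S -> D' `<=` D ->
  (forall p, D' p -> f p = g p) -> Ck_along W S k D f -> Ck_along W S' k D' g.
Proof.
move=> SS DD; elim: k f g => [|k IH] f g fg [Hc Hk].
  split=> //; apply: within_continuous_ext fg _; exact: within_continuous_sub Hc.
split; first by apply: within_continuous_ext fg _; exact: within_continuous_sub Hc.
move=> v /SS /Hk [f' Hf' H]; exists f'; first exact: IH Hf'.
by move=> p Dp; exact: (deriv_within_sub DD Dp fg (H _ (DD _ Dp))).
Qed.

Lemma Ck_along_pred S k D f : Ck_along W S k.+1 D f -> Ck_along W S k D f.
Proof.
elim: k f => [|k IH] f [Hc Hk]; split=> // v /Hk [f' Hf' H].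
by exists f' => //; exact: IH.
Qed.

Lemma C1_along_cst S D (c : R) : Ck_along W S 1 D (fun=> c).
Proof.
split; first exact: within_continuous_cst.
move=> v _; exists (fun=> 0); first by split=> //; exact: within_continuous_cst.
by move=> p _; exact: deriv_within_cst.
Qed.

Lemma C1_along_add S D f g : Ck_along W S 1 D f -> Ck_along W S 1 D g ->
  Ck_along W S 1 D (fun p => f p + g p).
Proof.
move=> [fc Hf] [gc Hg]; split; first exact: within_continuous_add.
move=> v Sv; have [f' [f'c _] Hf'] := Hf v Sv; have [g' [g'c _] Hg'] := Hg v Sv.
exists (fun p => f' p + g' p); first by split=> //; exact: within_continuous_add.
by move=> p Dp; exact: (deriv_withinD (Hf' p Dp) (Hg' p Dp)).
Qed.

Lemma C1_along_mul S D f g : Ck_along W S 1 D f -> Ck_along W S 1 D g ->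
  Ck_along W S 1 D (fun p => f p * g p).
Proof.
move=> [fc Hf] [gc Hg]; split; first exact: within_continuous_mul.
move=> v Sv; have [f' [f'c _] Hf'] := Hf v Sv; have [g' [g'c _] Hg'] := Hg v Sv.
exists (fun p => f' p * g p + f p * g' p).
  by split=> //; apply: within_continuous_add; exact: within_continuous_mul.
by move=> p Dp; exact: (deriv_withinM (Hf' p Dp) (Hg' p Dp)).
Qed.

Lemma C1_along_sum S D (I : Type) (r : seq I) (P : pred I) (f : I -> W -> R) :
  (forall i, Ck_along W S 1 D (f i)) ->
  Ck_along W S 1 D (fun p => \sum_(i <- r | P i) f i p).
Proof.
move=> Hf; elim: r => [|i r IH].
  under eq_fun do rewrite big_nil; exact: C1_along_cst.
under eq_fun do rewrite big_cons.
by case: (P i) => //; exact: (C1_along_add (Hf i) IH).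
Qed.

End Ck_theory.

(** Used to freeze the time in a time-dependent section and to restrict transition maps to
    coordinate lines. The sets of directions let a function that is C^2 in space only be treated as
    well. *)
Lemma Ck_along_affine (R : realType) (W W' : normedModType R) (S : set W)
    (S' : set W') (k : nat) (D : set W) (D' : set W') (phi A : W' -> W)
    (f : W -> R) : {within D', continuous phi} ->
  (forall q v h, phi (q + h *: v) = phi q + h *: A v) ->
  (forall v, S' v -> S (A v)) -> (forall q, D' q -> D (phi q)) ->
  Ck_along W S k D f -> Ck_along W' S' k D' (f \o phi).
Proof.
move=> phic phiE SS DD; elim: k f => [|k IH] f [Hc Hk].
  by split=> //; exact: within_continuous_map Hc.
split; first exact: within_continuous_map Hc.
move=> v /SS /Hk [f' Hf' H]; exists (f' \o phi); first exact: IH.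
move=> q /DD Dq; apply: (deriv_within_affine _ DD (H _ Dq)) => h.
exact: phiE.
Qed.

Section C1_rV.
Context (R : realType) (n : nat) (D : set 'rV[R]_n) (oD : open D).
Implicit Types f : 'rV[R]_n -> R.

Lemma Ck_partials k f : Ck 'rV[R]_n k.+1 D f ->
  exists f' : 'I_n -> 'rV[R]_n -> R, forall c, Ck 'rV[R]_n k D (f' c) /\
    forall p, D p -> deriv_within 'rV[R]_n D f p (delta_mx 0 c) (f' c p).
Proof.
move=> [_ H].
have {}H c := cid2 (H (delta_mx 0 c) I).
by exists (fun c => s2val (H c)) => c; split; [exact: (s2valP (H c))|exact: (s2valP' (H c))].
Qed.

Lemma C1_first_order f : Ck 'rV[R]_n 1 D f ->
  exists f' : 'I_n -> 'rV[R]_n -> R, (forall c, {within D, continuous (f' c)}) /\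
    forall p, D p -> first_order f p (f' ^~ p).
Proof.
move=> /Ck_partials[f' H]; exists f'; split=> [c|].
  by have [[]] := H c.
apply: partials_first_order => // c; last by have [[]] := H c.
by have [] := H c.
Qed.

Lemma C1_chain (W : normedModType R) (S D' : set W) (psi : W -> 'rV[R]_n) f :
  Ck 'rV[R]_n 1 D f -> (forall q, D' q -> D (psi q)) ->
  (forall c, Ck_along W S 1 D' (fun q => psi q 0 c)) ->
  Ck_along W S 1 D' (f \o psi).
Proof.
move=> Cf DD Cpsi.
have psic : {within D', continuous psi}.
  by apply/within_continuous_rV => c; exact: Ck_along_continuous (Cpsi c).
have [f' [f'c Hf']] := C1_first_order Cf.
split; first by apply: within_continuous_map (Ck_along_continuous Cf).
move=> v Sv; have Hpsi c := cid2 ((Cpsi c).2 v Sv).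
exists (fun q => \sum_c s2val (Hpsi c) q * f' c (psi q)).
  split=> //; apply: within_continuous_sum => c; apply: within_continuous_mul.
    by have [] := s2valP (Hpsi c).
  exact: within_continuous_map (f'c c).
move=> q D'q; apply: deriv_within_chain; first exact/Hf'/DD.
by move=> c; exact: (s2valP' (Hpsi c)).
Qed.

Lemma partial_derive f (p v : 'rV[R]_n) (l : R) : D p ->
  deriv_within 'rV[R]_n D f p v l -> 'D_v f p = l.
Proof.
by move=> Dp /(@deriv_within_openP _ _ _ _ _ _ _ oD Dp) [].
Qed.

End C1_rV.

(** * Charts, trivializations and connections in coordinates *)

Section charts.
Context (R : realType) (n : nat) (M : closed_oriented_manifold R n).

Lemma param_image (i : chart M) (O : set M) (y : 'rV[R]_n) :
  (coord i @` (O `&` dom i)) y ->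
  [/\ O (param i y), dom i (param i y) & coord i (param i y) = y].
Proof. by move=> [x [Ox ix] <-]; rewrite coordK. Qed.

Lemma coord_image (i : chart M) (O : set M) (x : M) : O x -> dom i x ->
  (coord i @` (O `&` dom i)) (coord i x).
Proof. by move=> Ox ix; exists x. Qed.

Lemma image_dom (i : chart M) (O : set M) :
  coord i @` (O `&` dom i) `<=` coord i @` dom i.
Proof. by move=> _ [x [_ ix] <-]; exists x. Qed.

Lemma param_continuous_at (i : chart M) (y : 'rV[R]_n) : (coord i @` dom i) y ->
  param i @ y --> param i y.
Proof.
move=> Dy; have /subspace_continuousP/(_ y Dy) H := @param_continuous _ _ M i.
move=> A /H; rewrite /within /= => HA.
have nD := open_nbhs_nbhs (conj (@coord_image_open _ _ M i) Dy).
have {}HA : \forall z \near y, (coord i @` dom i) z -> A (param i z) by exact: HA.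
suff : \forall z \near y, A (param i z) by [].
by apply: filterS2 nD HA => z Dz; apply.
Qed.

Lemma coord_continuous_at (i : chart M) (x : M) : dom i x ->
  coord i @ x --> coord i x.
Proof.
move=> ix; have /subspace_continuousP/(_ x ix) H := @coord_continuous _ _ M i.
move=> A /H; rewrite /within /= => HA.
have nD := open_nbhs_nbhs (conj (@dom_open _ _ M i) ix).
have {}HA : \forall z \near x, dom i z -> A (coord i z) by exact: HA.
suff : \forall z \near x, A (coord i z) by [].
by apply: filterS2 nD HA => z Dz; apply.
Qed.

Lemma coord_image_open_sub (i : chart M) (O : set M) : open O ->
  open (coord i @` (O `&` dom i)).
Proof.
move=> oO; rewrite openE => y /[dup] Dy /param_image[Oy iy yE].
have Di : (coord i @` dom i) y by exact: image_dom Dy.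
have nO : nbhs (param i y) O by exact: open_nbhs_nbhs.
have H := param_continuous_at Di nO.
have nD := open_nbhs_nbhs (conj (@coord_image_open _ _ M i) Di).
rewrite /interior; apply: filterS2 nD H => z [x ix <-] /=.
by rewrite coordK// => Ox; exists x.
Qed.

(** Transition maps are smooth, so one chart containing [O] decides about all charts. *)
Lemma fun_C1_chart (i : chart M) (O : set M) (f : M -> R) : open O ->
  O `<=` dom i ->
  Ck 'rV[R]_n 1 (coord i @` (O `&` dom i)) (fun y => f (param i y)) ->
  fun_Ck 1 O f.
Proof.
move=> oO Oi Cf j.
have C c : Ck_along 'rV[R]_n setT 1 (coord j @` (O `&` dom j))
    (fun y => coord i (param j y) 0 c).
  have := @transition_smooth _ _ M j i c 1%N.
  apply: Ck_along_sub => // _ [x [Ox jx] <-]; exists x => //; split=> //; exact: Oi.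
have := C1_chain (coord_image_open_sub oO) (psi := fun y => coord i (param j y)) Cf _ C.
have H : forall y, (coord j @` (O `&` dom j)) y ->
    (coord i @` (O `&` dom i)) (coord i (param j y)).
  by move=> y /param_image[Oy jy _]; apply: coord_image => //; exact: Oi.
move=> /(_ H); apply: Ck_along_sub => // y /param_image[Oy jy _] /=.
by rewrite coordK//; exact: Oi.
Qed.

Lemma chart_jacP (i j : chart M) (x : M) : dom i x -> dom j x ->
  forall d, first_order (fun y => coord j (param i y) 0 d) (coord i x)
    (fun c => chart_jac i j x c d).
Proof.
move=> ix jx.
have oD : open (coord i @` (dom i `&` dom j)).
  by rewrite setIC; exact/coord_image_open_sub/dom_open.
have Dx : (coord i @` (dom i `&` dom j)) (coord i x) by exists x.
have H d := cid (C1_first_order oD (@transition_smooth _ _ M i j d 1%N)).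
have Hd d : first_order (fun y => coord j (param i y) 0 d) (coord i x)
  (fun c => sval (H d) c (coord i x)) by apply: (svalP (H d)).2.
move=> d; have := Hd d; congr first_order; apply/funext => c.
by rewrite /chart_jac (first_order_jacobian Hd).
Qed.

Lemma partial_val (i : chart M) (O : set M) (f : M -> R) (c : 'I_n) (x : M)
    (l : R) : open O -> O x -> dom i x ->
  deriv_within 'rV[R]_n (coord i @` (O `&` dom i)) (fun y => f (param i y))
    (coord i x) (delta_mx 0 c) l -> partial i c f x = l.
Proof.
move=> oO Ox ix H; apply: partial_derive H; first exact: coord_image_open_sub.
exact: coord_image.
Qed.

Lemma fun_C1_first_order (i : chart M) (O : set M) (f : M -> R) (x : M) :
  open O -> fun_Ck 1 O f -> O x -> dom i x ->
  first_order (fun y => f (param i y)) (coord i x) (fun c => partial i c f x).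
Proof.
move=> oO Cf Ox ix; have oD := coord_image_open_sub (i := i) oO.
have [f' [_ Hf']] := C1_first_order oD (Cf i).
have := Hf' _ (coord_image Ox ix); congr first_order; apply/funext => c.
rewrite (partial_val oO Ox ix (l := f' c (coord i x)))//.
have := first_order_deriv (coord i @` (O `&` dom i)) (v := delta_mx 0 c)
  (Hf' _ (coord_image Ox ix)).
rewrite (bigD1 c)//= mxE !eqxx mul1r big1 ?addr0// => d dc.
by rewrite mxE eqxx (negbTE dc) mul0r.
Qed.

End charts.

Lemma deriv_within_near (R : realType) (W : normedModType R) (D E : set W)
    (f g : W -> R) (p v : W) (l : R) : (\forall q \near p, D q -> E q) ->
  (\forall q \near p, D q -> f q = g q) -> f p = g p ->
  deriv_within W E f p v l -> deriv_within W D g p v l.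
Proof.
move=> DE fg fgp /deriv_withinP H; apply/deriv_withinP => e /H {}H.
have cont : (fun h : R => p + h *: v) @ (0 : R) --> p.
  rewrite -[X in _ --> X]addr0 -[X in _ --> _ + X](scale0r v).
  by apply: cvgD; [exact: cvg_cst|apply: cvgZr_tmp; exact: cvg_id].
have DE' := nbhs_dnbhs (cont _ DE); have fg' := nbhs_dnbhs (cont _ fg).
apply: filterS3 H DE' fg' => h H + + Dh => /(_ Dh) Eh /(_ Dh) <-.
by rewrite -fgp; exact: H.
Qed.

Lemma pair_continuous_l (T U : topologicalType) (t : U) :
  continuous (fun y : T => (y, t)).
Proof.
move=> y A [[B C] /= [HB HC] BC]; apply: filterS HB => z Bz; apply: BC.
by split=> //=; exact: nbhs_singleton HC.
Qed.

Section bundle.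
Context (R : realType) (n k : nat) (M : closed_oriented_manifold R n).
Context (V : vector_bundle M k).
Implicit Types (a b : tindex V) (O : set M) (s : section_of V).

Lemma trivD a x (v w : V x) : tdom V a x ->
  triv V a (v + w) = triv V a v + triv V a w.
Proof. by move=> ax; rewrite -[v]scale1r triv_linear// !scale1r. Qed.

Lemma triv0 a x : tdom V a x -> triv V a (0 : V x) = 0.
Proof. by move=> ax; apply: (addrI (triv V a (0 : V x))); rewrite -trivD// !addr0. Qed.

Lemma trivZ a x c (v : V x) : tdom V a x -> triv V a (c *: v) = c *: triv V a v.
Proof. by move=> ax; rewrite -[c *: v]addr0 triv_linear// triv0// addr0. Qed.

Lemma trivB a x (v w : V x) : tdom V a x ->
  triv V a (v - w) = triv V a v - triv V a w.
Proof. by move=> ax; rewrite -[- w]scaleN1r trivD// trivZ// scaleN1r. Qed.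

Lemma triv_sum a x (I : Type) (r : seq I) (P : pred I) (v : I -> V x) :
  tdom V a x ->
  triv V a (\sum_(i <- r | P i) v i) = \sum_(i <- r | P i) triv V a (v i).
Proof.
move=> ax; apply: (big_morph (triv V a)); last exact: triv0.
by move=> ? ?; exact: trivD.
Qed.

Lemma triv_inj a x : tdom V a x -> injective (@triv _ _ _ _ V a x).
Proof. by move=> ax; exact: can_inj (trivK ax). Qed.

Lemma frameB a x v w : tdom V a x ->
  frame V a x (v - w) = frame V a x v - frame V a x w.
Proof. by move=> ax; apply: (triv_inj ax); rewrite trivB// !frameK. Qed.

Lemma frameE a x v : tdom V a x ->
  frame V a x v = \sum_d v 0 d *: frame_section a d x.
Proof.
move=> ax; apply: (triv_inj ax); rewrite frameK// triv_sum//.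
under eq_bigr do rewrite trivZ// /frame_section frameK//.
by apply/rowP => e; rewrite [v in LHS]row_sum_delta.
Qed.

Lemma triv_frameE a b x (v : V x) e : tdom V a x -> tdom V b x ->
  triv V b v 0 e = \sum_d triv V a v 0 d * triv V b (frame_section a d x) 0 e.
Proof.
move=> ax bx; rewrite -[v in LHS](trivK ax) frameE// triv_sum// summxE.
by apply: eq_bigr => d _; rewrite trivZ// mxE.
Qed.

Lemma sec_Ck_sub m O O' s s' : O' `<=` O -> (forall x, O' x -> s x = s' x) ->
  sec_Ck m O s -> sec_Ck m O' s'.
Proof.
move=> OO ss Hs i b e; apply: Ck_along_sub (Hs i b e) => //.
  by move=> _ [x [[Ox bx] ix] <-]; exists x => //; split=> //; split=> //; exact: OO.
by move=> _ [x [[Ox bx] ix] <-]; rewrite coordK// ss.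
Qed.

Lemma frame_section_Cinf a d : sec_Cinf (tdom V a) (frame_section a d).
Proof. by move=> m i b e; exact: cocycle_smooth. Qed.

Lemma sec_C1_0 O : sec_Ck 1 O (fun x => 0 : V x).
Proof.
move=> i b e; apply: Ck_along_sub
  (C1_along_cst setT (coord i @` (O `&` tdom V b `&` dom i)) 0) => //.
by move=> _ [x [[Ox bx] ix] <-]; rewrite coordK// triv0// mxE.
Qed.

Lemma sec_C1_add O s s' : sec_Ck 1 O s -> sec_Ck 1 O s' ->
  sec_Ck 1 O (fun x => s x + s' x).
Proof.
move=> Hs Hs' i b e; apply: Ck_along_sub (C1_along_add (Hs i b e) (Hs' i b e)) => //.
by move=> _ [x [[Ox bx] ix] <-]; rewrite coordK// trivD// mxE.
Qed.

Lemma sec_C1_scale O (f : M -> R) s : fun_Ck 1 O f -> sec_Ck 1 O s ->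
  sec_Ck 1 O (fun x => f x *: s x).
Proof.
move=> Hf Hs i b e.
have Hf' : Ck 'rV[R]_n 1 (coord i @` (O `&` tdom V b `&` dom i))
    (fun y => f (param i y)).
  apply: Ck_along_sub (Hf i) => // _ [x [[Ox bx] ix] <-].
  by exists x.
apply: Ck_along_sub (C1_along_mul Hf' (Hs i b e)) => //.
by move=> _ [x [[Ox bx] ix] <-]; rewrite coordK// trivZ// mxE.
Qed.

Lemma sec_C1_combination O (I : Type) (r : seq I) (f : I -> M -> R)
    (s : I -> section_of V) : (forall d, fun_Ck 1 O (f d)) ->
  (forall d, sec_Ck 1 O (s d)) ->
  sec_Ck 1 O (fun x => \sum_(d <- r) f d x *: s d x).
Proof.
move=> Hf Hs; elim: r => [|d r IH].
  by apply: sec_Ck_sub (sec_C1_0 O) => // x _; rewrite big_nil.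
apply: sec_Ck_sub (sec_C1_add (sec_C1_scale (Hf d) (Hs d)) IH) => // x _.
by rewrite big_cons.
Qed.

Lemma frame_section_C1 O a d : O `<=` tdom V a -> sec_Ck 1 O (frame_section a d).
Proof.
by move=> Oa; apply: sec_Ck_sub Oa _ (@frame_section_Cinf a d 1%N).
Qed.

Lemma sec_C1_coordinate O a s e : O `<=` tdom V a -> sec_Ck 1 O s ->
  fun_Ck 1 O (fun x => triv V a (s x) 0 e).
Proof.
move=> Oa Hs i; apply: Ck_along_sub (Hs i a e) => // _ [x [Ox ix] <-].
by exists x => //; split=> //; split=> //; exact: Oa.
Qed.

Lemma sec_C1_triv O (i : chart M) a s : open O -> O `<=` tdom V a ->
  O `<=` dom i ->
  (forall e, Ck 'rV[R]_n 1 (coord i @` (O `&` dom i))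
    (fun y => triv V a (s (param i y)) 0 e)) -> sec_Ck 1 O s.
Proof.
move=> oO Oa Oi Hs.
have Hs' e : fun_Ck 1 O (fun x => triv V a (s x) 0 e) by exact: fun_C1_chart Oi _.
have := sec_C1_combination (index_enum 'I_k) Hs' (fun d => frame_section_C1 d Oa).
apply: sec_Ck_sub => // x Ox; rewrite -frameE ?trivK//; exact: Oa.
Qed.

Lemma sec_time_slice (t1 t2 t : R) O (s : R -> section_of V) : t1 <= t <= t2 ->
  sec_time_Cinf t1 t2 O s -> sec_Cinf O (s t).
Proof.
move=> ht Hs m i b e; have := Hs i b e m.
apply: (Ck_along_affine (phi := fun y : 'rV[R]_n => (y, t : R^o))
  (A := fun v => (v, 0 : R^o))) => //.
- by apply: continuous_subspaceT; exact: (@pair_continuous_l 'rV[R]_n R^o t).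
- move=> q v h; rewrite -[X in (_, X) = _](_ : (t : R^o) + h *: (0 : R^o) = t)//.
  by rewrite scaler0 addr0.
Qed.

End bundle.

Section connection.
Context (R : realType) (n k : nat) (M : closed_oriented_manifold R n).
Context (V : vector_bundle M k) (T : R) (nabla : connection_family V T).
Context (t : R) (ht : 0 <= t <= T).
Implicit Types (a b : tindex V) (O : set M) (s : section_of V).

(* Leibniz rule for the product with the indicator function of O. *)
Lemma cov_local O s s' i c x : open O -> sec_Ck 1 O s ->
  (forall y, O y -> s y = s' y) -> O x -> dom i x ->
  nabla t s i c x = nabla t s' i c x.
Proof.
move=> oO Cs ss Ox ix.
pose f (y : M) : R := if pselect (O y) then 1 else 0.
have fO y : O y -> f y = 1 by rewrite /f; case: pselect.
have nfO y : ~ O y -> f y = 0 by rewrite /f; case: pselect.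
have Cf : fun_Ck 1 O f.
  move=> j; apply: Ck_along_sub
    (C1_along_cst setT (coord j @` (O `&` dom j)) 1) => //.
  by move=> y /param_image[Oy _ _]; rewrite fO.
have pf : partial i c f x = 0.
  apply: (partial_val oO Ox ix); apply: deriv_within_sub
    (deriv_within_cst (coord i @` (O `&` dom i)) 1 _ _) => //.
    exact: coord_image.
  by move=> y /param_image[Oy _ _]; rewrite fO.
have Cs' : sec_Ck 1 O s' by exact: sec_Ck_sub Cs.
have E (s0 : section_of V) : sec_Ck 1 O s0 ->
    nabla t s0 i c x = nabla t (fun y => f y *: s0 y) i c x.
  move=> Cs0; rewrite (cov_leibniz nabla c ht oO Cf Cs0 Ox ix) pf scale0r add0r.
  by rewrite fO// scale1r.
rewrite E// [RHS]E//; congr (nabla t _ i c x); apply: functional_extensionality_dep => y.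
by have [Oy|nOy] := pselect (O y); [rewrite ss|rewrite nfO// !scale0r].
Qed.

Lemma cov_0 i c x : dom i x -> nabla t (fun x => 0 : V x) i c x = 0.
Proof.
move=> ix; have C0 := @sec_C1_0 _ _ _ _ V setT.
have := cov_add nabla c
  ht openT C0 C0 I ix.
rewrite (_ : (fun y => 0 + 0 : V y) = (fun y => 0 : V y)).
  by move/esym/eqP; rewrite -subr_eq0 addrK => /eqP.
by apply: functional_extensionality_dep => y; rewrite addr0.
Qed.

Lemma cov_combination O (I : Type) (r : seq I) (f : I -> M -> R)
    (s : I -> section_of V) i c x : open O ->
  (forall d, fun_Ck 1 O (f d)) -> (forall d, sec_Ck 1 O (s d)) ->
  O x -> dom i x ->
  nabla t (fun y => \sum_(d <- r) f d y *: s d y) i c x =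
  \sum_(d <- r) (partial i c (f d) x *: s d x + f d x *: nabla t (s d) i c x).
Proof.
move=> oO Cf Cs Ox ix; elim: r => [|d r IH].
  rewrite big_nil -[RHS](cov_0 c ix); congr (nabla t _ i c x).
  by apply: functional_extensionality_dep => y; rewrite big_nil.
rewrite big_cons -IH -(cov_leibniz nabla c ht oO (Cf d) (Cs d) Ox ix).
rewrite -(cov_add nabla c ht oO _ _ Ox ix).
- by congr (nabla t _ i c x); apply: functional_extensionality_dep => y; rewrite big_cons.
- exact: sec_C1_scale.
- exact: sec_C1_combination.
Qed.

Lemma cov_coord O a s i c x : open O -> O `<=` tdom V a -> sec_Ck 1 O s ->
  O x -> dom i x ->
  nabla t s i c x = \sum_d (partial i c (fun y => triv V a (s y) 0 d) x *:
    frame_section a d x + triv V a (s x) 0 d *: nabla t (frame_section a d) i c x).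
Proof.
move=> oO Oa Cs Ox ix.
rewrite -(cov_combination (index_enum 'I_k) (f := fun d y => triv V a (s y) 0 d)
  (s := frame_section a) c oO _ _ Ox ix).
- apply: (cov_local _ oO Cs) => // y Oy; rewrite -frameE ?trivK//; exact: Oa.
- by move=> d; exact: sec_C1_coordinate.
- by move=> d; exact: frame_section_C1.
Qed.

(** The entries of the connection matrix of nabla(t) in the frame of [a]. *)
Definition conn_coef a i c x d e : R :=
  triv V a (nabla t (frame_section a d) i c x) 0 e.

Lemma cov_triv O a s i c x e : open O -> O `<=` tdom V a -> sec_Ck 1 O s ->
  O x -> dom i x ->
  triv V a (nabla t s i c x) 0 e =
  partial i c (fun y => triv V a (s y) 0 e) x +
  \sum_d triv V a (s x) 0 d * conn_coef a i c x d e.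
Proof.
move=> oO Oa Cs Ox ix; have ax := Oa _ Ox.
rewrite (cov_coord (a := a) c oO Oa Cs Ox ix) triv_sum// summxE.
rewrite [LHS](eq_bigr (fun d => partial i c (fun y => triv V a (s y) 0 d) x *
   (delta_mx 0 d : 'rV[R]_k) 0 e + triv V a (s x) 0 d * conn_coef a i c x d e)).
  rewrite big_split/=; congr (_ + _); rewrite (bigD1 e)//= mxE !eqxx mulr1 big1 ?addr0//.
  by move=> d de; rewrite mxE eqxx eq_sym (negbTE de) mulr0.
move=> d _; rewrite trivD// mxE !trivZ// mxE [in X in _ + X]mxE.
by rewrite {1}/frame_section frameK.
Qed.

Lemma conn_coef_C1 O a i c d e : open O -> O `<=` tdom V a -> O `<=` dom i ->
  fun_Ck 1 O (fun x => conn_coef a i c x d e).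
Proof.
move=> oO Oa Oi; have ct : 0 <= t <= T := ht.
have := sec_time_slice ct (@cov_smooth _ _ _ _ _ _ nabla (tdom V a)
  (frame_section a d) i c (@tdom_open _ _ _ _ V a) (frame_section_Cinf a d)).
move=> /(_ 1%N) H; apply: sec_C1_coordinate => //.
by apply: sec_Ck_sub H => // y Oy; split; [exact: Oa|exact: Oi].
Qed.

(** In a frame the covariant derivative is a partial derivative plus smooth coefficients times the
    coordinates, so exactly one order is lost. Hence the Leibniz rule applies again to the first
    covariant derivatives that enter the Laplacian. *)
Lemma cov_sec_C1 O a s i c : open O -> O `<=` tdom V a -> O `<=` dom i ->
  (forall e, Ck 'rV[R]_n 2 (coord i @` (O `&` dom i))
    (fun y => triv V a (s (param i y)) 0 e)) ->
  sec_Ck 1 O (nabla t s i c).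
Proof.
move=> oO Oa Oi Cs; have oD := coord_image_open_sub (i := i) oO.
have C1 e : Ck 'rV[R]_n 1 (coord i @` (O `&` dom i))
    (fun y => triv V a (s (param i y)) 0 e) by exact: (Ck_along_pred (k := 1) (Cs e)).
have Cs1 : sec_Ck 1 O s by exact: (sec_C1_triv oO Oa Oi C1).
apply: (sec_C1_triv oO Oa Oi) => e.
have [f' Hf'] := Ck_partials (Cs e).
have Cc d := conn_coef_C1 c d e oO Oa Oi i.
have := C1_along_add (Hf' c).1 (C1_along_sum (index_enum 'I_k) xpredT
  (fun d => C1_along_mul (C1 d) (Cc d))).
apply: Ck_along_sub => // y /[dup] Dy /param_image[Oy iy yE].
rewrite (cov_triv c e oO Oa Cs1 Oy iy); congr (_ + _).
by rewrite (partial_val oO Oy iy (l := f' c y))// yE; exact: (Hf' c).2.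
Qed.

End connection.

(** * Parallel translation along coordinate lines *)

Section line.
Context (R : realType) (n k : nat) (M : closed_oriented_manifold R n).
Context (V : vector_bundle M k) (T : R) (nabla : connection_family V T).
Context (t : R) (ht : 0 <= t <= T) (a : tindex V) (i : chart M).
Context (p w : 'rV[R]_n).
Let D := coord i @` (tdom V a `&` dom i).
Hypothesis line_dom : forall r : R, 0 <= r <= 1 -> D (p + r *: w).

Lemma deriv_line (J : set R) (f : 'rV[R]_n -> R) (r : R) (g : 'I_n -> R) :
  first_order f (p + r *: w) g ->
  deriv_within R^o J (fun q => f (p + q *: w)) r 1 (\sum_c w 0 c * g c).
Proof.
move=> Hf; apply: (deriv_within_chain (psi := fun q : R^o => p + q *: w) Hf) => c.
have := deriv_withinD (deriv_within_cst (J : set R^o) (p 0 c) (r : R^o) 1)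
  (@deriv_within_linear R J r (w 0 c)).
by rewrite add0r; congr deriv_within; apply/funext => q; rewrite !mxE.
Qed.

Lemma line_continuous : continuous (fun r : R => p + r *: w).
Proof.
by move=> r; apply: cvgD; [exact: cvg_cst|apply: cvgZr_tmp; exact: cvg_id].
Qed.

Lemma smooth_line : smooth_curve 0 1 (fun r => param i (p + r *: w)).
Proof.
split=> [|j c].
  have := @within_continuous_map _ (coord i @` dom i) _ _ (`[0, 1]%classic : set R)
    (fun r : R => p + r *: w) (param i); apply.
  - by apply: continuous_subspaceT; exact: line_continuous.
  - by move=> r; rewrite /= in_itv/= => /line_dom; exact: image_dom.
  - exact: param_continuous.
move=> m.
apply: (Ck_along_affine (phi := fun r : R^o => p + r *: w) (A := fun v : R^o => v *: w)
  _ _ _ _ (@transition_smooth _ _ M i j c m)) => //.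
- by apply: continuous_subspaceT; exact: line_continuous.
- by move=> q v h; rewrite scalerDl addrA scalerA.
- move=> r [/=]; rewrite in_itv/= => /line_dom/param_image[ar ir rE] jr.
  by exists (param i (p + r *: w)).
Qed.

(** The equation of parallel translation along the line p + r w, written in the frame of [a]. *)
Definition line_transport (Y : R -> 'rV[R]_k) := forall r e, 0 <= r <= 1 ->
  deriv_within R^o `[0, 1] (fun q => Y q 0 e) r 1
    (- \sum_c \sum_d w 0 c * Y r 0 d *
        conn_coef nabla t a i c (param i (p + r *: w)) d e).

(** Being parallel is a condition in every chart and every frame, while the equation is solved in
    one frame. The derivatives of the transition functions [phi] cancel against the inhomogeneous
    term in the transformation law of the connection coefficients. *)
Lemma line_parallel Y : line_transport Y ->
  parallel_along nabla t 0 1 (fun r => frame V a (param i (p + r *: w)) (Y r)).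
Proof.
move=> HY r r01 j b; set x := param i (p + r *: w) => jx bx.
have [ax ix xE] : [/\ tdom V a x, dom i x & coord i x = p + r *: w].
  exact/param_image/line_dom.
have oab : open (tdom V a `&` tdom V b) by apply: openI; exact: tdom_open.
pose phi d e (y : M) := triv V b (frame_section a d y) 0 e.
have Cphi d e : fun_Ck 1 (tdom V a `&` tdom V b) (phi d e).
  apply: sec_C1_coordinate; first by move=> y [].
  by apply: frame_section_C1 => y [].
have phi1 d e : deriv_within R^o `[0, 1] (fun q => phi d e (param i (p + q *: w))) r 1
    (\sum_c w 0 c * partial i c (phi d e) x).
  apply: (deriv_line `[0, 1] (f := fun y => phi d e (param i y))).
  rewrite -xE.
  exact: (fun_C1_first_order oab (Cphi d e) (conj ax bx) ix).
pose Y' d := - \sum_c \sum_e w 0 c * Y r 0 e * conn_coef nabla t a i c x e d.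
pose ds : 'rV[R]_k := \row_e \sum_d (Y' d * phi d e x +
  Y r 0 d * \sum_c w 0 c * partial i c (phi d e) x).
pose dgam : 'rV[R]_n := \row_d \sum_c w 0 c * chart_jac i j x c d.
exists dgam, ds; split=> [c|e|].
- rewrite mxE; apply: (deriv_line `[0, 1] (f := fun y => coord j (param i y) 0 c)).
  by rewrite -xE; exact: chart_jacP.
- rewrite mxE.
  have nb : \forall q \near r, tdom V b (param i (p + q *: w)).
    have Dx : (coord i @` dom i) (p + r *: w) by apply: image_dom; exact: line_dom.
    have := param_continuous_at Dx.
    move=> /(_ _ (open_nbhs_nbhs (conj (@tdom_open _ _ _ _ V b) bx))).
    exact: line_continuous.
  apply: (@deriv_within_near R R^o `[0, 1]%classic `[0, 1]%classic
    (fun q => \sum_d Y q 0 d * phi d e (param i (p + q *: w)))).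
  + by apply: (@nearW _ (nbhs (r : R^o))) => q.
  + apply: (@filterS _ (nbhs (r : R^o)) _ _ _ _ nb) => q bq.
    rewrite /= in_itv/= => /line_dom/param_image[aq iq _].
    by rewrite (triv_frameE (a := a))// frameK.
  + by rewrite (triv_frameE (a := a))// frameK.
  + by apply: deriv_within_sum => d; apply: deriv_withinM => //; exact: HY.
apply: (triv_inj bx); rewrite triv0// trivD// frameK//; apply/rowP => e.
rewrite !mxE.
pose B c d := triv V b (nabla t (frame_section b d) i c x).
pose N : 'rV[R]_k := triv V b (frame V a x (Y r)).
have -> : triv V b (\sum_c \sum_d (dgam 0 c * N 0 d) *: nabla t (frame_section b d) j c x) 0 e
    = \sum_c w 0 c * \sum_d N 0 d * B c d 0 e.
  have -> : \sum_c \sum_d (dgam 0 c * N 0 d) *: nabla t (frame_section b d) j c x =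
      \sum_c \sum_d (w 0 c * N 0 d) *: nabla t (frame_section b d) i c x.
    rewrite exchange_big [RHS]exchange_big; apply: eq_bigr => d _ /=.
    under [RHS]eq_bigr => c _.
      rewrite (cov_tensor nabla c ht (@tdom_open _ _ _ _ V b)
        (frame_section_Cinf b d 1%N) bx ix jx) scaler_sumr.
      over.
    rewrite exchange_big; apply: eq_bigr => c _ /=.
    rewrite mxE mulr_suml scaler_suml; apply: eq_bigr => c' _.
    by rewrite scalerA mulrAC.
  rewrite triv_sum// summxE; apply: eq_bigr => c _.
  rewrite triv_sum// summxE mulr_sumr; apply: eq_bigr => d _.
  by rewrite trivZ// mxE mulrA.
(* Component e, in the frame of [b], of the derivative of a frame vector of [a]. Computing it once
   in each frame, in [A1] and [A2], yields the transformation law of the coefficients. *)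
pose A c d := triv V b (nabla t (frame_section a d) i c x) 0 e.
have A1 c d : A c d = partial i c (phi d e) x + \sum_d' phi d d' x * B c d' 0 e.
  have sub : tdom V a `&` tdom V b `<=` tdom V b by move=> y [].
  have Cf : sec_Ck 1 (tdom V a `&` tdom V b) (frame_section a d).
    by apply: frame_section_C1 => y [].
  by rewrite /A (cov_triv nabla ht c e oab sub Cf (conj ax bx) ix).
have A2 c d : A c d = \sum_d' conn_coef nabla t a i c x d d' * phi d' e x.
  by rewrite /A (triv_frameE (a := a)).
have -> : \sum_d (Y' d * phi d e x + Y r 0 d * \sum_c w 0 c * partial i c (phi d e) x) =
    - \sum_c \sum_d w 0 c * Y r 0 d * A c d +
    \sum_c \sum_d w 0 c * Y r 0 d * partial i c (phi d e) x.
  rewrite big_split/=; congr (_ + _).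
    rewrite /Y'; under eq_bigr do rewrite mulNr mulr_suml.
    rewrite sumrN; congr (- _); rewrite exchange_big; apply: eq_bigr => c _ /=.
    under eq_bigr do rewrite mulr_suml.
    rewrite exchange_big; apply: eq_bigr => d _ /=.
    by rewrite A2 mulr_sumr; apply: eq_bigr => d' _; rewrite mulrA.
  under eq_bigr do rewrite mulr_sumr.
  rewrite exchange_big; apply: eq_bigr => c _; apply: eq_bigr => d _ /=.
  by ring.
have -> : \sum_c w 0 c * (\sum_d N 0 d * B c d 0 e) =
    \sum_c \sum_d w 0 c * Y r 0 d * \sum_d' phi d d' x * B c d' 0 e.
  apply: eq_bigr => c _; rewrite mulr_sumr.
  under [RHS]eq_bigr do rewrite mulr_sumr.
  rewrite [RHS]exchange_big; apply: eq_bigr => d _ /=.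
  rewrite /N (triv_frameE (a := a))// frameK// mulr_suml mulr_sumr.
  by apply: eq_bigr => d' _; rewrite -/(phi d' d x); ring.
rewrite -addrA -big_split/= -sumrN -big_split/= big1// => c _.
rewrite -big_split/= -sumrN -big_split/= big1// => d _.
by rewrite A1 mulrDr addNr.
Qed.

End line.

Section fibre_metric.
Context (R : realType) (n k : nat) (M : closed_oriented_manifold R n).
Context (V : vector_bundle M k) (h : bundle_metric V).

Lemma hprodDl x (v v' w : V x) : h x (v + v') w = h x v w + h x v' w.
Proof. by have := hprod_linear h 1 v v' w; rewrite scale1r mul1r. Qed.

Lemma hprod0l x (w : V x) : h x 0 w = 0.
Proof. by apply: (addrI (h x 0 w)); rewrite -hprodDl !addr0. Qed.

Lemma hprodZl x c (v w : V x) : h x (c *: v) w = c * h x v w.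
Proof. by rewrite -[c *: v]addr0 hprod_linear hprod0l addr0. Qed.

Lemma hprodBl x (v v' w : V x) : h x (v - v') w = h x v w - h x v' w.
Proof. by rewrite hprodDl -scaleN1r hprodZl mulN1r. Qed.

Lemma hprod_suml x (I : Type) (r : seq I) (v : I -> V x) w :
  h x (\sum_(d <- r) v d) w = \sum_(d <- r) h x (v d) w.
Proof.
by apply: (big_morph (fun v => h x v w)); [move=> ? ?; exact: hprodDl|exact: hprod0l].
Qed.

Lemma hprodBr x (w v v' : V x) : h x w (v - v') = h x w v - h x w v'.
Proof. by rewrite !(hprod_sym h w) hprodBl. Qed.

Lemma hprodZr x c (v w : V x) : h x w (c *: v) = c * h x w v.
Proof. by rewrite !(hprod_sym h w) hprodZl. Qed.

Lemma hprod_sumr x (I : Type) (r : seq I) (v : I -> V x) w :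
  h x w (\sum_(d <- r) v d) = \sum_(d <- r) h x w (v d).
Proof. by rewrite hprod_sym hprod_suml; apply: eq_bigr => d _; rewrite hprod_sym. Qed.

Lemma hprod_ge0 x (v : V x) : 0 <= h x v v.
Proof. by have [->|/hprod_pos/ltW//] := eqVneq v 0; rewrite hprod0l. Qed.

(** Takes the place of the Cauchy-Schwarz inequality and keeps the estimates in terms of squared
    distances. *)
Lemma hprod_AMGM x (v w : V x) : 2 * h x v w <= h x v v + h x w w.
Proof.
have := hprod_ge0 (v - w); rewrite hprodBl !hprodBr (hprod_sym h w v); lra.
Qed.

End fibre_metric.

Section transport.
Context (R : realType) (n k : nat) (M : closed_oriented_manifold R n).
Context (V : vector_bundle M k) (T : R) (nabla : connection_family V T).
Context (t : R) (ht : 0 <= t <= T) (a : tindex V) (i : chart M).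
Let D := coord i @` (tdom V a `&` dom i).

(** The equation is linear in Y, so the length of line on which one Picard step covers all of [0, 1]
    does not depend on the initial vector v. The displacement bound, linear in |w|, keeps translated
    vectors close to v over nearby points. *)
Lemma line_transport_exists (x0 : M) : tdom V a x0 -> dom i x0 ->
  exists2 r0 : R, 0 < r0 & ball (coord i x0) r0 `<=` D /\
  exists2 C : R, 0 <= C & forall p w v,
    (forall r : R, 0 <= r <= 1 -> ball (coord i x0) r0 (p + r *: w)) ->
    exists Y, [/\ Y 0 = v, line_transport nabla t a i p w Y &
      `|Y 1 - v| <= C * `|w| * (2 * `|v| + 1)].
Proof.
move=> ax ix; have oad : open (tdom V a `&` dom i).
  by apply: openI; [exact: tdom_open|exact: dom_open].
have oD : open D by apply: coord_image_open_sub; exact: tdom_open.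
have Dx : D (coord i x0) by exact: coord_image.
pose om c d e (y : 'rV[R]_n) := conn_coef nabla t a i c (param i y) d e.
have omc c d e : {within D, continuous (om c d e)}.
  have := @conn_coef_C1 _ _ _ _ _ _ nabla t ht _ a i c d e oad
    (fun _ => @proj1 _ _) (fun _ => @proj2 _ _) i.
  move/Ck_along_continuous; apply: within_continuous_sub.
  by move=> _ [x [? ?] <-]; exists x.
(* The sum bounds every coefficient at x0; the added 1 lets the bound persist nearby. *)
pose C0 := 1 + \sum_c \sum_d \sum_e `|om c d e (coord i x0)|.
have C0_ge0 : 0 <= C0.
  by rewrite addr_ge0// sumr_ge0// => c _; rewrite sumr_ge0// => d _; rewrite sumr_ge0.
have omb : \forall y \near coord i x0, D y /\ forall c d e, `|om c d e y| <= C0.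
  have nD : nbhs (coord i x0) D by exact: open_nbhs_nbhs.
  have H (j : 'I_n * 'I_k * 'I_k) : \forall y \near coord i x0,
      D y -> `|om j.1.1 j.1.2 j.2 y| <= C0.
    move: j => [[c d] e] /=.
    have /subspace_continuousP/(_ _ Dx) := omc c d e.
    move=> /cvgrPdist_le/(_ _ ltr01); rewrite nearE /within /=.
    apply: (@filterS _ (nbhs (coord i x0))) => y + Dy => /(_ Dy) Hy.
    rewrite -[om c d e y](subrK (om c d e (coord i x0))) (le_trans (ler_normD _ _))//.
    rewrite lerD//; first by rewrite distrC.
    rewrite (bigD1 c)//= (bigD1 d)//= (bigD1 e)//= -!addrA lerDl addr_ge0//.
      by rewrite sumr_ge0.
    rewrite addr_ge0//; first by rewrite sumr_ge0// => ? _; rewrite sumr_ge0.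
    by rewrite sumr_ge0// => ? _; rewrite sumr_ge0// => ? _; rewrite sumr_ge0.
  have H2 := @filter_forall _ ('I_n * 'I_k * 'I_k)%type (fun j y => D y ->
      `|om j.1.1 j.1.2 j.2 y| <= C0) (nbhs (coord i x0)) _ H.
  apply: filterS2 nD (H2 _) => y Dy Hy; split=> // c d e.
  exact: (Hy (c, d, e)).
move: omb => /nbhs_ballP[d1 /= d10 Hd1].
pose C := (n * k)%:R * C0.
have C_ge0 : 0 <= C by rewrite mulr_ge0.
(* A line contained in a ball of radius [r0] has |w| <= 2 r0, so this choice gives C |w| <= 1/2, the
   contraction condition on [0, 1]. *)
pose r0 := Num.min d1 (1 / (4 * (C + 1))).
have C10 : 0 < 4 * (C + 1) by rewrite mulr_gt0// ltr_wpDl.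
have r00 : 0 < r0 by rewrite lt_min d10 divr_gt0.
have r0C : C * (2 * r0) <= 2^-1.
  have r0le : r0 * (4 * (C + 1)) <= 1 by rewrite -ler_pdivlMr// /r0 ge_min lexx orbT.
  by rewrite -(@ler_pM2r _ 2)// mulVf//; nra.
have sub : ball (coord i x0) r0 `<=` ball (coord i x0) d1.
  by apply: le_ball; rewrite /r0 ge_min lexx.
exists r0 => //; split; first by move=> y /sub/Hd1[].
exists C => // p w v line_ball.
have wC : C * `|w| <= 2^-1.
  apply: le_trans r0C; rewrite ler_wpM2l//.
  have B0 : ball (coord i x0) r0 p.
    by rewrite -[p]addr0 -(scale0r w); apply: line_ball; rewrite lexx ler01.
  have B1 : ball (coord i x0) r0 (p + w).
    by rewrite -[w]scale1r; apply: line_ball; rewrite lexx ler01.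
  move: B0 B1; rewrite -ball_normE/= => B0 B1.
  have -> : w = (coord i x0 - p) - (coord i x0 - (p + w)).
    by apply/rowP => e; rewrite !mxE; ring.
  rewrite (le_trans (ler_normB _ _))// mulr_natl mulr2n ltW// ltrD//.
pose f (r : R) (y : 'rV[R]_k) : 'rV[R]_k :=
  \row_e (- \sum_c \sum_d w 0 c * y 0 d * om c d e (p + r *: w)).
have fB r y y' : f r y - f r y' = f r (y - y').
  apply/rowP => e; rewrite !mxE -opprD; congr (- _).
  rewrite -sumrB; apply: eq_bigr => c _; rewrite -sumrB; apply: eq_bigr => d _.
  by rewrite !mxE; ring.
have fle r y : 0 <= r <= 1 -> `|f r y| <= C * `|w| * `|y|.
  move=> /line_ball/sub/Hd1[_ Hom].
  apply/rV_norm_leP; first by rewrite !mulr_ge0.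
  move=> e; rewrite mxE normrN.
  apply: le_trans (ler_norm_sum _ _ _) _.
  apply: (@le_trans _ _ (\sum_(c < n) \sum_(d < k) `|w| * `|y| * C0)).
    apply: ler_sum => c _; apply: le_trans (ler_norm_sum _ _ _) _.
    apply: ler_sum => d _; rewrite !normrM.
    apply: ler_pM => //.
    by apply: ler_pM => //; exact: rV_norm_coord.
  rewrite !sumr_const !card_ord -mulrnA -mulr_natl /C.
  by rewrite mulnC le_eqVlt; apply/orP; left; apply/eqP; ring.
have CW0 : 0 <= C * `|w| by rewrite mulr_ge0.
have v10 : 0 <= `|v| + 1 by rewrite addr_ge0.
(* On the ball of radius |v| + 1 around v vectors have norm at most 2 |v| + 1, which gives the speed
   bound; half of it is below the radius, so solutions do not leave the ball. *)
have [|||||||Y [Y0 Yb Yd]] := @picard_lindelof R k 0 1 (`|v| + 1)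
    (C * `|w| * (2 * `|v| + 1)) (C * `|w|) v f ler01 v10.
- by rewrite mulr_ge0// addr_ge0// mulr_ge0.
- exact: CW0.
- move=> y _; apply/within_continuous_rV => e.
  have H : {within `[0, 1], continuous (fun r : R =>
      - 1 * \sum_c \sum_d w 0 c * y 0 d * om c d e (p + r *: w))}.
    apply: within_continuous_mul; first exact: within_continuous_cst.
    apply: within_continuous_sum => c; apply: within_continuous_sum => d.
    apply: within_continuous_mul; first exact: within_continuous_cst.
    apply: (within_continuous_map _ _ (omc c d e)).
      by apply: continuous_subspaceT; exact: line_continuous.
    by move=> r; rewrite /= in_itv/= => /line_ball/sub/Hd1[].
  by apply: within_continuous_ext H => r _; rewrite mxE mulN1r.
- by move=> r y y' r01 _ _; rewrite fB fle.
- move=> r y r01 yv; apply: le_trans (fle r y r01) _; rewrite ler_wpM2l//.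
  rewrite -[y](subrK v) (le_trans (ler_normD _ _))//; lra.
- rewrite subr0 mulr1; apply: (@le_trans _ _ (2^-1 * (2 * `|v| + 1))).
    by rewrite ler_wpM2r// addr_ge0// mulr_ge0.
  by have := normr_ge0 v; lra.
- by rewrite subr0 mulr1.
exists Y; split=> //.
  by move=> r e r01; have := Yd r e r01; rewrite mxE.
by have := Yb 1; rewrite lexx ler01 subr0 mulr1; apply.
Qed.

End transport.

Section line_metric.
Context (R : realType) (n k : nat) (M : closed_oriented_manifold R n).
Context (V : vector_bundle M k) (h : bundle_metric V).
Context (T : R) (nabla : connection_family V T) (hc : compatible nabla h).
Context (t : R) (ht : 0 <= t <= T) (a : tindex V) (i : chart M).
Context (p w : 'rV[R]_n).
Let D := coord i @` (tdom V a `&` dom i).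
Hypothesis line_dom : forall r : R, 0 <= r <= 1 -> D (p + r *: w).
Let gam r := param i (p + r *: w).

(** Compatibility concerns sections over open sets, whereas [S] and [N] live on the line only. It is
    applied to the frame vectors, after expanding both curves in the frame. *)
Lemma deriv_hprod_line (S N : R -> 'rV[R]_k) (S' : 'rV[R]_k) r : 0 <= r <= 1 ->
  line_transport nabla t a i p w N ->
  (forall e, deriv_within R^o `[0, 1] (fun q => S q 0 e) r 1 (S' 0 e)) ->
  deriv_within R^o `[0, 1]
    (fun q => h (gam q) (frame V a (gam q) (S q)) (frame V a (gam q) (N q))) r 1
    (h (gam r) (frame V a (gam r) S' + \sum_c \sum_d (w 0 c * S r 0 d) *:
       nabla t (frame_section a d) i c (gam r)) (frame V a (gam r) (N r))).
Proof.
move=> r01 HN HS; set x := gam r.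
have [ax ix xE] : [/\ tdom V a x, dom i x & coord i x = p + r *: w].
  exact/param_image/line_dom.
pose hm d e (y : M) := h y (frame_section a d y) (frame_section a e y).
have Chm d e : fun_Ck 1 (tdom V a) (hm d e) by exact: hprod_smooth.
pose E d := frame_section a d x.
pose nE c d := nabla t (frame_section a d) i c x.
have phm d e c : partial i c (hm d e) x = h x (nE c d) (E e) + h x (E d) (nE c e).
  have [Cd Ce] := (@frame_section_Cinf _ _ _ _ V a d, @frame_section_Cinf _ _ _ _ V a e).
  exact: hc ht (@tdom_open _ _ _ _ V a) Cd Ce ax ix.
have hm1 d e : deriv_within R^o `[0, 1] (fun q => hm d e (gam q)) r 1
    (\sum_c w 0 c * partial i c (hm d e) x).
  apply: (deriv_line `[0, 1] (f := fun y => hm d e (param i y))).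
  by rewrite -xE; exact: (fun_C1_first_order (@tdom_open _ _ _ _ V a) (Chm d e) ax ix).
pose N' d := - \sum_c \sum_e w 0 c * N r 0 e * conn_coef nabla t a i c x e d.
have expand q (u v : 'rV[R]_k) : 0 <= q <= 1 ->
    h (gam q) (frame V a (gam q) u) (frame V a (gam q) v) =
    \sum_d \sum_e u 0 d * v 0 e * hm d e (gam q).
  move=> /line_dom/param_image[aq _ _]; rewrite (frameE u aq) (frameE v aq).
  rewrite hprod_suml; apply: eq_bigr => d _; rewrite hprod_sumr; apply: eq_bigr => e _.
  by rewrite hprodZl hprodZr mulrA.
have fN : frame V a x (\row_d N' d) = - \sum_c \sum_d (w 0 c * N r 0 d) *: nE c d.
  apply: (triv_inj ax); rewrite frameK// -scaleN1r trivZ// scaleN1r triv_sum//.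
  apply/rowP => e; rewrite !mxE summxE /N'; congr (- _).
  apply: eq_bigr => c _; rewrite triv_sum// summxE; apply: eq_bigr => d _.
  by rewrite trivZ// mxE.
have : deriv_within R^o `[0, 1]
    (fun q => \sum_d \sum_e S q 0 d * N q 0 e * hm d e (gam q)) r 1
    (\sum_d \sum_e ((S' 0 d * N r 0 e + S r 0 d * N' e) * hm d e x +
       S r 0 d * N r 0 e * \sum_c w 0 c * partial i c (hm d e) x)).
  apply: deriv_within_sum => d; apply: deriv_within_sum => e.
  apply: deriv_withinM (hm1 d e); apply: deriv_withinM => //.
  exact: HN.
set l := (X in deriv_within _ _ _ _ _ X).
have -> : l = h x (frame V a x S' + \sum_c \sum_d (w 0 c * S r 0 d) *: nE c d)
    (frame V a x (N r)).
  have E1 : h x (frame V a x S') (frame V a x (N r)) =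
      \sum_d \sum_e S' 0 d * N r 0 e * hm d e x by rewrite expand.
  have E2 : h x (frame V a x (S r)) (frame V a x (\row_d N' d)) =
      \sum_d \sum_e S r 0 d * N' e * hm d e x.
    by rewrite expand//; apply: eq_bigr => d _; apply: eq_bigr => e _; rewrite mxE.
  have G (u v : 'rV[R]_k) : h x (\sum_c \sum_d (w 0 c * u 0 d) *: nE c d)
      (frame V a x v) =
      \sum_d \sum_e u 0 d * v 0 e * \sum_c w 0 c * h x (nE c d) (E e).
    transitivity (\sum_c \sum_d \sum_e
        u 0 d * v 0 e * (w 0 c * h x (nE c d) (E e))).
      rewrite hprod_suml; apply: eq_bigr => c _.
      rewrite hprod_suml; apply: eq_bigr => d _.
      rewrite hprodZl frameE// hprod_sumr mulr_sumr; apply: eq_bigr => e _.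
      by rewrite hprodZr; ring.
    rewrite exchange_big; apply: eq_bigr => d _ /=.
    by rewrite exchange_big; apply: eq_bigr => e _ /=; rewrite mulr_sumr.
  rewrite hprodDl G E1 /l.
  (* Since [N] is parallel, its derivative contributes the negative of the terms in which the
     connection acts on the second frame vector; only the covariant derivative of [S] survives. *)
  have E4 : \sum_d \sum_e S r 0 d * N' e * hm d e x =
      - \sum_d \sum_e S r 0 d * N r 0 e * \sum_c w 0 c * h x (E d) (nE c e).
    rewrite -E2 fN hprod_sym -scaleN1r hprodZl mulN1r G exchange_big; congr (- _).
    apply: eq_bigr => d _; apply: eq_bigr => e _ /=; rewrite (mulrC (N r 0 e)).
    by congr (_ * _); apply: eq_bigr => c _; rewrite hprod_sym.
  transitivity (\sum_d \sum_e S' 0 d * N r 0 e * hm d e x +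
      \sum_d \sum_e S r 0 d * N' e * hm d e x +
      (\sum_d \sum_e S r 0 d * N r 0 e * (\sum_c w 0 c * h x (nE c d) (E e)) +
      \sum_d \sum_e S r 0 d * N r 0 e * (\sum_c w 0 c * h x (E d) (nE c e)))).
    rewrite -!big_split/=; apply: eq_bigr => d _; rewrite -!big_split/=.
    apply: eq_bigr => e _; rewrite -mulrDr -big_split/= mulrDl; congr (_ + _ * _).
    by apply: eq_bigr => c _; rewrite phm mulrDr.
  by rewrite E4; ring.
apply: deriv_within_sub => //.
by move=> q; rewrite /= in_itv/= => q01; rewrite expand.
Qed.

End line_metric.

Section transport_along_lines.
Context (R : realType) (n k : nat) (M : closed_oriented_manifold R n).
Context (V : vector_bundle M k) (T : R) (nabla : connection_family V T).
Context (t : R) (ht : 0 <= t <= T) (a : tindex V) (i : chart M).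
Let O := tdom V a `&` dom i.
Let D := coord i @` O.

(** The transport equation is invariant under reparametrization, so a field parallel along a line
    can be followed backwards from any intermediate point to the start. *)
Lemma line_transport_reverse (p w : 'rV[R]_n) N (s : R) : 0 <= s <= 1 ->
  line_transport nabla t a i p w N ->
  line_transport nabla t a i (p + s *: w) (- s *: w) (fun r => N (s * (1 - r))).
Proof.
move=> /andP[s0 s1] HN r e /andP[r0 r1].
have sr : 0 <= s * (1 - r) <= 1 by apply/andP; split; nra.
have := deriv_within_dirZ (c := - s) (HN _ e sr).
have pw : p + s *: w + r *: (- s *: w) = p + (s * (1 - r)) *: w.
  by apply/rowP => j; rewrite !mxE; ring.
rewrite pw (_ : - s * _ = - \sum_c \sum_d (- s *: w) 0 c * N (s * (1 - r)) 0 d *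
   conn_coef nabla t a i c (param i (p + (s * (1 - r)) *: w)) d e); last first.
  rewrite mulrN mulr_sumr; congr (- _); apply: eq_bigr => c _.
  by rewrite mulr_sumr; apply: eq_bigr => d _; rewrite mxE; ring.
apply: (deriv_within_affine (phi := fun q : R^o => s * (1 - q))).
  by move=> q; rewrite /GRing.scale/=; ring.
by move=> q; rewrite /= !in_itv/= => /andP[q0 q1]; apply/andP; split; nra.
Qed.

Lemma frame_line_transport (p w : 'rV[R]_n) (N : R -> 'rV[R]_k) (r : R) : D (p + r *: w) ->
  frame V a (param i (p + r *: w)) (\row_d - \sum_c \sum_e w 0 c * N r 0 e *
     conn_coef nabla t a i c (param i (p + r *: w)) e d) =
  - \sum_c \sum_d (w 0 c * N r 0 d) *:
    nabla t (frame_section a d) i c (param i (p + r *: w)).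
Proof.
move=> /param_image[ax ix _].
apply: (triv_inj ax); rewrite frameK// -scaleN1r trivZ// scaleN1r triv_sum//.
apply/rowP => e; rewrite !mxE summxE; congr (- _).
apply: eq_bigr => c _; rewrite triv_sum// summxE; apply: eq_bigr => d _.
by rewrite trivZ// mxE.
Qed.

Lemma line_transport_invariant (K : set (total_space V)) (p w : 'rV[R]_n) Y :
  parallel_invariant nabla t K ->
  (forall r : R, 0 <= r <= 1 -> D (p + r *: w)) ->
  line_transport nabla t a i p w Y ->
  K (Vec (param i p) (frame V a (param i p) (Y 0))) ->
  K (Vec (param i (p + w)) (frame V a (param i (p + w)) (Y 1))).
Proof.
move=> HK line_dom HY.
have := HK 0 1 _ _ ltr01 (smooth_line line_dom) (line_parallel ht line_dom HY).
by rewrite scale0r addr0 scale1r.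
Qed.

Context (h : bundle_metric V) (hc : compatible nabla h).

Lemma line_transport_hprod (p w : 'rV[R]_n) Y N (r : R) :
  (forall r : R, 0 <= r <= 1 -> D (p + r *: w)) ->
  line_transport nabla t a i p w Y -> line_transport nabla t a i p w N ->
  0 <= r <= 1 ->
  h (param i (p + r *: w)) (frame V a (param i (p + r *: w)) (Y r))
    (frame V a (param i (p + r *: w)) (N r)) =
  h (param i p) (frame V a (param i p) (Y 0)) (frame V a (param i p) (N 0)).
Proof.
move=> line_dom HY HN /andP[r0 r1].
pose f q := h (param i (p + q *: w)) (frame V a (param i (p + q *: w)) (Y q))
  (frame V a (param i (p + q *: w)) (N q)).
have -> : h (param i p) (frame V a (param i p) (Y 0))
    (frame V a (param i p) (N 0)) = f 0.
  by rewrite /f scale0r addr0.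
rewrite -/(f r); apply/eqP; rewrite -subr_eq0 -normr_le0.
have := @segment_deriv_dist R 0 r f (fun=> 0) 0 r0; rewrite mul0r; apply.
  move=> q /andP[q0 qr]; have q01 : 0 <= q <= 1 by rewrite q0 (le_trans qr).
  apply: (@segment_deriv_sub _ 0 1) => //; first by rewrite q0.
  have := deriv_hprod_line hc ht line_dom q01 HN (S := Y) (S' := \row_d
    - \sum_c \sum_e w 0 c * Y q 0 e *
     conn_coef nabla t a i c (param i (p + q *: w)) e d).
  rewrite frame_line_transport; last exact: line_dom.
  rewrite addNr hprod0l; apply=> e; rewrite mxE; exact: HY.
by move=> q _; rewrite normr0.
Qed.

(** Applied to a section and then to its covariant derivatives, this gives the first and second
    derivatives of <s, N> along a line. *)
Lemma deriv_hprod_section (p w : 'rV[R]_n) (s : section_of V) N (r : R) :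
  (forall r : R, 0 <= r <= 1 -> D (p + r *: w)) ->
  sec_Ck 1 O s -> line_transport nabla t a i p w N -> 0 <= r <= 1 ->
  deriv_within R^o `[0, 1] (fun q => h (param i (p + q *: w))
      (s (param i (p + q *: w))) (frame V a (param i (p + q *: w)) (N q))) r 1
    (\sum_c w 0 c * h (param i (p + r *: w))
      (nabla t s i c (param i (p + r *: w)))
      (frame V a (param i (p + r *: w)) (N r))).
Proof.
move=> line_dom Cs HN r01.
have oO : open O by apply: openI; [exact: tdom_open|exact: dom_open].
have Oa : O `<=` tdom V a by move=> y [].
have [ax ix xE] := param_image (line_dom r r01); set x := param i (p + r *: w) in ax ix xE *.
have Cse e : fun_Ck 1 O (fun y => triv V a (s y) 0 e) by exact: sec_C1_coordinate.
have := deriv_hprod_line hc ht line_dom r01 HN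
  (S := fun q => triv V a (s (param i (p + q *: w))))
  (S' := \row_e \sum_c w 0 c * partial i c (fun y => triv V a (s y) 0 e) x).
rewrite -/x (_ : frame V a x _ + _ = \sum_c w 0 c *: nabla t s i c x); last first.
  rewrite frameE//.
  under eq_bigr do rewrite mxE scaler_suml.
  rewrite exchange_big/= -big_split/=; apply: eq_bigr => c _.
  rewrite (cov_coord nabla ht (a := a) c oO Oa Cs (conj ax ix) ix) scaler_sumr.
  by rewrite -big_split/=; apply: eq_bigr => d _; rewrite scalerDr !scalerA.
rewrite hprod_suml (eq_bigr (fun c => w 0 c * h x (nabla t s i c x) (frame V a x (N r))));
  last by move=> c _; rewrite hprodZl.
move=> H; apply: (deriv_within_sub _ _ _ (H _)) => //.
  by move=> q; rewrite /= in_itv/= => /line_dom/param_image[aq _ _]; rewrite trivK.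
move=> e; rewrite mxE; apply: (deriv_line `[0, 1] (f := fun y => triv V a (s (param i y)) 0 e)).
by rewrite -xE; exact: (fun_C1_first_order oO (Cse e) (conj ax ix) ix).
Qed.

End transport_along_lines.

(** * The elliptic inequality at a maximal distance *)

Section quadratic_forms.
Context (R : realType) (n : nat).
Implicit Types (P B : 'I_n -> 'I_n -> R) (w : 'I_n -> R).

Definition qform P w : R := \sum_b \sum_c w b * w c * P b c.

Lemma qform_shift P w (s : R) j : (forall b c, P b c = P c b) ->
  qform P (fun b => w b + s * (b == j)%:R) =
  qform P w + 2 * s * (\sum_b w b * P b j) + s ^+ 2 * P j j.
Proof.
move=> symP.
have sel (f : 'I_n -> R) : \sum_b (b == j)%:R * f b = f j.
  by rewrite (bigD1 j)//= eqxx mul1r big1 ?addr0// => b /negbTE ->; rewrite mul0r.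
rewrite /qform.
transitivity (\sum_b \sum_c (w b * w c * P b c + s * (b == j)%:R * (w c * P b c) +
    (s * (c == j)%:R * (w b * P b c) + s ^+ 2 * (b == j)%:R * ((c == j)%:R * P b c)))).
  by apply: eq_bigr => b _; apply: eq_bigr => c _; ring.
under eq_bigr do rewrite !big_split/=.
rewrite !big_split/= -!addrA; congr (_ + _).
have -> : \sum_b \sum_c s * (b == j)%:R * (w c * P b c) = s * \sum_b w b * P b j.
  under eq_bigr do rewrite -mulr_sumr -mulrA.
  rewrite -mulr_sumr sel; congr (_ * _); apply: eq_bigr => b _.
  by rewrite symP.
have -> : \sum_b \sum_c s * (c == j)%:R * (w b * P b c) = s * \sum_b w b * P b j.
  rewrite mulr_sumr; apply: eq_bigr => b _; under eq_bigr do rewrite -mulrA.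
  by rewrite -mulr_sumr sel.
have -> : \sum_b \sum_c s ^+ 2 * (b == j)%:R * ((c == j)%:R * P b c) = s ^+ 2 * P j j.
  under eq_bigr do rewrite -mulr_sumr sel -mulrA.
  by rewrite -mulr_sumr (sel (fun b => P b j)).
by ring.
Qed.

Lemma qform_delta P j : (forall b c, P b c = P c b) ->
  qform P (fun b => (b == j)%:R) = P j j.
Proof.
move=> symP; have := qform_shift (fun=> 0) 1 j symP.
have -> : qform P (fun=> 0) = 0.
  by rewrite /qform big1// => b _; rewrite big1// => c _; rewrite !mul0r.
have -> : \sum_b 0 * P b j = 0 by rewrite big1// => b _; rewrite mul0r.
rewrite mulr0 !add0r expr1n mul1r => <-.
by congr qform; apply/funext => b; rewrite add0r mul1r.
Qed.

(** When P j j = 0, the form at e_b + s e_j is affine in s; being nonnegative for all s, it has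
    slope zero. *)
Lemma psd_zero_diag P j : (forall b c, P b c = P c b) ->
  (forall w, 0 <= qform P w) -> P j j = 0 -> forall b, P b j = 0.
Proof.
move=> symP psd Pjj b.
have H s : 0 <= P b b + 2 * s * P b j.
  have := psd (fun c => (c == b)%:R + s * (c == j)%:R).
  rewrite (qform_shift _ s j symP) Pjj mulr0 addr0.
  rewrite qform_delta//.
  rewrite (bigD1 b)//= eqxx mul1r big1 ?addr0//.
  by move=> c /negbTE ->; rewrite mul0r.
have [//|Pbj] := eqVneq (P b j) 0.
(* The value of s at which the affine function equals -1. *)
have := H (- (P b b + 1) / (2 * P b j)).
have -> : P b b + 2 * (- (P b b + 1) / (2 * P b j)) * P b j = - 1 by field.
by rewrite lerNr oppr0 ler10.
Qed.

(* Symmetric Gaussian elimination writes P as a sum of nonnegative multiples of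
   rank one forms q q^T. *)
Lemma psd_trace_le0 P B : (forall b c, P b c = P c b) ->
  (forall w, 0 <= qform P w) -> (forall w, qform B w <= 0) ->
  \sum_b \sum_c P b c * B b c <= 0.
Proof.
move=> + + nB.
(* Induction on the number m of rows not yet eliminated: the rows with b + m < n are already zero.
   In the inductive step the pivot j = n - (m + 1) is the first remaining row. *)
suff H m : forall P, (forall b c, P b c = P c b) -> (forall w, 0 <= qform P w) ->
    (forall b c : 'I_n, (b + m < n)%N -> P b c = 0) ->
    \sum_b \sum_c P b c * B b c <= 0.
  by move=> symP psd; apply: (H n) => // b c; rewrite ltnNge leq_addl.
elim: m => [|m IH] {}P symP psd P0.
  rewrite big1// => b _; rewrite big1// => c _; rewrite P0 ?mul0r//.
  by rewrite addn0 ltn_ord.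
have [mn|nm] := ltnP m n; last first.
  apply: IH => // b c bm; exfalso.
  by move: bm; rewrite ltnNge (leq_trans nm)// leq_addl.
have jn : (n - m.+1 < n)%N by rewrite ltn_subrL (leq_ltn_trans _ mn).
pose j := Ordinal jn.
have jE (b : 'I_n) : (b + m < n)%N -> (b + m.+1 < n)%N \/ b = j.
  rewrite addnS leq_eqVlt => /predU1P[E|]; last by left.
  by right; apply/val_inj => /=; lia.
have [Pjj|Pjj] := eqVneq (P j j) 0.
  apply: IH => // b c /jE[/P0//|->]; rewrite symP.
  exact: psd_zero_diag.
have pj w : qform P (fun b => w b + - ((\sum_b w b * P b j) / P j j) * (b == j)%:R) =
    qform P w - (\sum_b w b * P b j) ^+ 2 / P j j.
  by rewrite qform_shift//; field.
have Pjj0 : 0 < P j j.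
  rewrite lt_neqAle eq_sym Pjj/=.
  by have := psd (fun b => (b == j)%:R); rewrite qform_delta.
(* The Schur complement of the pivot. It stays nonnegative because its form at w is that of P at the
   vector obtained by completing the square. *)
pose P' b c := P b c - P b j * P c j / P j j.
have qP' w : qform P' w = qform P w - (\sum_b w b * P b j) ^+ 2 / P j j.
  rewrite /qform /P'.
  under eq_bigr do (under eq_bigr do rewrite mulrBr; rewrite sumrB).
  rewrite sumrB; congr (_ - _); rewrite expr2 -mulrA mulr_suml.
  apply: eq_bigr => b _; rewrite mulr_suml mulr_sumr.
  by apply: eq_bigr => c _; ring.
have -> : \sum_b \sum_c P b c * B b c = \sum_b \sum_c P' b c * B b c +
    (P j j)^-1 * qform B (fun b => P b j).
  rewrite /qform mulr_sumr -big_split/=; apply: eq_bigr => b _.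
  rewrite mulr_sumr -big_split/=; apply: eq_bigr => c _.
  by rewrite /P'; field.
rewrite -[leRHS]addr0 lerD//; last by rewrite pmulr_rle0 ?invr_gt0.
apply: IH => [b c|w|b c /jE[bm|->]].
- by rewrite /P' symP (mulrC (P b j)).
- by rewrite qP' -pj.
- by rewrite /P' (P0 b c bm) (P0 b j bm) !mul0r subr0.
- by rewrite /P' symP; field.
Qed.

End quadratic_forms.

(** The inverse matrix is nonnegative too: its form at w is that of [G] at w G^-1. No symmetry of
    [B] is assumed, because second covariant derivatives commute only up to curvature. *)
Lemma posdef_trace_le0 (R : realType) (n : nat) (G : 'M[R]_n) (B : 'I_n -> 'I_n -> R) :
  G^T = G -> (forall v : 'rV[R]_n, v != 0 -> 0 < (v *m G *m v^T) 0 0) ->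
  (forall w, qform B w <= 0) -> \sum_b \sum_c invmx G b c * B b c <= 0.
Proof.
move=> symG posG nB.
have uG : G \in unitmx.
  rewrite -row_free_unit; apply/row_freeP.
  have [//|] := boolP (row_free G); first by move/row_freeP.
  rewrite -kermx_eq0 => /rowV0Pn[v /sub_kermxP vG v0].
  by have := posG v v0; rewrite vG mul0mx mxE ltxx.
have symI : (invmx G)^T = invmx G by rewrite trmx_inv symG.
have psd (w : 'rV[R]_n) : 0 <= (w *m invmx G *m w^T) 0 0.
  have [->|w0] := eqVneq w 0; first by rewrite !mul0mx mxE.
  have := posG (w *m invmx G); rewrite mulmxKV// trmx_mul symI mulmxA.
  move=> /(_ _)/ltW; apply; apply: contra_neq w0 => H.
  by rewrite -[w](mulmxKV uG) H mul0mx.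
apply: psd_trace_le0 => // [b c|w].
  by rewrite -[in LHS]symI mxE.
have := psd (\row_b w b); rewrite mxE.
congr (0 <= _); rewrite /qform exchange_big; apply: eq_bigr => c _.
rewrite !mxE mulr_suml; apply: eq_bigr => b _; rewrite !mxE /=; ring.
Qed.

Section maximum.
Context (R : realType) (n k : nat) (M : closed_oriented_manifold R n).
Context (V : vector_bundle M k) (T : R) (nabla : connection_family V T).
Context (h : bundle_metric V) (hc : compatible nabla h).
Context (t : R) (ht : 0 <= t <= T) (a : tindex V) (i : chart M).
Let O := tdom V a `&` dom i.
Let D := coord i @` O.

(* With N parallel along a line through x0, the function <s, N> has a maximum
   at x0: nearby fibres of K lie below the parallel translates of the supporting
   hyperplane, and s is at distance at most |N| from K. *)
Lemma hprod_line_max (K : set (total_space V)) (s : section_of V) (x0 : M)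
    (n0 : 'rV[R]_k) (m : R) : tdom V a x0 -> dom i x0 ->
  parallel_invariant nabla t K ->
  (forall v, K (Vec x0 v) -> h x0 v (frame V a x0 n0) <= m) ->
  let q := h x0 (frame V a x0 n0) (frame V a x0 n0) in
  h x0 (s x0) (frame V a x0 n0) = m + q ->
  (forall x, exists2 v, K (Vec x v) & h x (s x - v) (s x - v) <= q) ->
  exists2 r0 : R, 0 < r0 & forall w, `|w| < r0 ->
    (forall r, 0 <= r <= 1 -> D (coord i x0 + r *: w)) /\
    exists N, [/\ N 0 = n0, line_transport nabla t a i (coord i x0) w N &
      forall r, 0 <= r <= 1 ->
        h (param i (coord i x0 + r *: w)) (s (param i (coord i x0 + r *: w)))
          (frame V a (param i (coord i x0 + r *: w)) (N r)) <= m + q].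
Proof.
move=> ax ix HK Hm q Hq Hd.
have [r0 r00 [sub [C C0 HT]]] := line_transport_exists nabla ht ax ix.
exists r0 => // w wr0; set p := coord i x0.
have line_ball (r : R) : 0 <= r <= 1 -> ball p r0 (p + r *: w).
  move=> /andP[r_ge0 r1]; rewrite -ball_normE/= opprD addrA subrr add0r normrN.
  by rewrite normrZ ger0_norm// (le_lt_trans _ wr0)// ler_piMl.
have line_dom r : 0 <= r <= 1 -> D (p + r *: w) by move=> /line_ball/sub.
split=> //; have [N [N0 HN _]] := HT p w n0 line_ball.
exists N; split=> // r r01.
set x := param i (p + r *: w).
have [ax' ix' xE] := param_image (line_dom r r01).
rewrite -/x in ax' ix' xE.
have [v Kv vq] := Hd x.
have NN : h x (frame V a x (N r)) (frame V a x (N r)) = q.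
  rewrite (line_transport_hprod ht hc line_dom HN HN r01) N0.
  by rewrite /p coordK.
have back (u : R) : 0 <= u <= 1 -> ball p r0 (p + r *: w + u *: (- r *: w)).
  move=> /andP[u0 u1].
  have -> : p + r *: w + u *: (- r *: w) = p + (r * (1 - u)) *: w.
    by apply/rowP => j; rewrite !mxE; ring.
  by apply: line_ball; case/andP: r01 => ? ?; apply/andP; split; nra.
have back_dom u : 0 <= u <= 1 -> D (p + r *: w + u *: (- r *: w)) by move=> /back/sub.
(* The point [v] of the nearby fibre is carried back to x0, where the bound [Hm] of the supporting
   half space holds; products with the reversed field [N] are preserved. *)
have [Y [Y0 HY _]] := HT _ _ (triv V a v) back.
have HZ := line_transport_reverse r01 HN.
have KY := line_transport_invariant ht HK back_dom HY.
rewrite Y0 -/x trivK// in KY; have {}KY := KY Kv.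
have pE : p + r *: w + (- r) *: w = p by rewrite scaleNr addrK.
rewrite pE /p coordK// in KY.
have one01 : 0 <= (1 : R) <= 1 by rewrite lexx ler01.
have := line_transport_hprod ht hc back_dom HY HZ one01.
rewrite scale1r pE /p coordK// -/p -/x subrr mulr0 N0 subr0 mulr1 Y0 trivK// => HhY.
have vm : h x v (frame V a x (N r)) <= m by rewrite -HhY; exact: Hm.
(* Both |s - v|^2 and |N|^2 are at most q, so <s - v, N> <= q, which adds to <v, N> <= m. *)
have := hprod_AMGM h (s x - v) (frame V a x (N r)).
rewrite NN hprodBl; lra.
Qed.

(** The lines start at x0, so only one-sided derivatives at 0 are available; the directions w and -w
    together make the first derivatives vanish. The second derivative along w is the quadratic form
    of the second covariant derivatives. *)
Lemma covariant_derivs_at_max (K : set (total_space V)) (s : section_of V)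
    (x0 : M) (n0 : 'rV[R]_k) (m : R) : tdom V a x0 -> dom i x0 ->
  parallel_invariant nabla t K ->
  (forall v, K (Vec x0 v) -> h x0 v (frame V a x0 n0) <= m) ->
  let q := h x0 (frame V a x0 n0) (frame V a x0 n0) in
  h x0 (s x0) (frame V a x0 n0) = m + q ->
  (forall x, exists2 v, K (Vec x v) & h x (s x - v) (s x - v) <= q) ->
  (forall e, Ck 'rV[R]_n 2 (coord i @` (O `&` dom i))
    (fun y => triv V a (s (param i y)) 0 e)) ->
  (forall c, h x0 (nabla t s i c x0) (frame V a x0 n0) = 0) /\
  forall w : 'I_n -> R, qform (fun b c =>
    h x0 (nabla t (nabla t s i c) i b x0) (frame V a x0 n0)) w <= 0.
Proof.
move=> ax ix HK Hm q Hq Hd Cs.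
have oO : open O by apply: openI; [exact: tdom_open|exact: dom_open].
have Oa : O `<=` tdom V a by move=> y [].
have Oi : O `<=` dom i by move=> y [].
have Cs1 : sec_Ck 1 O s.
  by apply: (sec_C1_triv oO Oa Oi) => e; apply: Ck_along_pred; exact: Cs.
have Cz c : sec_Ck 1 O (nabla t s i c) by exact: cov_sec_C1 Cs.
have [r0 r00 H] := hprod_line_max ax ix HK Hm Hq Hd.
pose p := coord i x0.
pose al c := h x0 (nabla t s i c x0) (frame V a x0 n0).
pose be b c := h x0 (nabla t (nabla t s i c) i b x0) (frame V a x0 n0).
have zero01 : 0 <= (0 : R) <= 1 by rewrite lexx ler01.
have p0 w : param i (p + 0 *: w) = x0 by rewrite scale0r addr0 coordK.
have first_le (w : 'rV[R]_n) : `|w| < r0 -> \sum_c w 0 c * al c <= 0.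
  move=> /H[line_dom [N [N0 HN fmax]]].
  have := deriv_hprod_section ht hc line_dom Cs1 HN zero01.
  rewrite (p0 w) N0 => /deriv_le0_at_max; apply=> r r01.
  by rewrite /= p0 N0 Hq; exact: fmax.
have al0 c : al c = 0.
  pose w : 'rV[R]_n := (r0 / 2) *: delta_mx 0 c.
  have wr0 : `|w| < r0.
    rewrite normrZ ger0_norm ?divr_ge0 ?ltW//.
    have : `|delta_mx 0 c : 'rV[R]_n| <= 1.
      by apply/rV_norm_leP => // e; rewrite mxE; case: (_ && _); rewrite ?normr0 ?normr1.
    by move=> H1; nra.
  have wE : \sum_d w 0 d * al d = r0 / 2 * al c.
    rewrite (bigD1 c)//= !mxE !eqxx mulr1 big1 ?addr0// => d dc.
    by rewrite !mxE eqxx (negbTE dc) mulr0 mul0r.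
  have := first_le w wr0; rewrite wE.
  have := first_le (- w); rewrite normrN => /(_ wr0).
  under eq_bigr do rewrite mxE mulNr.
  rewrite sumrN wE => H1 H2; have r20 : 0 < r0 / 2 by rewrite divr_gt0.
  by apply/eqP; rewrite eq_le; apply/andP; split; nra.
split=> [//|w].
have small (v : 'rV[R]_n) : `|v| < r0 -> qform be (fun c => v 0 c) <= 0.
  move=> /H[line_dom [N [N0 HN fmax]]].
  have d1 r (r01 : 0 <= r <= 1) := deriv_hprod_section ht hc line_dom Cs1 HN r01.
  apply: (deriv2_le0_at_max d1).
  - by rewrite (p0 v) N0 big1// => c _; rewrite -/(al c) al0 mulr0.
  - have -> : qform be (fun c => v 0 c) = \sum_c v 0 c * \sum_b v 0 b *
        h (param i (p + 0 *: v)) (nabla t (nabla t s i c) i b (param i (p + 0 *: v)))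
          (frame V a (param i (p + 0 *: v)) (N 0)).
      rewrite (p0 v) N0 /qform exchange_big; apply: eq_bigr => c _.
      by rewrite mulr_sumr; apply: eq_bigr => b _; rewrite /be; ring.
    apply: deriv_within_sum => c; apply: deriv_withinZ.
    exact: (deriv_hprod_section ht hc line_dom (Cz c) HN zero01).
  - by move=> r r01; rewrite /= (p0 v) N0 Hq; exact: fmax.
(* Lines exist only for short vectors; homogeneity of the quadratic form removes the restriction. *)
pose v : 'rV[R]_n := \row_c w c.
pose e := r0 / 2 / (`|v| + 1).
have v10 : 0 < `|v| + 1 by rewrite ltr_wpDl.
have e0 : 0 < e by rewrite !divr_gt0.
have ev : `|e *: v| < r0.
  rewrite normrZ ger0_norm ?ltW//.
  have : e * (`|v| + 1) = r0 / 2 by rewrite /e divfK// gt_eqF.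
  by have := normr_ge0 v; nra.
have := small _ ev.
have -> : qform be (fun c => (e *: v) 0 c) = e ^+ 2 * qform be w.
  rewrite /qform mulr_sumr; apply: eq_bigr => b _; rewrite mulr_sumr.
  by apply: eq_bigr => c _; rewrite !mxE; ring.
by rewrite pmulr_rle0// exprn_gt0.
Qed.

End maximum.

(** * Topology of the total space *)

Lemma fun_Ck_continuous (R : realType) (n : nat) (M : closed_oriented_manifold R n)
    (m : nat) (O : set M) (f : M -> R) (x : M) :
  open O -> fun_Ck m O f -> O x -> f @ x --> f x.
Proof.
move=> oO Cf Ox; have [i ix] := dom_cover x.
have /subspace_continuousP/(_ _ (coord_image Ox ix)) := Ck_along_continuous (Cf i).
rewrite /from_subspace coordK// => H A /H; rewrite /within /= => HA.
have oD := coord_image_open_sub (i := i) oO.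
have nD := open_nbhs_nbhs (conj oD (coord_image Ox ix)).
have HA' : \forall y \near coord i x, A (f (param i y)) by apply: filterS2 nD HA => y Dy; apply.
have {}HA' : \forall y \near x, A (f (param i (coord i y))).
  exact: (coord_continuous_at ix HA').
have nO := open_nbhs_nbhs (conj (@dom_open _ _ M i) ix).
suff : \forall y \near x, A (f y) by [].
by apply: filterS2 nO HA' => y iy; rewrite coordK.
Qed.

Section total_space_topology.
Context (R : realType) (n k : nat) (M : closed_oriented_manifold R n).
Context (V : vector_bundle M k).

Lemma cvg_combination (X : Type) (F : set_system X) {FF : Filter F} (m : nat)
    (u : X -> 'rV[R]_m) (u0 : 'rV[R]_m) (g : 'I_m -> X -> R) (g0 : 'I_m -> R) :
  u x @[x --> F] --> u0 -> (forall d, g d x @[x --> F] --> g0 d) ->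
  \sum_d u x 0 d * g d x @[x --> F] --> \sum_d u0 0 d * g0 d.
Proof.
move=> Hu Hg.
have Hd d : u x 0 d * g d x @[x --> F] --> u0 0 d * g0 d.
  apply: cvgM => //; apply: (cvg_comp u (fun v : 'rV[R]_m => v 0 d) Hu).
  exact: (@matrix_normedtype.coord_continuous R 1 m 0 d).
elim: (index_enum 'I_m) => [|d r IH].
  under eq_fun do rewrite big_nil; rewrite big_nil; exact: cvg_cst.
under eq_fun do rewrite big_cons; rewrite big_cons.
by apply: cvgD.
Qed.

Lemma transition_continuous (a b : tindex V) (x : M) (v : 'rV[R]_k) :
  tdom V a x -> tdom V b x ->
  (fun p : M * 'rV[R]_k => triv V b (frame V a p.1 p.2)) @ (x, v) -->
  triv V b (frame V a x v).
Proof.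
move=> ax bx; have oab : open (tdom V a `&` tdom V b).
  by apply: openI; exact: tdom_open.
have Cphi d e : fun_Ck 1 (tdom V a `&` tdom V b)
    (fun y => triv V b (frame_section a d y) 0 e).
  apply: sec_C1_coordinate; first by move=> y [].
  by apply: frame_section_C1 => y [].
apply: cvg_rV => e.
have H : (fun p : M * 'rV[R]_k => \sum_d p.2 0 d *
      triv V b (frame_section a d p.1) 0 e) @ (x, v) -->
    \sum_d v 0 d * triv V b (frame_section a d x) 0 e.
  apply: (cvg_combination (F := nbhs (x, v)) (u := snd) (u0 := v)
    (g := fun d p => triv V b (frame_section a d p.1) 0 e)); first exact: cvg_snd.
  move=> d; apply: (cvg_comp fst (fun y => triv V b (frame_section a d y) 0 e)
    (cvg_fst (F := nbhs x) (G := nbhs v))).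
  exact: (fun_Ck_continuous oab (Cphi d e) (conj ax bx)).
rewrite (triv_frameE (a := a))// frameK//.
apply: cvg_trans H; apply: near_eq_cvg.
have nab : nbhs x (tdom V a `&` tdom V b) by exact: open_nbhs_nbhs.
have nab' : \forall p \near (x, v), (tdom V a `&` tdom V b) p.1.
  exact: ((cvg_fst (F := nbhs x) (G := nbhs v)) _ nab).
apply: filterS nab' => -[y u] /= [ay by_].
by rewrite [RHS](triv_frameE (a := a))// frameK.
Qed.

Lemma frame_continuous (a : tindex V) (x : M) (v : 'rV[R]_k) : tdom V a x ->
  (fun p : M * 'rV[R]_k => Vec p.1 (frame V a p.1 p.2)) @ (x, v) -->
  (Vec x (frame V a x v) : total_space V).
Proof.
move=> ax A; rewrite nbhsE /= => -[B [oB Bx] BA].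
have oB' : total_open B by [].
have : nbhs (x, v) [set p : M * 'rV[R]_k | tdom V a p.1 /\ B (Vec p.1 (frame V a p.1 p.2))].
  by apply: open_nbhs_nbhs; split=> //; exact: oB'.
by apply: (@filterS _ (nbhs (x, v))) => -[y u] [_ /BA].
Qed.

(** The topology is glued, so openness of a preimage is tested in every other trivialization, where
    it follows from continuity of the transition maps. *)
Lemma triv_continuous (a : tindex V) (z : total_space V) : tdom V a (base z) ->
  (fun z : total_space V => (base z, triv V a (vec z))) @ z -->
  (base z, triv V a (vec z)).
Proof.
move=> ax A; rewrite nbhsE => -[B [oB Bz] BA].
pose C : set (total_space V) := [set y | tdom V a (base y) /\ B (base y, triv V a (vec y))].
have oC : open C.
  suff : total_open C by [].
  move=> b; rewrite openE => -[y u] /= [by_ [ay Byu]].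
  have H1 := @transition_continuous b a y u by_ ay.
  have H2 := open_nbhs_nbhs (conj (@tdom_open _ _ _ _ V a) ay).
  have H3 := open_nbhs_nbhs (conj (@tdom_open _ _ _ _ V b) by_).
  have H4 : (fun p : M * 'rV[R]_k => (p.1, triv V a (frame V b p.1 p.2))) @ (y, u)
      --> (y, triv V a (frame V b y u)).
    move=> W [[W1 W2] /= [HW1 HW2] sub].
    have A1 : \forall p \near (y, u), W1 p.1.
      exact: ((cvg_fst (F := nbhs y) (G := nbhs u)) _ HW1).
    have A2 : \forall p \near (y, u), W2 (triv V a (frame V b p.1 p.2)) by exact: (H1 _ HW2).
    suff : \forall p \near (y, u), W (p.1, triv V a (frame V b p.1 p.2)) by [].
    by apply: filterS2 A1 A2 => p p1 p2; exact: sub.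
  have H5 : \forall p \near (y, u), B (p.1, triv V a (frame V b p.1 p.2)).
    exact: (H4 _ (open_nbhs_nbhs (conj oB Byu))).
  have H6 : \forall p \near (y, u), (tdom V a `&` tdom V b) p.1.
    exact: ((cvg_fst (F := nbhs y) (G := nbhs u)) _ (filterI H2 H3)).
  by apply: filterS2 H5 H6 => -[y' u'] /= ? [? ?].
have : nbhs z C by apply: open_nbhs_nbhs; split.
by apply: (@filterS _ (nbhs z)) => y [_ /BA].
Qed.

End total_space_topology.

(** * Uniform estimates in local coordinates *)

Lemma near_prod2 (R : realType) (X : topologicalType) (Y : normedModType R)
    (x0 : X) (y0 : Y) (P : X * Y -> Prop) : (\forall z \near (x0, y0), P z) ->
  exists2 eta : R, 0 < eta & \forall x \near x0, forall y, `|y - y0| < eta ->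
    P (x, y).
Proof.
move=> [[A B] /= [HA /nbhs_ballP[eta /= eta0 HB]] AB]; exists eta => //.
apply: filterS HA => x Ax y yy0; apply: AB; split=> //=; apply: HB.
by rewrite -ball_normE/= distrC.
Qed.

Lemma near_prod3 (R : realType) (X : topologicalType) (Y Z : normedModType R)
    (x0 : X) (y0 : Y) (z0 : Z) (P : X * Y * Z -> Prop) :
  (\forall p \near (x0, y0, z0), P p) ->
  exists2 eta : R, 0 < eta & \forall x \near x0, forall y z, `|y - y0| < eta ->
    `|z - z0| < eta -> P (x, y, z).
Proof.
move=> [[A B] /= [/near_prod2[e1 e10 HA] /nbhs_ballP[e2 /= e20 HB]] AB].
exists (Num.min e1 e2); first by rewrite lt_min e10.
apply: filterS HA => x Ax y z; rewrite !lt_min => /andP[y1 _] /andP[_ z2].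
apply: AB; split=> /=; first exact: Ax.
by apply: HB; rewrite -ball_normE/= distrC.
Qed.

Section local_coordinates.
Context (R : realType) (n k : nat) (M : closed_oriented_manifold R n).
Context (V : vector_bundle M k) (a : tindex V) (x0 : M) (ax0 : tdom V a x0).

Lemma near_tdom : \forall x \near x0, tdom V a x.
Proof. exact: open_nbhs_nbhs (conj (@tdom_open _ _ _ _ V a) ax0). Qed.

Lemma near_total (v0 : 'rV[R]_k) (t1 : R) (Q : set (total_space V * R)) :
  nbhs (Vec x0 (frame V a x0 v0), t1) Q ->
  exists2 eta : R, 0 < eta & \forall x \near x0, forall v t,
    `|v - v0| < eta -> `|t - t1| < eta -> Q (Vec x (frame V a x v), t).
Proof.
move=> HQ; apply: (near_prod3 (z0 := t1 : R^o)
  (P := fun p => Q (Vec p.1.1 (frame V a p.1.1 p.1.2), p.2))).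
move: HQ => [[A B] /= [HA HB] AB].
exists ([set p | A (Vec p.1 (frame V a p.1 p.2))], B) => /=.
  by split=> //; exact: (frame_continuous (v := v0) ax0 HA).
by move=> [[x v] t] /= [? ?]; exact: AB.
Qed.

Lemma field_near (T : R) (U : set (total_space V)) (F : forall x, V x -> R -> V x)
    (v0 : 'rV[R]_k) (t1 e : R) : open U -> continuous_field T U F ->
  U (Vec x0 (frame V a x0 v0)) -> 0 <= t1 <= T -> 0 < e ->
  exists2 eta : R, 0 < eta & \forall x \near x0, tdom V a x /\ forall v t,
    `|v - v0| < eta -> `|t - t1| < eta -> 0 <= t <= T ->
    U (Vec x (frame V a x v)) /\
    `|triv V a (F x (frame V a x v) t) - triv V a (F x0 (frame V a x0 v0) t1)| <= e.
Proof.
move=> oU /subspace_continuousP Fc U0 t1T e0.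
have Hb : \forall y \near (Vec x0 (F x0 (frame V a x0 v0) t1) : total_space V),
    tdom V a (base y) /\ `|triv V a (vec y) - triv V a (F x0 (frame V a x0 v0) t1)| <= e.
  pose w := (Vec x0 (F x0 (frame V a x0 v0) t1) : total_space V).
  have Hc := @triv_continuous _ _ _ _ _ a w ax0.
  have Hn : \forall p \near (base w, triv V a (vec w)), tdom V a p.1 /\
      `|p.2 - triv V a (F x0 (frame V a x0 v0) t1)| <= e.
    exists ([set x | tdom V a x], [set v | `|v - triv V a (vec w)| <= e]) => /=.
      split; first exact: near_tdom.
      apply/nbhs_ballP; exists e => //= v; rewrite -ball_normE/= distrC; exact: ltW.
    by move=> [x v] /= [? ?].
  exact: (Hc _ Hn).
have H : \forall p \near (Vec x0 (frame V a x0 v0) : total_space V, t1),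
   (U p.1 /\ 0 <= p.2 <= T) -> (tdom V a (base p.1) /\
     `|triv V a (F (base p.1) (vec p.1) p.2) -
       triv V a (F x0 (frame V a x0 v0) t1)| <= e).
  exact: (Fc (Vec x0 (frame V a x0 v0), t1) (conj U0 t1T) _ Hb).
have HU : \forall p \near (Vec x0 (frame V a x0 v0) : total_space V, t1), U p.1.
  by exists (U, setT) => /=; [split; [exact: open_nbhs_nbhs|exact: filterT]|move=> p []].
have [eta eta0 Heta] := near_total (filterI H HU).
exists eta => //; apply: filterS2 near_tdom Heta => x ax Hx; split=> // v t vv tt tT.
by have [H1 H2] := Hx v t vv tt; split=> //; have [] := H1 (conj H2 tT).
Qed.

Context (h : bundle_metric V).

Let hm d e (x : M) := h x (frame_section a d x) (frame_section a e x).

Let hmE x u v : tdom V a x -> h x (frame V a x u) (frame V a x v) =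
  \sum_d u 0 d * \sum_e v 0 e * hm d e x.
Proof.
move=> ax; rewrite (frameE u ax) (frameE v ax) hprod_suml; apply: eq_bigr => d _.
rewrite hprodZl; congr (_ * _); rewrite hprod_sumr; apply: eq_bigr => e _.
by rewrite hprodZr.
Qed.

Let hm_cvg d e : hm d e @ x0 --> hm d e x0.
Proof. exact: (fun_Ck_continuous (@tdom_open _ _ _ _ V a) (hprod_smooth h a d e 1) ax0). Qed.

Lemma hprod_near (u0 v0 : 'rV[R]_k) (e : R) : 0 < e ->
  exists2 eta : R, 0 < eta & \forall x \near x0, forall u v,
    `|u - u0| < eta -> `|v - v0| < eta ->
    `|h x (frame V a x u) (frame V a x v) -
      h x0 (frame V a x0 u0) (frame V a x0 v0)| <= e.
Proof.
move=> e0.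
have H : (fun p : M * 'rV[R]_k * 'rV[R]_k =>
    \sum_d p.1.2 0 d * \sum_e p.2 0 e * hm d e p.1.1) @ (x0, u0, v0) -->
    \sum_d u0 0 d * \sum_e v0 0 e * hm d e x0.
  have H1 : (fun p : M * 'rV[R]_k * 'rV[R]_k => p.1) @ (x0, u0, v0) --> (x0, u0).
    exact: (cvg_fst (F := nbhs (x0, u0)) (G := nbhs v0)).
  have H11 : (fun p : M * 'rV[R]_k * 'rV[R]_k => p.1.1) @ (x0, u0, v0) --> x0.
    exact: (cvg_comp _ fst H1 (cvg_fst (F := nbhs x0) (G := nbhs u0))).
  have H12 : (fun p : M * 'rV[R]_k * 'rV[R]_k => p.1.2) @ (x0, u0, v0) --> u0.
    exact: (cvg_comp _ snd H1 (cvg_snd (F := nbhs x0) (G := nbhs u0))).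
  have H2 : (fun p : M * 'rV[R]_k * 'rV[R]_k => p.2) @ (x0, u0, v0) --> v0.
    exact: (cvg_snd (F := nbhs (x0, u0)) (G := nbhs v0)).
  have FF : Filter (nbhs (x0, u0, v0)) by exact: nbhs_filter.
  apply: (@cvg_combination R _ _ FF k _ _ (fun d p => \sum_e p.2 0 e * hm d e p.1.1)
    (fun d => \sum_e v0 0 e * hm d e x0) H12) => d.
  apply: (@cvg_combination R _ _ FF k _ _ (fun e p => hm d e p.1.1)
    (fun e => hm d e x0) H2) => e'.
  have H := @cvg_comp _ _ _ _ (hm d e') _ _ _ H11 (@hm_cvg d e').
  exact: H.
pose G (p : M * 'rV[R]_k * 'rV[R]_k) :=
  \sum_d p.1.2 0 d * \sum_e p.2 0 e * hm d e p.1.1.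
have {}H : \forall p \near (x0, u0, v0), `|G p - G (x0, u0, v0)| <= e.
  have H' : \forall p \near (x0, u0, v0), `|G (x0, u0, v0) - G p| <= e.
    by move/cvgrPdist_le : H => /(_ e e0).
  by apply: filterS H' => p; rewrite distrC.
have [eta eta0 Heta] := near_prod3 H.
exists eta => //; apply: filterS2 near_tdom Heta => x ax Hx u v uu vv.
by rewrite !hmE//; exact: Hx.
Qed.

Lemma hprod_upper : exists2 C : R, 0 < C & \forall x \near x0, forall v,
  h x (frame V a x v) (frame V a x v) <= C * `|v| ^+ 2.
Proof.
have [eta eta0 Heta] := hprod_near 0 0 ltr01.
(* Vectors of norm eta / 2 have squared length at most 1 near x0; the general bound follows by
   scaling. *)
pose c := (eta / 2)^-1.
have e20 : 0 < eta / 2 by rewrite divr_gt0.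
exists (c ^+ 2); first by rewrite exprn_gt0// invr_gt0.
apply: filterS2 near_tdom Heta => x ax Hx v.
have [->|v0] := eqVneq v 0.
  by rewrite normr0 expr0n/= mulr0 hmE// big1// => d _; rewrite mxE mul0r.
have nv0 : 0 < `|v| by rewrite normr_gt0.
pose s := eta / 2 / `|v|.
have s0 : 0 < s by rewrite divr_gt0.
have sv : `|s *: v - 0| < eta.
  rewrite subr0 normrZ gtr0_norm// /s divfK ?gt_eqF//.
  by rewrite ltr_pdivrMr// ltr_pMr// ltr1n.
have := Hx _ _ sv sv.
have -> : h x0 (frame V a x0 0) (frame V a x0 0) = 0.
  by rewrite hmE// big1// => d _; rewrite mxE mul0r.
have fZ : frame V a x (s *: v) = s *: frame V a x v.
  by apply: (triv_inj ax); rewrite frameK// trivZ// frameK.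
rewrite subr0 fZ hprodZl hprodZr => /ler_normlP[_].
have -> : c ^+ 2 * `|v| ^+ 2 = s ^- 2.
  by rewrite /c /s; field; rewrite !gt_eqF.
by rewrite mulrA -expr2 mulrC -ler_pdivlMr ?exprn_gt0// mul1r.
Qed.

(** Positivity on the compact unit sphere of the fibre over x0, spread to nearby fibres by
    continuity. With the upper bound it compares the metric and coordinate norms uniformly in x. *)
Lemma hprod_lower : exists2 c : R, 0 < c & \forall x \near x0, tdom V a x /\
  forall v, c * `|v| ^+ 2 <= h x (frame V a x v) (frame V a x v).
Proof.
pose S : set 'rV[R]_k := [set v | `|v| = 1].
have cS : compact S.
  apply: bounded_closed_compact.
    by exists 1; split => // y y1 v /= ->; exact: ltW.
  have -> : S = (fun v : 'rV[R]_k => `|v|) @^-1` [set 1] by [].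
  by apply: closed_comp; [move=> v _; exact: norm_continuous|exact: closed_eq].
have HS v : S v -> \forall v' \near v & p \near filter_prod (0 : R)^'+ (nbhs x0),
    p.1 <= h p.2 (frame V a p.2 v') (frame V a p.2 v').
  move=> Sv.
  have m0 : 0 < h x0 (frame V a x0 v) (frame V a x0 v).
    apply: hprod_pos; apply/eqP => /(congr1 (triv V a)).
    rewrite frameK// triv0// => v0; move: Sv; rewrite /S/= v0 normr0.
    by move/esym/eqP; rewrite oner_eq0.
  set m := h x0 _ _ in m0.
  have m20 : 0 < m / 2 by rewrite divr_gt0.
  have [eta eta0 Heta] := hprod_near v v m20.
  have A1 : \forall v' \near v, `|v' - v| < eta.
    by apply/nbhs_ballP; exists eta => //= v'; rewrite -ball_normE/= distrC.
  have A2 : \forall c \near (0 : R)^'+, c <= m / 2.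
    by apply: nbhs_right_le.
  exists ([set v' | `|v' - v| < eta], [set p : R * M | p.1 <= m / 2 /\ forall u w,
      `|u - v| < eta -> `|w - v| < eta ->
      `|h p.2 (frame V a p.2 u) (frame V a p.2 w) - m| <= m / 2]) => /=.
    split=> //; exists ([set c | c <= m / 2], [set x | forall u w,
      `|u - v| < eta -> `|w - v| < eta ->
      `|h x (frame V a x u) (frame V a x w) - m| <= m / 2]) => //=.
  move=> [v' [c x]] /= [vv' [cm Hx]]; have := Hx _ _ vv' vv' => /ler_normlP[H _].
  by apply: (le_trans cm); lra.
have := (compact_near_coveringP S).1 cS _ _
  (fun p v => p.1 <= h p.2 (frame V a p.2 v) (frame V a p.2 v)) _ HS.
move=> /(_ _)[[A B] /= [HA HB] AB].
have [c [c0 Ac]] : exists c : R, 0 < c /\ A c.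
  have HA' : \forall c \near (0 : R)^'+, A c /\ 0 < c.
    by apply: filterI HA _; exact: nbhs_right_gt.
  by have [c [Ac c0]] := @filter_ex _ (0 : R)^'+ _ _ HA'; exists c.
exists c => //; apply: filterS2 near_tdom HB => x ax Bx; split=> // v.
have [->|v0] := eqVneq v 0.
  by rewrite normr0 expr0n/= mulr0 hprod_ge0.
have nv0 : 0 < `|v| by rewrite normr_gt0.
have Sv : S (`|v|^-1 *: v).
  by rewrite /S/= normrZ normfV normr_id mulVf// gt_eqF.
have := AB (c, x) (conj Ac Bx) _ Sv => /=.
have -> : frame V a x (`|v|^-1 *: v) = `|v|^-1 *: frame V a x v.
  by apply: (triv_inj ax); rewrite frameK// trivZ// frameK.
rewrite hprodZl hprodZr mulrA -expr2 exprVn ler_pdivlMl ?exprn_gt0//.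
by rewrite mulrC.
Qed.

Lemma chart_time_near (Y : normedModType R) (i : chart M) (s0 s1 t1 : R)
    (f : 'rV[R]_n * R^o -> Y) (e : R) :
  dom i x0 ->
  {within (coord i @` (tdom V a `&` dom i)) `*` `[s0, s1], continuous f} ->
  s0 <= t1 <= s1 -> 0 < e ->
  exists2 eta : R, 0 < eta & \forall x \near x0, [/\ tdom V a x, dom i x &
    forall t, `|t - t1| < eta -> s0 <= t <= s1 ->
    `|f (coord i x, t) - f (coord i x0, t1)| <= e].
Proof.
move=> ix0 /subspace_continuousP fc t1s e0.
have D0 : ((coord i @` (tdom V a `&` dom i)) `*` `[s0, s1]) (coord i x0, t1).
  by split=> /=; [exact: coord_image|rewrite in_itv].
have H : \forall p \near (coord i x0, t1 : R^o),
    ((coord i @` (tdom V a `&` dom i)) `*` `[s0, s1]) p ->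
    `|f p - f (coord i x0, t1)| <= e.
  have := fc _ D0; move/cvgrPdist_le => /(_ e e0).
  by rewrite nearE /within /=; apply: filterS => p Hp /Hp; rewrite distrC.
have [eta eta0 Heta] := near_prod2 H.
exists eta => //.
have {}Heta := coord_continuous_at ix0 Heta.
have ni := open_nbhs_nbhs (conj (@dom_open _ _ M i) ix0).
apply: filterS3 near_tdom ni Heta => x ax ix Hx; split=> // t tt ts.
by apply: Hx => //; split=> /=; [exact: coord_image|rewrite in_itv].
Qed.

End local_coordinates.

(** * The ODE in the fibres *)

Section flow.
Context (R : realType) (n k : nat) (M : closed_oriented_manifold R n).
Context (V : vector_bundle M k) (h : bundle_metric V) (T : R).
Context (U : set (total_space V)) (F : forall x : M, V x -> R -> V x).
Hypotheses (oU : open U) (cF : continuous_field T U F) (lF : lipschitz_field T h U F).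
Context (a : tindex V) (x0 : M) (ax0 : tdom V a x0).

Lemma field_lipschitz_near (v0 : 'rV[R]_k) (t1 : R) :
  U (Vec x0 (frame V a x0 v0)) -> 0 <= t1 <= T ->
  exists2 eta : R, 0 < eta & exists2 L : R, 0 < L &
  \forall x \near x0, tdom V a x /\ forall v w t,
    `|v - v0| < eta -> `|w - v0| < eta -> `|t - t1| < eta -> 0 <= t <= T ->
    `|triv V a (F (frame V a x v) t) - triv V a (F (frame V a x w) t)| <=
      L * `|v - w|.
Proof.
move=> U0 t1T; have [N HN [L0 HL]] := lF (p := (Vec x0 (frame V a x0 v0), t1)) U0 t1T.
have [e1 e10 He1] := near_total ax0 HN.
have [e2 e20 He2] := field_near ax0 oU cF U0 t1T ltr01.
have [c c0 Hc] := hprod_lower ax0 h.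
have [C C0 HC] := hprod_upper ax0 h.
pose L1 := `|L0| + 1.
have L10 : 0 < L1 by rewrite ltr_wpDl.
(* Changing norms costs the factor sqrt(C / c), which is at most 1 + C / c. *)
pose L := L1 * (1 + C / c).
have Cc0 : 0 < C / c by rewrite divr_gt0.
have L_gt0 : 0 < L by rewrite mulr_gt0// addr_gt0.
exists (Num.min e1 e2); first by rewrite lt_min e10.
exists L => //.
apply: filterS3 (filterI Hc HC) He1 He2 => x [[ax Hlow] Hup] H1 [_ H2].
split=> // v w t; rewrite !lt_min => /andP[v1 v2] /andP[w1 w2] /andP[t_1 t_2] tT.
have [Uv _] := H2 v t v2 t_2 tT; have [Uw _] := H2 w t w2 t_2 tT.
have := HL x _ _ t tT Uv Uw (H1 v t v1 t_1) (H1 w t w1 t_1).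
set X := F (frame V a x v) t - F (frame V a x w) t.
rewrite -frameB// => HX.
have HX2 : h x X X <= L1 ^+ 2 * h x (frame V a x (v - w)) (frame V a x (v - w)).
  rewrite -[h x X X]sqr_sqrtr ?hprod_ge0// -[X in _ * X]sqr_sqrtr ?hprod_ge0//.
  rewrite -exprMn ler_pXn2r ?nnegrE ?sqrtr_ge0 ?mulr_ge0 ?sqrtr_ge0 ?(ltW L10)//.
  apply: (le_trans HX); rewrite ler_wpM2r ?sqrtr_ge0// (le_trans (ler_norm _))//.
  by rewrite lerDl.
have Lvw : 0 <= L * `|v - w| by apply: mulr_ge0 => //; exact: ltW.
rewrite -trivB// -/X -(ler_pXn2r (n := 2)) ?nnegrE//.
have := Hlow (triv V a X); rewrite trivK// => lX.
rewrite -(ler_pM2l c0); apply: (le_trans lX); apply: (le_trans HX2).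
apply: (@le_trans _ _ (L1 ^+ 2 * (C * `|v - w| ^+ 2))).
  by rewrite ler_wpM2l ?sqr_ge0.
have -> : c * (L * `|v - w|) ^+ 2 = L1 ^+ 2 * (c * (1 + C / c) ^+ 2 * `|v - w| ^+ 2).
  by rewrite /L; ring.
apply: ler_wpM2l; first exact: sqr_ge0.
apply: ler_wpM2r; first exact: sqr_ge0.
have Cz : C = c * (C / c) by field; rewrite gt_eqF.
rewrite [leLHS]Cz; apply: ler_wpM2l; first exact: ltW.
by have := ltW Cc0; nra.
Qed.

(** The point is the uniformity: one existence time and one speed bound serve all fibres near x0 and
    all initial vectors near [v0]. *)
Lemma flow_near (v0 : 'rV[R]_k) (t1 : R) :
  U (Vec x0 (frame V a x0 v0)) -> 0 <= t1 < T ->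
  exists2 C : R, 0 <= C & exists2 eta : R, 0 < eta &
  \forall x \near x0, tdom V a x /\ forall v, `|v - v0| < eta ->
    forall tau, 0 < tau -> tau <= eta -> t1 + tau <= T /\
    exists Y : R -> 'rV[R]_k, [/\ Y t1 = v,
      forall r, t1 <= r <= t1 + tau -> `|Y r - v| <= C * (r - t1),
      forall r, t1 <= r <= t1 + tau -> U (Vec x (frame V a x (Y r))) &
      forall r e, t1 <= r <= t1 + tau ->
        deriv_within R^o `[t1, t1 + tau] (fun q => Y q 0 e) r 1
          (triv V a (F (frame V a x (Y r)) r) 0 e)].
Proof.
move=> U0 /andP[t10 t1T].
have t1T' : 0 <= t1 <= T by rewrite t10 ltW.
have [e1 e10 [L L0 HL]] := field_lipschitz_near U0 t1T'.
have [e2 e20 He2] := field_near ax0 oU cF U0 t1T' ltr01.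
pose C := `|triv V a (F (frame V a x0 v0) t1)| + 1.
have C0 : 0 < C by rewrite ltr_wpDl.
pose e0 := Num.min e1 e2.
have e00 : 0 < e0 by rewrite lt_min e10.
have [e01 e02] : e0 <= e1 /\ e0 <= e2 by rewrite /e0 !ge_min !lexx orbT.
pose rho := e0 / 4.
have rho0 : 0 < rho by rewrite divr_gt0.
(* The bound [rho] keeps initial vectors and times in the region of the estimates, T - t1 keeps the
   flow in the time interval, and the other two are the conditions of the Picard-Lindelof
   theorem. *)
pose eta := Num.min (Num.min rho (T - t1)) (Num.min (rho / C) ((2 * L)^-1)).
have eta0 : 0 < eta.
  by rewrite !lt_min rho0 subr_gt0 t1T divr_gt0//= invr_gt0 mulr_gt0.
have [eta1 eta2 eta3 eta4] : [/\ eta <= rho, eta <= T - t1, eta <= rho / C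
    & eta <= (2 * L)^-1].
  by rewrite /eta !ge_min !lexx !orbT.
exists C; first exact: ltW.
exists eta => //; apply: filterS2 HL He2 => x [ax Hlip] [_ Hb].
split=> // v vv tau tau0 taue.
have tT : t1 + tau <= T by lra.
split=> //.
have vr (r : R) : t1 <= r <= t1 + tau -> `|r - t1| < e0 /\ 0 <= r <= T.
  move=> /andP[r1 r2]; rewrite ger0_norm ?subr_ge0//; split.
    by rewrite /rho in eta1; lra.
  by apply/andP; split; lra.
have vy (y : 'rV[R]_k) : `|y - v| <= rho -> `|y - v0| < e0.
  move=> yv; rewrite -(subrKA v) (le_lt_trans (ler_normD _ _))//.
  by rewrite /rho in eta1 yv; lra.
have Hb' y r : t1 <= r <= t1 + tau -> `|y - v| <= rho ->
    U (Vec x (frame V a x y)) /\ `|triv V a (F (frame V a x y) r)| <= C.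
  move=> /vr[r1 rT] /vy y1.
  have [Uy H] := Hb y r (lt_le_trans y1 e02) (lt_le_trans r1 e02) rT; split=> //.
  rewrite -[X in `|X|](subrK (triv V a (F (frame V a x0 v0) t1))).
  by rewrite (le_trans (ler_normD _ _))// /C addrC lerD2l.
have tb : t1 <= t1 + tau by rewrite lerDl ltW.
have [|||||||Y [Y0 Yb Yd]] := @picard_lindelof R k t1 (t1 + tau) rho C L v
    (fun r y => triv V a (F (frame V a x y) r)) tb (ltW rho0).
- exact: ltW.
- exact: ltW.
- move=> y yv; apply/subspace_continuousP => r /=; rewrite in_itv/= => rt.
  have [Uy _] := Hb' y r rt yv; have [_ rT] := vr r rt.
  apply/cvgrPdist_le => e e_gt0.
  have [e3 e30 /nbhs_singleton[_ He3]] := field_near ax oU cF Uy rT e_gt0.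
  rewrite nearE /within /=; apply/nbhs_ballP; exists e3 => //= q.
  rewrite -ball_normE/= distrC => qr; rewrite in_itv/= => qt.
  have [_ qT] := vr q qt.
  by rewrite distrC; apply: (He3 y q _ qr qT).2; rewrite subrr normr0.
- move=> r y w rt yv wv; have [r1 rT] := vr r rt.
  by apply: Hlip => //; [exact: lt_le_trans (vy _ yv) e01|
    exact: lt_le_trans (vy _ wv) e01|exact: lt_le_trans r1 e01].
- by move=> r y rt yv; have [] := Hb' y r rt yv.
- rewrite addrAC subrr add0r mulrC -ler_pdivlMr//.
  exact: le_trans eta3.
- rewrite addrAC subrr add0r.
  apply: (@le_trans _ _ (L * (2 * L)^-1)).
    by rewrite ler_wpM2l ?(ltW L0)// (le_trans taue).
  by rewrite le_eqVlt; apply/orP; left; apply/eqP; field; rewrite gt_eqF.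
have Yrho r : t1 <= r <= t1 + tau -> `|Y r - v| <= rho.
  move=> /[dup] rt /andP[r1 r2]; apply: (le_trans (Yb r rt)).
  rewrite mulrC -ler_pdivlMr//; apply: le_trans eta3; lra.
exists Y; split=> // r rt.
by have [] := Hb' _ r rt (Yrho r rt).
Qed.

(** Over a fixed point the change of trivialization is a constant linear map. *)
Lemma coordinate_ode_solution (J : set R) (x : M) (Y : R -> 'rV[R]_k) :
  tdom V a x -> (forall r, J r -> U (Vec x (frame V a x (Y r)))) ->
  (forall r e, J r -> deriv_within R^o J (fun q => Y q 0 e) r 1
    (triv V a (F (frame V a x (Y r)) r) 0 e)) ->
  ode_solution U F J (fun r => frame V a x (Y r)).
Proof.
move=> ax HU HY r Jr; split; first exact: HU.
move=> b e bx; rewrite (triv_frameE (a := a))//.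
have -> : (fun q => triv V b (frame V a x (Y q)) 0 e) =
    (fun q => \sum_d Y q 0 d * triv V b (frame_section a d x) 0 e).
  by apply/funext => q; rewrite (triv_frameE (a := a))// frameK.
apply: deriv_within_sum => d.
have := deriv_withinZ (c := triv V b (frame_section a d x) 0 e) (HY r d Jr).
by rewrite mulrC; congr deriv_within; apply/funext => q; rewrite mulrC.
Qed.

End flow.

(** * Points of K near a solution of the PDE *)

Section time_dependent_section.
Context (R : realType) (n k : nat) (M : closed_oriented_manifold R n).
Context (V : vector_bundle M k) (t0 T : R) (s : R -> section_of V).
Hypothesis Cs : sec_C21 t0 T s.
Context (a : tindex V) (x0 : M) (ax0 : tdom V a x0).

Lemma section_near (t1 e : R) : t0 <= t1 <= T -> 0 < e ->
  exists2 eta : R, 0 < eta & \forall x \near x0, tdom V a x /\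
    forall t, `|t - t1| < eta -> t0 <= t <= T ->
    `|triv V a (s t x) - triv V a (s t1 x0)| <= e.
Proof.
move=> t1T e0; have [i ix0] := dom_cover x0.
have fc : {within (coord i @` (tdom V a `&` dom i)) `*` `[t0, T],
    continuous (fun p : 'rV[R]_n * R^o => triv V a (s p.2 (param i p.1)))}.
  by apply/within_continuous_rV => d; exact: Ck_along_continuous (Cs i a d).2.
have [eta eta0 Heta] := chart_time_near ax0 ix0 fc t1T e0.
exists eta => //; apply: filterS Heta => x [ax ix Hx]; split=> // t tt tT.
by have /= := Hx t tt tT; rewrite !coordK.
Qed.

Lemma section_time_deriv : exists dS : M -> R -> 'rV[R]_k,
  (forall t1 e, t0 <= t1 <= T -> 0 < e ->
    exists2 eta : R, 0 < eta & \forall x \near x0, tdom V a x /\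
    forall t, `|t - t1| < eta -> t0 <= t <= T -> `|dS x t - dS x0 t1| <= e) /\
  (\forall x \near x0, forall t d, t0 <= t <= T -> deriv_within R^o `[t0, T]
    (fun q => triv V a (s q x) 0 d) t 1 (dS x t 0 d)).
Proof.
have [i ix0] := dom_cover x0.
have H d := cid2 ((Cs i a d).2.2 (0, 1) I).
pose f (p : 'rV[R]_n * R^o) := \row_d s2val (H d) p.
have fc : {within (coord i @` (tdom V a `&` dom i)) `*` `[t0, T], continuous f}.
  apply/within_continuous_rV => d.
  apply: within_continuous_ext (s2valP (H d)).1 => p _; by rewrite /f mxE.
exists (fun x t => f (coord i x, t)); split=> [t1 e t1T e0|].
  have [eta eta0 Heta] := chart_time_near ax0 ix0 fc t1T e0.
  by exists eta => //; apply: filterS Heta => x [ax ix Hx].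
have ni := open_nbhs_nbhs (conj (@dom_open _ _ M i) ix0).
apply: filterS2 (near_tdom ax0) ni => x ax ix t d tT.
have D0 : ((coord i @` (tdom V a `&` dom i)) `*` `[t0, T]) (coord i x, t).
  by split=> /=; [exact: coord_image|rewrite in_itv].
have := s2valP' (H d) _ D0; rewrite mxE => Hd.
have := deriv_within_affine (D' := `[t0, T]%classic) (q := t : R^o) (v' := 1 : R^o)
  (phi := fun q : R^o => (coord i x, q)) _ _ Hd.
move=> /(_ _ _); rewrite (_ : _ \o _ = fun q => triv V a (s q x) 0 d); last first.
  by apply/funext => q /=; rewrite coordK.
apply.
  move=> q; rewrite -[X in (X, _) = _](_ : coord i x + q *: 0 = _)//.
  by rewrite scaler0 addr0.
by move=> q tq; split=> //=; exact: coord_image.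
Qed.

Lemma section_C2 (i : chart M) (t : R) d : t0 <= t <= T ->
  Ck 'rV[R]_n 2 (coord i @` (tdom V a `&` dom i `&` dom i))
    (fun y => triv V a (s t (param i y)) 0 d).
Proof.
move=> tT.
apply: (Ck_along_affine (phi := fun y : 'rV[R]_n => (y, t : R^o))
  (A := fun v => (v, 0 : R^o)) _ _ _ _ (Cs i a d).1) => //.
- by apply: continuous_subspaceT; exact: (@pair_continuous_l 'rV[R]_n R^o t).
- move=> q v h; rewrite -[X in (_, X) = _](_ : (t : R^o) + h *: (0 : R^o) = t)//.
  by rewrite scaler0 addr0.
- by move=> _ [x [[ax ix] _] <-]; split=> /=; [exact: coord_image|rewrite in_itv].
Qed.

End time_dependent_section.

Section compactness.
Context (R : realType) (n k : nat) (M : closed_oriented_manifold R n).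
Context (V : vector_bundle M k) (h : bundle_metric V) (T : R).
Context (K : R -> set (total_space V)) (t0 : R) (s : R -> section_of V).
Hypothesis t00 : 0 <= t0.
Hypothesis clK : closed [set p : total_space V * R | 0 <= p.2 <= T /\ K p.2 p.1].
Hypothesis Cs : sec_C21 t0 T s.
Context (rho : R -> R).
Hypothesis rho_cont : continuous rho.

(* With W empty this is lower semicontinuity of the distance to K; with W a
   neighbourhood of a nearest point it is continuity of the nearest point. *)
Lemma near_points_near (a : tindex V) (x0 : M) (t1 : R) (W : set 'rV[R]_k) :
  tdom V a x0 -> t0 <= t1 <= T -> open W ->
  (forall v, K t1 (Vec x0 (frame V a x0 v)) ->
    h x0 (s t1 x0 - frame V a x0 v) (s t1 x0 - frame V a x0 v) <= rho t1 -> W v) ->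
  exists2 eta : R, 0 < eta & \forall x \near x0, tdom V a x /\
    forall t v, `|t - t1| < eta -> t0 <= t <= T -> K t (Vec x (frame V a x v)) ->
      h x (s t x - frame V a x v) (s t x - frame V a x v) <= rho t -> W v.
Proof.
move=> ax0 t1T oW HW.
have [c c0 Hc] := hprod_lower ax0 h.
pose S t x := triv V a (s t x).
have hS x t v : tdom V a x -> h x (s t x - frame V a x v) (s t x - frame V a x v) =
    h x (frame V a x (S t x - v)) (frame V a x (S t x - v)).
  by move=> ax; rewrite /S frameB// trivK.
have [e1 e10 He1] := section_near Cs ax0 t1T ltr01.
have rhoc e : 0 < e -> \forall t \near t1, `|rho t - rho t1| <= e.
  move=> e0; have := @rho_cont t1 => /cvgrPdist_le /(_ e e0) H.
  have {}H : \forall t \near t1, `|rho t1 - rho t| <= e by exact: H.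
  by apply: filterS H => t; rewrite distrC.
have /nbhs_ballP[e2 /= e20 He2] := rhoc _ ltr01.
(* A bound for |S - v| when v is within squared distance [rho], since r^2 <= q implies r <= q + 1;
   [Bd] then bounds |v| itself, so the possible exceptions form the compact set [Q]. *)
pose m := (`|rho t1| + 1) / c + 1.
pose Bd := `|S t1 x0| + 1 + m.
pose Q := [set v : 'rV[R]_k | `|v| <= Bd /\ ~ W v].
have cQ : compact Q.
  apply: bounded_closed_compact.
    exists Bd; split; first exact: num_real.
    by move=> y By v [/= vB _]; apply: le_trans vB _; exact: ltW.
  apply: closedI; last exact: open_closedC.
  apply: (@closed_comp _ _ (fun v : 'rV[R]_k => `|v|) [set r | r <= Bd]).
    by move=> v _; exact: norm_continuous.
  exact: closed_le.
pose bad (p : M * R) v := t0 <= p.2 <= T -> K p.2 (Vec p.1 (frame V a p.1 v)) ->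
  h p.1 (s p.2 p.1 - frame V a p.1 v) (s p.2 p.1 - frame V a p.1 v) <= rho p.2 -> False.
have HQ v : Q v -> \forall v' \near v & p \near filter_prod (nbhs x0) (nbhs t1), bad p v'.
  move=> [_ nW].
  suff [eta eta0 Heta] : exists2 eta : R, 0 < eta & \forall x \near x0, forall v' t,
      `|v' - v| < eta -> `|t - t1| < eta -> bad (x, t) v'.
    exists ([set v' | `|v' - v| < eta], [set p | `|p.2 - t1| < eta /\ forall v' t,
        `|v' - v| < eta -> `|t - t1| < eta -> bad (p.1, t) v']) => /=.
      split; first by apply/nbhs_ballP; exists eta => //= v'; rewrite -ball_normE/= distrC.
      exists ([set x | forall v' t, `|v' - v| < eta -> `|t - t1| < eta -> bad (x, t) v'],
        [set t | `|t - t1| < eta]) => /=.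
        by split=> //; apply/nbhs_ballP; exists eta => //= t; rewrite -ball_normE/= distrC.
      by move=> [x t] /= [].
    by move=> [v' [x t]] /= [vv' [tt]]; exact.
  (* A vector outside K(t1) stays outside for nearby (x, t) because the track is closed. One in
     K(t1) but not in W has squared distance above [rho t1], and this strict inequality persists. *)
  have [Kv|nK] := pselect (K t1 (Vec x0 (frame V a x0 v))); last first.
    have := open_nbhs_nbhs (conj (closed_openC clK)
      (_ : (~` [set p : total_space V * R | 0 <= p.2 <= T /\ K p.2 p.1])
        (Vec x0 (frame V a x0 v), t1))).
    move=> /(_ (fun H => nK H.2))/(near_total ax0)[eta eta0 Heta].
    exists eta => //; apply: filterS Heta => x Hx v' t vv tt /= /andP[t0t tT] Kt _.
    by apply: (Hx v' t vv tt); split=> //=; rewrite (le_trans t00).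
  set q0 := h x0 (s t1 x0 - frame V a x0 v) (s t1 x0 - frame V a x0 v).
  have q0r : rho t1 < q0 by rewrite ltNge; apply/negP => /(HW v Kv).
  pose e := (q0 - rho t1) / 3.
  have e0 : 0 < e by rewrite divr_gt0// subr_gt0.
  have [f1 f10 Hf1] := hprod_near ax0 h (S t1 x0 - v) (S t1 x0 - v) e0.
  have f130 : 0 < f1 / 3 by rewrite divr_gt0.
  have [f2 f20 Hf2] := section_near Cs ax0 t1T f130.
  have /nbhs_ballP[f3 /= f30 Hf3] := rhoc _ e0.
  exists (Num.min (f1 / 3) (Num.min f2 f3)).
    by rewrite !lt_min f20 f30 divr_gt0.
  apply: filterS2 Hf1 Hf2 => x Hx1 [ax Hx2] v' t.
  rewrite !lt_min => /andP[v1 _] /andP[_ /andP[t2 t3]] /= tT _.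
  rewrite hS//.
  have u1 : `|S t x - v' - (S t1 x0 - v)| < f1.
    have -> : S t x - v' - (S t1 x0 - v) = (S t x - S t1 x0) - (v' - v).
      by apply/rowP => j; rewrite !mxE; ring.
    have HS : `|S t x - S t1 x0| <= f1 / 3 by exact: Hx2.
    rewrite (le_lt_trans (ler_normB _ _))//.
    by apply: le_lt_trans (lerD HS (ltW v1)) _; lra.
  have := Hx1 _ _ u1 u1; rewrite -(hS x)// -(hS x0)// -/q0 => /ler_normlP[H1 _].
  have /ler_normlP[_ H2] : `|rho t - rho t1| <= e.
    by apply: Hf3; rewrite -ball_normE/= distrC.
  have ee : 3 * e = q0 - rho t1 by rewrite /e; field.
  by move=> H3; clearbody e q0; lra.
have [[A B] /= [HA /nbhs_ballP[e3 /= e30 HB]] AB] :=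
  (compact_near_coveringP Q).1 cQ _ _ bad _ HQ.
exists (Num.min (Num.min e1 e2) e3); first by rewrite !lt_min e10 e20.
apply: filterS3 HA Hc He1 => x Ax [ax Hlow] [_ Hx1]; split=> // t v.
rewrite !lt_min => /andP[/andP[t_1 t_2] t_3] tT Kv hv.
have [//|nW] := pselect (W v); exfalso.
have Bt : B t by apply: HB; rewrite -ball_normE/= distrC.
apply: (AB (x, t) (conj Ax Bt) v _ tT Kv hv).
split=> //=.
have rt : rho t <= `|rho t1| + 1.
  have /ler_normlP[_ H] : `|rho t - rho t1| <= 1.
    by apply: He2; rewrite -ball_normE/= distrC.
  by have := ler_norm (rho t1); lra.
have := Hlow (S t x - v); rewrite -hS// => H.
have : `|S t x - v| <= m.
  have H2 : `|S t x - v| ^+ 2 <= (`|rho t1| + 1) / c.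
    rewrite ler_pdivlMr// mulrC; apply: le_trans H _; exact: le_trans rt.
  by rewrite /m; have := normr_ge0 (S t x - v); nra.
have HS1 : `|S t x - S t1 x0| <= 1 by exact: Hx1.
move=> HS2.
have -> : v = S t1 x0 + ((S t x - S t1 x0) - (S t x - v)).
  by apply/rowP => j; rewrite !mxE; ring.
rewrite (le_trans (ler_normD _ _))//.
apply: le_trans (lerD (lexx _) (le_trans (ler_normB _ _) (lerD HS1 HS2))) _.
by rewrite /Bd addrA.
Qed.

End compactness.

(** The same [delta] is the squared radius of the tube and the inverse of the squared Lipschitz
    constant. Shrinking it weakens every requirement, so the property holds locally for all small
    [delta], and compactness of M x [t0, T] gives a common one. *)
Lemma near_solution_uniform (R : realType) (n k : nat)
    (M : closed_oriented_manifold R n) (V : vector_bundle M k)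
    (h : bundle_metric V) (T : R) (U : set (total_space V))
    (F : forall x : M, V x -> R -> V x) (A : R -> set (total_space V)) (t0 : R)
    (s : R -> section_of V) : 0 <= t0 -> open U -> lipschitz_field T h U F ->
  closed [set p : total_space V * R | 0 <= p.2 <= T /\ A p.2 p.1] ->
  sec_C21 t0 T s ->
  (forall t x, t0 <= t <= T -> U (Vec x (s t x))) ->
  (forall t x, t0 <= t <= T -> ~ A t (Vec x (s t x))) ->
  exists2 delta : R, 0 < delta & forall x t (v : V x), t0 <= t <= T ->
    h x (s t x - v) (s t x - v) <= delta ->
    [/\ U (Vec x v), ~ A t (Vec x v) &
      h x (F x (s t x) t - F x v t) (F x (s t x) t - F x v t) <=
        delta^-1 * h x (s t x - v) (s t x - v)].
Proof.
move=> t00 oU lF clA Cs sU sA.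
pose good (delta : R) (p : M * R) := forall v : V p.1, t0 <= p.2 <= T ->
  h p.1 (s p.2 p.1 - v) (s p.2 p.1 - v) <= delta ->
    [/\ U (Vec p.1 v), ~ A p.2 (Vec p.1 v) &
      h p.1 (F p.1 (s p.2 p.1) p.2 - F p.1 v p.2)
         (F p.1 (s p.2 p.1) p.2 - F p.1 v p.2) <=
        delta^-1 * h p.1 (s p.2 p.1 - v) (s p.2 p.1 - v)].
pose Q := [set: M] `*` (`[t0, T]%classic : set R).
have cQ : compact Q by apply: compact_setX; [exact: manifold_compact|exact: segment_compact].
have HQ p : Q p -> \forall p' \near p & delta \near (0 : R)^'+, good delta p'.
  move: p => [x0 t1] [_ /=]; rewrite in_itv/= => t1T.
  have t1T' : 0 <= t1 <= T by move: t1T => /andP[? ->]; rewrite (le_trans t00).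
  have [a ax0] := tdom_cover V x0.
  pose S t x := triv V a (s t x).
  have S0 : frame V a x0 (S t1 x0) = s t1 x0 by rewrite /S trivK.
  have nU : nbhs (Vec x0 (frame V a x0 (S t1 x0)), t1)
      [set p : total_space V * R | U p.1].
    rewrite S0; exists (U, setT) => /=; last by move=> p [].
    by split; [apply: open_nbhs_nbhs; split=> //; exact: sU|exact: filterT].
  have nA : nbhs (Vec x0 (frame V a x0 (S t1 x0)), t1)
      (~` [set p : total_space V * R | 0 <= p.2 <= T /\ A p.2 p.1]).
    rewrite S0; apply: open_nbhs_nbhs; split; first exact: closed_openC.
    by move=> [_ /sA]; exact.
  have [N HN [L HL]] := lF (Vec x0 (s t1 x0), t1) (sU _ _ t1T) t1T'.
  rewrite -S0 in HN.
  have [e1 e10 He1] := near_total ax0 (filterI (filterI nU nA) HN).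
  have [c c0 Hc] := hprod_lower ax0 h.
  have e130 : 0 < e1 / 3 by rewrite divr_gt0.
  have [e2 e20 He2] := section_near Cs ax0 t1T e130.
  (* Squared distance at most [d1] forces coordinate distance at most e1 / 3, and [d2] makes
     delta^-1 exceed L^2. *)
  pose d1 := c * (e1 / 3) ^+ 2.
  pose d2 := (L ^+ 2 + 1)^-1.
  have d10 : 0 < d1 by rewrite mulr_gt0// exprn_gt0.
  have d20 : 0 < d2 by rewrite invr_gt0 ltr_wpDl// sqr_ge0.
  exists ([set p | `|p.2 - t1| < Num.min e1 e2 /\ [/\ tdom V a p.1,
      forall v t, `|v - S t1 x0| < e1 -> `|t - t1| < e1 ->
       (U (Vec p.1 (frame V a p.1 v)) /\ ~ (0 <= t <= T /\ A t (Vec p.1 (frame V a p.1 v)))) /\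
        N (Vec p.1 (frame V a p.1 v), t),
      forall v, c * `|v| ^+ 2 <= h p.1 (frame V a p.1 v) (frame V a p.1 v) &
      forall t, `|t - t1| < e2 -> t0 <= t <= T -> `|S t p.1 - S t1 x0| <= e1 / 3]],
    [set d | 0 < d /\ (d <= d1 /\ d <= d2)]) => /=.
    split.
      exists ([set x | [/\ tdom V a x,
        forall v t, `|v - S t1 x0| < e1 -> `|t - t1| < e1 ->
         (U (Vec x (frame V a x v)) /\ ~ (0 <= t <= T /\ A t (Vec x (frame V a x v)))) /\
          N (Vec x (frame V a x v), t),
        forall v, c * `|v| ^+ 2 <= h x (frame V a x v) (frame V a x v) &
        forall t, `|t - t1| < e2 -> t0 <= t <= T -> `|S t x - S t1 x0| <= e1 / 3]],
        [set t | `|t - t1| < Num.min e1 e2]) => /=.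
        split.
          by apply: filterS3 He1 Hc He2 => x H1 [ax H2] [_ H3].
        apply/nbhs_ballP; exists (Num.min e1 e2) => /=; first by rewrite lt_min e10.
        by move=> t; rewrite -ball_normE/= distrC.
      by move=> [x t] /= [].
    apply: filterI; first exact: nbhs_right_gt.
    by apply: filterI; exact: nbhs_right_le.
  move=> [[x t] d] /= [[tt [ax H1 H2 H3]] [d0 [dd1 dd2]]] v /= tT hv.
  move: tt; rewrite lt_min => /andP[tt1 tt2].
  have tT' : 0 <= t <= T by move: tT => /andP[? ->]; rewrite (le_trans t00).
  have hS : s t x - v = frame V a x (S t x - triv V a v) by rewrite frameB// /S !trivK.
  have Sv : `|S t x - triv V a v| <= e1 / 3.
    have := H2 (S t x - triv V a v); rewrite -hS => /le_trans/(_ hv)/le_trans/(_ dd1).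
    rewrite /d1 ler_pM2l// ler_pXn2r ?nnegrE//; exact: ltW.
  have SS : `|S t x - S t1 x0| <= e1 / 3 by exact: H3.
  have vS : `|triv V a v - S t1 x0| < e1.
    have -> : triv V a v - S t1 x0 = (S t x - S t1 x0) - (S t x - triv V a v).
      by apply/rowP => j; rewrite !mxE; ring.
    rewrite (le_lt_trans (ler_normB _ _))//.
    by apply: le_lt_trans (lerD SS Sv) _; lra.
  have [[Uv Av] Nv] := H1 _ _ vS tt1.
  have SS' : `|S t x - S t1 x0| < e1 by apply: (le_lt_trans SS); lra.
  have [[Us _] Ns] := H1 _ _ SS' tt1.
  rewrite trivK// in Uv Av Nv; rewrite /S trivK// in Us Ns.
  split=> //; first by move=> At; exact: Av.
  have := HL x _ _ t tT' Us Uv Ns Nv; rewrite /hnorm => HF.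
  set X := F x (s t x) t - F x v t in HF *.
  have LL : 0 <= L * Num.sqrt (h x (s t x - v) (s t x - v)).
    by apply: le_trans HF; exact: sqrtr_ge0.
  have : h x X X <= L ^+ 2 * h x (s t x - v) (s t x - v).
    rewrite -[h x X X]sqr_sqrtr ?hprod_ge0// -[X in _ * X]sqr_sqrtr ?hprod_ge0//.
    by rewrite -exprMn ler_pXn2r ?nnegrE ?sqrtr_ge0.
  move=> /le_trans; apply; apply: ler_wpM2r; first exact: hprod_ge0.
  have Ld : L ^+ 2 + 1 <= d^-1.
    by rewrite -[leLHS]invrK lef_pV2 ?posrE.
  by apply: le_trans Ld; rewrite lerDl.
have Hd : \forall delta \near (0 : R)^'+, Q `<=` good delta.
  exact: (compact_near_coveringP Q).1.
have Hd' : \forall delta \near (0 : R)^'+, Q `<=` good delta /\ 0 < delta.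
  by apply: filterI Hd _; exact: nbhs_right_gt.
have [delta [Hg delta0]] := @filter_ex _ (0 : R)^'+ _ _ Hd'.
exists delta => // x t v tT; apply: (Hg (x, t)) => //.

Qed.

(** * Nearest points of convex sets in a fibre *)

Lemma hprod_sqB (R : realType) (n k : nat) (M : closed_oriented_manifold R n)
    (V : vector_bundle M k) (h : bundle_metric V) (x : M) (c : R) (v w : V x) :
  h x (v - c *: w) (v - c *: w) = h x v v - 2 * c * h x w v + c ^+ 2 * h x w w.
Proof.
rewrite hprodBl !hprodBr !hprodZl !hprodZr (hprod_sym h v w); ring.
Qed.

Section nearest_point.
Context (R : realType) (n k : nat) (M : closed_oriented_manifold R n).
Context (V : vector_bundle M k) (h : bundle_metric V) (x : M).
Context (C : set (V x)) (y z : V x).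
Hypotheses (cC : convex_set C) (Cy : C y).
Hypothesis nearest : forall v, C v -> h x (z - y) (z - y) <= h x (z - v) (z - v).

(** Moving from y towards v by the fraction l stays in C and cannot decrease the distance to z,
    which gives 2<d, N> <= l |d|^2 for small l > 0. *)
Lemma nearest_support v : C v -> h x (v - y) (z - y) <= 0.
Proof.
move=> Cv; set N := z - y; set d := v - y; rewrite leNgt; apply/negP => dN.
have H (l : R) : 0 < l -> l < 1 -> 2 * h x d N <= l * h x d d.
  move=> l0 l1.
  have Cl : C (y + l *: d).
    have l01 : 0 <= l <= 1 by rewrite !ltW.
    pose lam : {i01 R} := Itv01 (ltW l0) (ltW l1).
    have := cC (x := v) (y := y) lam; rewrite !inE => /(_ Cv Cy).
    congr C; rewrite /conv/= /d scalerBr scalerBl scale1r.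
    by rewrite addrC -addrA; congr (_ + _); rewrite addrC.
  have := nearest Cl.
  have -> : z - (y + l *: d) = N - l *: d by rewrite opprD addrA.
  rewrite -/N hprod_sqB => H.
  by rewrite -(ler_pM2l l0); clearbody N d; nra.
have dd : 0 <= h x d d by exact: hprod_ge0.
(* With this [l] the right-hand side l |d|^2 is at most <d, N>, contradicting <d, N> > 0. *)
pose l := Num.min (1 / 2) (h x d N / (h x d d + 1)).
have d10 : 0 < h x d d + 1 by rewrite ltr_wpDl.
have l0 : 0 < l by rewrite lt_min !divr_gt0.
have [la lb] : l <= 1 / 2 /\ l <= h x d N / (h x d d + 1).
  by rewrite /l !ge_min !lexx orbT.
have l1 : l < 1 by lra.
have := H l l0 l1; rewrite ler_pdivlMr// in lb; nra.
Qed.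

(** The support inequality gives |z - v|^2 >= |z - y|^2 + |v - y|^2. *)
Lemma nearest_unique v : C v -> h x (z - v) (z - v) <= h x (z - y) (z - y) -> v = y.
Proof.
move=> Cv; have := nearest_support Cv; set N := z - y; set d := v - y.
have -> : z - v = N - 1 *: d by rewrite scale1r /N /d opprB addrA subrK.
rewrite hprod_sqB => H1 H2.
have [/eqP|/(hprod_pos h) dd] := eqVneq d 0; first by rewrite subr_eq0 => /eqP.
exfalso; clearbody N d; lra.
Qed.

End nearest_point.

(** * The barrier argument *)

Lemma deriv_hprod_fibre (R : realType) (n k : nat) (M : closed_oriented_manifold R n)
    (V : vector_bundle M k) (h : bundle_metric V) (a : tindex V) (x : M)
    (J : set R) (u : R -> 'rV[R]_k) (r : R) (u' : 'rV[R]_k) : tdom V a x ->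
  (forall e, deriv_within R^o J (fun q => u q 0 e) r 1 (u' 0 e)) ->
  deriv_within R^o J (fun q => h x (frame V a x (u q)) (frame V a x (u q))) r 1
    (2 * h x (frame V a x u') (frame V a x (u r))).
Proof.
move=> ax Hu; pose hm d e := h x (frame_section a d x) (frame_section a e x).
have hmE v w : h x (frame V a x v) (frame V a x w) =
    \sum_d \sum_e hm d e * (v 0 d * w 0 e).
  rewrite (frameE v ax) (frameE w ax) hprod_suml; apply: eq_bigr => d _.
  rewrite hprodZl hprod_sumr mulr_sumr; apply: eq_bigr => e _.
  by rewrite hprodZr /hm; ring.
have : deriv_within R^o J
    (fun q => \sum_d \sum_e hm d e * (u q 0 d * u q 0 e)) r 1
    (\sum_d \sum_e hm d e * (u' 0 d * u r 0 e + u r 0 d * u' 0 e)).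
  apply: deriv_within_sum => d; apply: deriv_within_sum => e.
  by apply: deriv_withinZ; exact: deriv_withinM.
congr deriv_within; first by apply/funext => q; rewrite hmE.
rewrite mulr_natl mulr2n {1}hmE (hprod_sym h) hmE -big_split/=.
apply: eq_bigr => d _; rewrite -big_split/=; apply: eq_bigr => e _.
by rewrite -mulrDr.
Qed.

Section generator.
Context (R : realType) (n k : nat) (M : closed_oriented_manifold R n).
Context (V : vector_bundle M k) (T : R) (g : metric_family M T).
Context (Gam : christoffel M) (h : bundle_metric V) (nabla : connection_family V T).
Context (u : R -> chart M -> 'I_n -> forall x : M, V x -> V x).
Hypothesis du : smooth_diagonal T u.

(** The diagonal form makes u(nabla s) a combination of the derivatives nabla_c s, and the
    Christoffel symbols of the Laplacian also multiply only these. All of them are orthogonal to N,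
    so only the trace of the second derivatives is left. *)
Lemma generator_le0 (t : R) (s : section_of V) (i : chart M) (x : M) (N : V x) :
  0 <= t <= T -> dom i x -> (forall c, h x (nabla t s i c x) N = 0) ->
  (forall w, qform (fun b c => h x (nabla t (nabla t s i c) i b x) N) w <= 0) ->
  h x (laplacian g nabla Gam t s i x + \sum_c u t i c (nabla t s i c x)) N <= 0.
Proof.
move=> tT ix al0 be0; have [uc [_ ucE]] := du.2 i.
rewrite hprodDl hprod_suml [X in _ + X]big1 ?addr0; last first.
  by move=> c _; rewrite ucE// hprodZl al0 mulr0.
have := posdef_trace_le0 (gmx_sym g tT ix) (fun v => gmx_pos g tT ix (v := v)) be0.
congr (_ <= _); rewrite /laplacian hprod_suml; apply: eq_bigr => b _.
rewrite hprod_suml; apply: eq_bigr => c _.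
rewrite hprodZl /nabla_hat hprodBl hprod_suml big1 ?subr0// => d _.
by rewrite hprodZl al0 mulr0.
Qed.

End generator.

Section barrier.
Context (R : realType) (n k : nat) (T : R).
Context (M : closed_oriented_manifold R n) (g : metric_family M T).
Context (Gam : christoffel M) (V : vector_bundle M k) (h : bundle_metric V).
Context (nabla : connection_family V T) (U : set (total_space V)).
Context (F : forall x : M, V x -> R -> V x).
Context (u : R -> chart M -> 'I_n -> forall x : M, V x -> V x).
Context (K A : R -> set (total_space V)).
Hypothesis hc : compatible nabla h.
Hypothesis oU : open U.
Hypothesis KU : forall t : R, 0 <= t <= T -> K t `<=` U.
Hypothesis Kpar : forall t : R, 0 <= t <= T -> parallel_invariant nabla t (K t).
Hypothesis Kconv : forall (t : R) (x : M), 0 <= t <= T ->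
  convex_set (fiber_of (K t) x).
Hypothesis clK : closed [set p : total_space V * R | 0 <= p.2 <= T /\ K p.2 p.1].
Hypothesis du : smooth_diagonal T u.
Hypothesis cF : continuous_field T U F.
Hypothesis lF : lipschitz_field T h U F.
Hypothesis ode : forall (x : M) (t0 : R) (J : set R) (s : R -> V x),
    0 <= t0 < T -> is_interval J -> J t0 -> J `<=` `[t0, T] ->
    ode_solution U F J s ->
    fiber_of (K t0 `\` A t0) x (s t0) ->
    (forall t, J t -> fiber_of (K t) x (s t)) \/
    (exists t1, [/\ J t1,
      forall t : R, t0 <= t < t1 -> fiber_of (K t `\` A t) x (s t) &
      fiber_of (A t1) x (s t1)]).
Context (t0 : R) (s : R -> section_of V).
Hypothesis t0T : 0 <= t0 < T.
Hypothesis pde : pde_solution U g Gam nabla u F t0 s.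
Context (delta : R).
Hypothesis delta0 : 0 < delta.
Hypothesis near_s : forall x t (v : V x), t0 <= t <= T ->
    h x (s t x - v) (s t x - v) <= delta ->
    [/\ U (Vec x v), ~ A t (Vec x v) &
      h x (F (s t x) t - F v t) (F (s t x) t - F v t) <=
        delta^-1 * h x (s t x - v) (s t x - v)].
Context (E : R).
Hypothesis E0 : 0 < E.
Let c := delta^-1 + 2.
Let rho (t : R) := E * expR (c * (t - t0)).
Hypothesis rho_delta : forall t, t0 <= t <= T -> rho t <= delta.

Let c0 : 0 < c. Proof. by rewrite addr_gt0// invr_gt0. Qed.

Let rho_gt0 t : 0 < rho t. Proof. by rewrite mulr_gt0// expR_gt0. Qed.

(** The exponential lies above its tangent at t1; a constant slope bound c rho(t1) on a short
    interval is therefore enough to stay below [rho]. *)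
Let rho_growth t1 t : rho t1 * (1 + c * (t - t1)) <= rho t.
Proof.
rewrite /rho (_ : c * (t - t0) = c * (t1 - t0) + c * (t - t1)); last by ring.
by rewrite expRD mulrA ler_wpM2l ?expR_ge1Dx// mulr_ge0 ?expR_ge0// ltW.
Qed.

Let rho_mono t1 t : t1 <= t -> rho t1 <= rho t.
Proof.
move=> tt; apply: le_trans (rho_growth t1 t).
rewrite ler_peMr ?(ltW (rho_gt0 _))// lerDl; apply: mulr_ge0; first exact: ltW.
by rewrite subr_ge0.
Qed.

Let rho_continuous : continuous rho.
Proof.
move=> t; apply: cvgMr; apply: (@continuous_comp _ _ _ (fun t => c * (t - t0)) (@expR R)).
  by apply: cvgMr; apply: cvgB; [exact: cvg_id|exact: cvg_cst].
exact: continuous_expR.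
Qed.

Definition below (t : R) := forall x : M, exists2 v : V x, K t (Vec x v) &
  h x (s t x - v) (s t x - v) <= rho t.

Let time_le t : t0 <= t <= T -> 0 <= t <= T.
Proof. by move: t0T => /andP[? _] /andP[? ->]; rewrite (le_trans _ (_ : t0 <= _)). Qed.

Lemma flow_stays (a : tindex V) (x : M) (Y : R -> 'rV[R]_k) (t1 t2 : R) :
  tdom V a x -> t0 <= t1 -> t1 < t2 -> t2 <= T ->
  K t1 (Vec x (frame V a x (Y t1))) ->
  (forall r, t1 <= r <= t2 -> U (Vec x (frame V a x (Y r)))) ->
  (forall r e, t1 <= r <= t2 -> deriv_within R^o `[t1, t2] (fun q => Y q 0 e) r 1
     (triv V a (F (frame V a x (Y r)) r) 0 e)) ->
  (forall r, t1 <= r <= t2 ->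
    h x (s r x - frame V a x (Y r)) (s r x - frame V a x (Y r)) <= delta) ->
  forall r, t1 <= r <= t2 -> K r (Vec x (frame V a x (Y r))).
Proof.
move=> ax t01 t12 t2T KY UY dY dist; move: t0T => /andP[t00 _].
have inT r : t1 <= r <= t2 -> t0 <= r <= T by move=> /andP[? ?]; lra.
have notA r : t1 <= r <= t2 -> ~ A r (Vec x (frame V a x (Y r))).
  by move=> rt; have [] := near_s (inT r rt) (dist r rt).
have t1in : t1 <= t1 <= t2 by rewrite lexx ltW.
have := @ode x t1 `[t1, t2]%classic (fun r => frame V a x (Y r)).
have t1T : 0 <= t1 < T by rewrite (le_trans t00)//= (lt_le_trans t12).
move=> /(_ t1T (@interval_is_interval _ _)) H.
have J1 : `[t1, t2]%classic t1 by rewrite /= in_itv.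
have JT : `[t1, t2]%classic `<=` `[t1, T]%classic.
  by move=> r; rewrite /= !in_itv/= => /andP[-> /le_trans->].
have sol : ode_solution U F `[t1, t2]%classic (fun r => frame V a x (Y r)).
  by apply: coordinate_ode_solution.
have [] := H J1 JT sol.
- by split=> //; exact: notA.
- by move=> HK r rt; apply: HK; rewrite /= in_itv.
- by move=> [t3 [/=]]; rewrite in_itv/= => /notA.
Qed.


Let continues (t1 : R) (x0 : M) := exists2 eta : R, 0 < eta &
  \forall x \near x0, forall t, t1 <= t <= t1 + eta ->
    exists2 v : V x, K t (Vec x v) & h x (s t x - v) (s t x - v) <= rho t.

Let s_C21 : sec_C21 t0 T s. Proof. by have [] := pde. Qed.

Lemma continues_strict (a : tindex V) (x0 : M) (t1 : R) (y : 'rV[R]_k) :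
  tdom V a x0 -> t0 <= t1 < T -> K t1 (Vec x0 (frame V a x0 y)) ->
  h x0 (s t1 x0 - frame V a x0 y) (s t1 x0 - frame V a x0 y) < rho t1 ->
  continues t1 x0.
Proof.
move=> ax0 /andP[t01 t1T] Ky hy; have t1T' : t0 <= t1 <= T by rewrite t01 ltW.
have t1T'' : 0 <= t1 < T by rewrite t1T andbT; case/andP: (time_le t1T').
have [i ix0] := dom_cover x0.
have [r0 r00 [sub [C C0 HT]]] := line_transport_exists nabla (time_le t1T') ax0 ix0.
pose S t x := triv V a (s t x).
have hS x t v : tdom V a x -> h x (s t x - frame V a x v) (s t x - frame V a x v) =
    h x (frame V a x (S t x - v)) (frame V a x (S t x - v)).
  by move=> ax; rewrite /S frameB// trivK.
rewrite hS// in hy; set h0 := h x0 _ _ in hy.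
pose e := rho t1 - h0.
have e0 : 0 < e by rewrite subr_gt0.
have [f1 f10 Hf1] := hprod_near ax0 h (S t1 x0 - y) (S t1 x0 - y) e0.
(* Three errors of size f1 / 4 will be added: the variation of s, the motion along the flow, and the
   displacement by parallel translation. *)
have f140 : 0 < f1 / 4 by rewrite divr_gt0.
have [e2 e20 He2] := section_near s_C21 ax0 t1T' f140.
have [C' C'0 [e3 e30 He3]] := flow_near oU cF lF ax0 (KU (time_le t1T') Ky) t1T''.
pose eta := Num.min (Num.min e3 (e2 / 2)) (f1 / 4 / (C' + 1)).
have C'1 : 0 < C' + 1 by rewrite ltr_wpDl.
have eta0 : 0 < eta by rewrite !lt_min e30 !divr_gt0.
have [eta1 eta2 eta3] : [/\ eta <= e3, eta <= e2 / 2 & eta <= f1 / 4 / (C' + 1)].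
  by rewrite /eta !ge_min !lexx !orbT.
(* Times |w|, this bounds the displacement of y under parallel translation, which determines the
   radius [d] of admissible base points. *)
pose kap := C * (2 * `|y| + 1) + 1.
have yk : 0 <= C * (2 * `|y| + 1) by rewrite mulr_ge0// addr_ge0// mulr_ge0.
have kap0 : 0 < kap by rewrite ltr_wpDl.
pose d := Num.min r0 (Num.min e3 (f1 / 4) / kap).
have d0 : 0 < d by rewrite lt_min r00/= divr_gt0// lt_min e30.
have [dr dk] : d <= r0 /\ d <= Num.min e3 (f1 / 4) / kap by rewrite /d !ge_min !lexx orbT.
have nd : \forall x \near x0, `|coord i x - coord i x0| < d.
  have := coord_continuous_at ix0; move/cvgrPdist_lt => /(_ d d0) H.
  have {}H : \forall x \near x0, `|coord i x0 - coord i x| < d by exact: H.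
  by apply: filterS H => x; rewrite distrC.
have ni := open_nbhs_nbhs (conj (@dom_open _ _ M i) ix0).
exists eta => //.
apply: filterS3 (filterI nd ni) (filterI Hf1 He2) He3 => x [xd ix] [Hh [ax HSx]] [_ Hflow] t tt.
pose p := coord i x0; pose w := coord i x - p.
have line_ball (r : R) : 0 <= r <= 1 -> ball p r0 (p + r *: w).
  move=> /andP[r_ge0 r1]; rewrite -ball_normE/= opprD addrA subrr add0r normrN.
  by rewrite normrZ ger0_norm// (le_lt_trans _ (lt_le_trans xd dr))// ler_piMl.
have [Z [Z0 HZ Z1]] := HT p w y line_ball.
have pw : p + w = coord i x by rewrite subrKC.
have := line_transport_invariant (time_le t1T') (Kpar (time_le t1T'))
  (fun r r01 => sub _ (line_ball r r01)) HZ.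
rewrite Z0 pw !coordK// => /(_ Ky) KZ.
have Zy : `|Z 1 - y| < Num.min e3 (f1 / 4).
  apply: (le_lt_trans Z1); apply: (@le_lt_trans _ _ (kap * `|w|)).
    by rewrite -mulrA (mulrC `|w|) mulrA ler_wpM2r// lerDl.
  by rewrite mulrC -ltr_pdivlMr// (lt_le_trans xd).
move: Zy; rewrite lt_min => /andP[Zy1 Zy2].
have [tT [Y [Y0 Yb YU Yd]]] := Hflow _ Zy1 eta eta0 eta1.
have close r : t1 <= r <= t1 + eta ->
    h x (s r x - frame V a x (Y r)) (s r x - frame V a x (Y r)) <= rho t1.
  move=> rt; rewrite hS//; have /andP[r1 r2] := rt.
  have rT : t0 <= r <= T by rewrite (le_trans t01)//= (le_trans r2).
  have rt1 : `|r - t1| < e2 by rewrite ger0_norm ?subr_ge0//; lra.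
  have H1 : `|S r x - S t1 x0| <= f1 / 4 by exact: HSx.
  have H2 : `|Y r - Z 1| <= f1 / 4.
    apply: (le_trans (Yb r rt)); apply: (@le_trans _ _ ((C' + 1) * eta)).
      by apply: ler_pM => //; [lra|rewrite lerDl|lra].
    by rewrite mulrC -ler_pdivlMr.
  have uu : `|S r x - Y r - (S t1 x0 - y)| < f1.
    have -> : S r x - Y r - (S t1 x0 - y) = (S r x - S t1 x0) - ((Y r - Z 1) + (Z 1 - y)).
      by apply/rowP => j; rewrite !mxE; ring.
    apply: le_lt_trans (ler_normB _ _) _.
    apply: le_lt_trans (lerD H1 (le_trans (ler_normD _ _) (lerD H2 (ltW Zy2)))) _.
    lra.
  have := Hh _ _ uu uu; rewrite -/h0 => /ler_normlP[_].
  by rewrite /e lerBlDr subrK.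
have t1e : t1 < t1 + eta by rewrite ltrDl.
exists (frame V a x (Y t)).
  apply: (flow_stays ax t01 t1e tT _ YU Yd _ tt); first by rewrite Y0.
  move=> r rt; apply: (le_trans (close r rt)); exact: rho_delta.
apply: le_trans (close t tt) _; apply: rho_mono; by case/andP: tt.
Qed.


(** With equality at x0 there is no room for an initial error: a parallel translate of the nearest
    point could start above [rho t1]. The ODE solution over x therefore starts at the point given by
    [below t1]; only its closeness to y, needed for the slope, is taken from [near_points_near]. *)
Lemma continues_nearest (x0 : M) (t1 : R) : t0 <= t1 < T -> below t1 ->
  (forall v, K t1 (Vec x0 v) -> rho t1 <= h x0 (s t1 x0 - v) (s t1 x0 - v)) ->
  continues t1 x0.
Proof.
move=> /andP[t01 t1T] Pt1 Hmin; have t1T' : t0 <= t1 <= T by rewrite t01 ltW.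
have t1T'' : 0 <= t1 < T by rewrite t1T andbT; case/andP: (time_le t1T').
have [a ax0] := tdom_cover V x0; have [i ix0] := dom_cover x0.
have [y0 Ky0 hy0] := Pt1 x0.
have hyE : h x0 (s t1 x0 - y0) (s t1 x0 - y0) = rho t1.
  by apply/eqP; rewrite eq_le hy0 Hmin.
pose S t x := triv V a (s t x); pose y := triv V a y0.
have yE : frame V a x0 y = y0 by rewrite /y trivK.
have hS x t v : tdom V a x -> h x (s t x - frame V a x v) (s t x - frame V a x v) =
    h x (frame V a x (S t x - v)) (frame V a x (S t x - v)).
  by move=> ax; rewrite /S frameB// trivK.
have nearest v : fiber_of (K t1) x0 v ->
    h x0 (s t1 x0 - y0) (s t1 x0 - y0) <= h x0 (s t1 x0 - v) (s t1 x0 - v).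
  by move=> Kv; rewrite hyE; exact: Hmin.
have cK := @Kconv t1 x0 (time_le t1T').
pose N := s t1 x0 - y0; pose n0 := S t1 x0 - y.
have nE : frame V a x0 n0 = N by rewrite /n0 frameB// yE /S trivK.
have [al0 be0] : (forall c, h x0 (nabla t1 (s t1) i c x0) N = 0) /\
    forall w, qform (fun b c => h x0 (nabla t1 (nabla t1 (s t1) i c) i b x0) N) w <= 0.
  have Hm v : K t1 (Vec x0 v) -> h x0 v (frame V a x0 n0) <= h x0 y0 N.
    move=> Kv; rewrite nE.
    have := nearest_support cK Ky0 nearest Kv; rewrite -/N hprodBl; lra.
  have Hq : h x0 (s t1 x0) (frame V a x0 n0) =
      h x0 y0 N + h x0 (frame V a x0 n0) (frame V a x0 n0).
    by rewrite nE -hprodDl /N subrKC.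
  have Hd x : exists2 v, K t1 (Vec x v) &
      h x (s t1 x - v) (s t1 x - v) <= h x0 (frame V a x0 n0) (frame V a x0 n0).
    by rewrite nE /N hyE; exact: Pt1.
  have := covariant_derivs_at_max hc (time_le t1T') ax0 ix0 (Kpar (time_le t1T'))
    Hm Hq Hd (fun d => section_C2 s_C21 a i d t1T').
  by rewrite nE.
have gen := generator_le0 g Gam du (time_le t1T') ix0 al0 be0.
set G := (X in h x0 X N) in gen.
have [dS [dSc dSd]] := section_time_deriv s_C21 ax0.
have tT0 : t0 < T by case/andP: t0T.
(* [dS] was chosen only as a continuous time derivative; uniqueness of derivatives on [t0, T]
   identifies it at (x0, t1) with the right-hand side of the PDE. *)
have dS0 : dS x0 t1 = triv V a (G + F (s t1 x0) t1).
  apply/rowP => d; have [_ _ /(_ t1 i x0 t1T' ix0 a d ax0) H] := pde.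
  apply: (segment_deriv_unique tT0 t1T' _ H).
  exact: (nbhs_singleton dSd).
pose f0 := triv V a (F y0 t1).
have fE : frame V a x0 (dS x0 t1 - f0) = G + (F (s t1 x0) t1 - F y0 t1).
  by rewrite frameB// dS0 /f0 !trivK// addrA.
have strict : 2 * h x0 (frame V a x0 (dS x0 t1 - f0)) (frame V a x0 n0) <=
    (delta^-1 + 1) * rho t1.
  have hd : h x0 (s t1 x0 - y0) (s t1 x0 - y0) <= delta by rewrite hyE rho_delta.
  have [_ _ HF] := near_s t1T' hd.
  have HA := hprod_AMGM h (F (s t1 x0) t1 - F y0 t1) N.
  have hNN : h x0 N N = rho t1 by exact: hyE.
  rewrite hNN in HA; rewrite hyE in HF; rewrite fE nE hprodDl mulrDl mul1r.
  lra.
(* This tolerance is doubled in the slope and uses up the last 1 in the constant [c]. *)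
have r20 : 0 < rho t1 / 2 by rewrite divr_gt0.
have [g1 g10 Hg1] := hprod_near ax0 h (dS x0 t1 - f0) n0 r20.
have g140 : 0 < g1 / 4 by rewrite divr_gt0.
have [e1 e10 He1] := section_near s_C21 ax0 t1T' g140.
have [e2 e20 He2] := dSc t1 _ t1T' g140.
have Ky : K t1 (Vec x0 (frame V a x0 y)) by rewrite yE.
have Uy : U (Vec x0 (frame V a x0 y)) := KU (time_le t1T') Ky.
have [e3 e30 He3] := field_near ax0 oU cF Uy (time_le t1T') g140.
have [C' C'0 [e4 e40 He4]] := flow_near oU cF lF ax0 Uy t1T''.
(* The solution stays within 2 [w0] of y, at most g1 / 2; the other two bounds keep it where the
   field varies little and its start where the flow exists. *)
pose w0 := Num.min (Num.min (g1 / 4) (e3 / 2)) e4.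
have w00 : 0 < w0 by rewrite !lt_min e40 !divr_gt0.
have [w01 w02 w03] : [/\ w0 <= g1 / 4, w0 <= e3 / 2 & w0 <= e4].
  by rewrite /w0 !ge_min !lexx !orbT.
pose W := [set v : 'rV[R]_k | `|y - v| < w0].
have oW : open W.
  rewrite (_ : W = ball y w0); last by rewrite -ball_normE.
  exact: ball_open.
have HW v : K t1 (Vec x0 (frame V a x0 v)) ->
    h x0 (s t1 x0 - frame V a x0 v) (s t1 x0 - frame V a x0 v) <= rho t1 -> W v.
  move=> Kv hv; have vy : frame V a x0 v = y0.
    by apply: (nearest_unique cK Ky0 nearest Kv); rewrite hyE.
  by rewrite /W/= /y -vy frameK// subrr normr0.
have t00 : 0 <= t0 by case/andP: t0T.
have [e5 e50 He5] := near_points_near t00 clK s_C21 rho_continuous ax0 t1T' oW HW.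
pose eta := Num.min (Num.min (e1 / 2) (e2 / 2)) (Num.min (Num.min (e3 / 2) e4)
  (w0 / (C' + 1))).
have C'1 : 0 < C' + 1 by rewrite ltr_wpDl.
have eta0 : 0 < eta by rewrite !lt_min e40 !divr_gt0.
have [eta1 eta2 [eta3 eta4 eta5]] : [/\ eta <= e1 / 2, eta <= e2 / 2 &
    [/\ eta <= e3 / 2, eta <= e4 & eta <= w0 / (C' + 1)]].
  by rewrite /eta !ge_min !lexx !orbT.
exists eta => //.
apply: filterS3 (filterI (filterI Hg1 He1) (filterI He2 He3)) (filterI He4 He5) dSd
  => x [[Hh [ax HSx]] [[_ HdS] [_ Hf]]] [[_ Hflow] [_ Hnear]] Hd t tt.
have [v' Kv' hv'] := Pt1 x.
pose y' := triv V a v'.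
have y'E : frame V a x y' = v' by rewrite /y' trivK.
have Wy' : `|y' - y| < w0.
  rewrite distrC; apply: (Hnear t1 y') => //; rewrite ?y'E//.
  by rewrite subrr normr0.
have [tT [Y [Y0 Yb YU Yd]]] := Hflow y' (lt_le_trans Wy' w03) eta eta0 eta4.
have inT r : t1 <= r <= t1 + eta -> t0 <= r <= T.
  by move=> /andP[r1 r2]; rewrite (le_trans t01)//= (le_trans r2).
have Yy r : t1 <= r <= t1 + eta -> `|Y r - y| <= w0 + w0.
  move=> rt; rewrite -(subrKA y') (le_trans (ler_normD _ _))// lerD//; last exact: ltW.
  have /andP[r1 r2] := rt.
  apply: (le_trans (Yb r rt)); apply: (@le_trans _ _ ((C' + 1) * eta)).
    by apply: ler_pM => //; [lra|rewrite lerDl|lra].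
  by rewrite mulrC -ler_pdivlMr.
have slope r : t1 <= r <= t1 + eta -> 2 * h x
    (frame V a x (dS x r - triv V a (F (frame V a x (Y r)) r)))
    (frame V a x (S r x - Y r)) <= c * rho t1.
  move=> rt; have /andP[r1 r2] := rt.
  have ra : `|r - t1| <= eta by rewrite ger0_norm ?subr_ge0//; lra.
  have H1 : `|S r x - S t1 x0| <= g1 / 4.
    by apply: HSx; [apply: (le_lt_trans ra); lra|exact: inT].
  have H2 : `|dS x r - dS x0 t1| <= g1 / 4.
    by apply: HdS; [apply: (le_lt_trans ra); lra|exact: inT].
  have H3 : `|triv V a (F (frame V a x (Y r)) r) - f0| <= g1 / 4.
    rewrite /f0 -yE; apply: (Hf _ _ _ _ (time_le (inT r rt))).2.
      rewrite -(subrKA y') (le_lt_trans (ler_normD _ _))//.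
      have H4 : `|Y r - y'| <= e3 / 2.
        apply: (le_trans (Yb r rt)); apply: (@le_trans _ _ ((C' + 1) * eta)).
          by apply: ler_pM => //; [lra|rewrite lerDl|lra].
        by rewrite mulrC -ler_pdivlMr// (le_trans eta5)// ler_wpM2r// invr_ge0 ltW.
      by apply: lt_le_trans (ler_ltD H4 (lt_le_trans Wy' w02)) _; lra.
    by apply: (le_lt_trans ra); lra.
  have u1 : `|dS x r - triv V a (F (frame V a x (Y r)) r) - (dS x0 t1 - f0)| < g1.
    rewrite [X in `|X|](_ : _ = (dS x r - dS x0 t1) -
      (triv V a (F (frame V a x (Y r)) r) - f0)).
      by apply: le_lt_trans (ler_normB _ _) _; apply: le_lt_trans (lerD H2 H3) _; lra.
    by apply/rowP => j; rewrite !mxE; ring.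
  have v1 : `|S r x - Y r - n0| < g1.
    rewrite [X in `|X|](_ : _ = (S r x - S t1 x0) - (Y r - y)).
      apply: le_lt_trans (ler_normB _ _) _.
      by apply: le_lt_trans (lerD H1 (Yy r rt)) _; lra.
    by apply/rowP => j; rewrite !mxE; ring.
  have := Hh _ _ u1 v1 => /ler_normlP[_ H4].
  have cE : c * rho t1 = (delta^-1 + 1) * rho t1 + rho t1 by rewrite /c; ring.
  by rewrite cE; lra.
have grow r : t1 <= r <= t1 + eta ->
    h x (s r x - frame V a x (Y r)) (s r x - frame V a x (Y r)) <= rho r.
  move=> rt; have /andP[r1 r2] := rt.
  pose f q := h x (frame V a x (S q x - Y q)) (frame V a x (S q x - Y q)).
  rewrite hS// -/(f r).
  have f1 : f t1 <= rho t1 by rewrite /f -hS// Y0 y'E.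
  have := @segment_deriv_le R t1 r f (fun q => 2 * h x
    (frame V a x (dS x q - triv V a (F (frame V a x (Y q)) q)))
    (frame V a x (S q x - Y q))) (c * rho t1) r1.
  move=> H; have {}H : f r - f t1 <= c * rho t1 * (r - t1).
    apply: H => q /andP[q1 q2]; last by apply: slope; rewrite q1 (le_trans q2).
    have qt : t1 <= q <= t1 + eta by rewrite q1 (le_trans q2).
    apply: (deriv_hprod_fibre (u := fun q => S q x - Y q)) => // d.
    have Hd1 := Hd q d (inT q qt); have Hd2 := Yd q d qt.
    have {}Hd1 : deriv_within R^o `[t1, r] (fun q => triv V a (s q x) 0 d) q 1 (dS x q 0 d).
      by apply: segment_deriv_sub Hd1; rewrite ?q1 ?q2// (le_trans r2).
    have {}Hd2 : deriv_within R^o `[t1, r] (fun q => Y q 0 d) q 1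
        (triv V a (F (frame V a x (Y q)) q) 0 d).
      by apply: segment_deriv_sub Hd2; rewrite ?q1 ?q2.
    have := deriv_withinB Hd1 Hd2; rewrite !mxE.
    by congr deriv_within; apply/funext => z; rewrite !mxE.
  have := rho_growth t1 r; lra.
have t1e : t1 < t1 + eta by rewrite ltrDl.
exists (frame V a x (Y t)); last exact: grow.
apply: (flow_stays ax t01 t1e tT _ YU Yd _ tt); first by rewrite Y0 y'E.
by move=> r rt; apply: (le_trans (grow r rt)); apply: rho_delta; exact: inT.
Qed.


Lemma below_continues (t1 : R) : t0 <= t1 < T -> below t1 ->
  exists2 tau : R, 0 < tau & forall t, t1 <= t <= t1 + tau -> below t.
Proof.
move=> t1T Pt1.
have H x0 : continues t1 x0.
  have [[v Kv hv]|none] := pselect (exists2 v, K t1 (Vec x0 v) &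
      h x0 (s t1 x0 - v) (s t1 x0 - v) < rho t1).
    have [a ax0] := tdom_cover V x0.
    by apply: (@continues_strict a x0 t1 (triv V a v)); rewrite ?trivK.
  apply: continues_nearest => // v Kv; rewrite leNgt; apply/negP => hv.
  by apply: none; exists v.
pose P (tau : R) (x : M) := forall t, t1 <= t <= t1 + tau ->
    exists2 v : V x, K t (Vec x v) & h x (s t x - v) (s t x - v) <= rho t.
have HP x : [set: M] x -> \forall x' \near x & tau \near (0 : R)^'+, P tau x'.
  move=> _; have [eta eta0 Heta] := H x.
  exists ([set x | P eta x], [set tau | tau <= eta]) => /=.
    by split=> //; exact: nbhs_right_le.
  move=> [x' tau] /= [Hx taue] t /andP[t_1 t_2]; apply: Hx.
  by rewrite t_1 (le_trans t_2)// lerD2l.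
have Htau : \forall tau \near (0 : R)^'+, [set: M] `<=` P tau.
  exact: (compact_near_coveringP _).1 (@manifold_compact _ _ M) _ _ P _ HP.
have Htau' : \forall tau \near (0 : R)^'+, [set: M] `<=` P tau /\ 0 < tau.
  by apply: filterI Htau _; exact: nbhs_right_gt.
have [tau [Ht tau0]] := @filter_ex _ (0 : R)^'+ _ _ Htau'.
by exists tau => // t tt x; exact: Ht tt.
Qed.

Lemma below_left_closed (t1 : R) : t0 < t1 <= T ->
  (forall t, t0 <= t < t1 -> below t) -> below t1.
Proof.
move=> /andP[t01 t1T] Hb x; have [a ax] := tdom_cover V x.
apply: contrapT => none.
have t1T' : t0 <= t1 <= T by rewrite ltW.
have t00 : 0 <= t0 by case/andP: t0T.
have H v : K t1 (Vec x (frame V a x v)) ->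
    h x (s t1 x - frame V a x v) (s t1 x - frame V a x v) <= rho t1 -> set0 v.
  by move=> Kv hv; apply: none; exists (frame V a x v).
(* Applied with W empty: the absence of a witness at t1 would persist at slightly earlier times. *)
have [eta eta0 Heta] := near_points_near t00 clK s_C21 rho_continuous ax t1T' open0 H.
have [_ {}Heta] := nbhs_singleton Heta.
pose t := Num.max t0 (t1 - eta / 2).
have e20 : 0 < eta / 2 by rewrite divr_gt0.
have tt1 : t < t1 by rewrite gt_max t01 ltrBlDr ltrDl.
have t0t : t0 <= t by rewrite le_max lexx.
have tte : `|t - t1| < eta.
  rewrite distrC ger0_norm ?subr_ge0 ?(ltW tt1)//.
  have : t1 - eta / 2 <= t by rewrite le_max lexx orbT.
  lra.
have tin : t0 <= t < t1 by rewrite t0t.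
have [v Kv hv] := Hb t tin x.
by apply: (Heta t (triv V a v) tte); rewrite ?trivK// t0t (le_trans (ltW tt1)).
Qed.

(** Induction over the real interval: the supremum of the times up to which the claim holds is
    attained by left closedness and cannot be smaller than T by continuation. *)
Lemma below_all : (forall x, K t0 (Vec x (s t0 x))) ->
  forall t, t0 <= t <= T -> below t.
Proof.
move=> Ks0; have tT0 : t0 < T by case/andP: t0T.
have b0 : below t0.
  by move=> x; exists (s t0 x) => //; rewrite subrr hprod0l ltW.
pose B := [set t | t0 <= t <= T /\ forall t', t0 <= t' <= t -> below t'].
have Bt0 : B t0.
  split=> [|t' t't]; first by rewrite lexx ltW.
  by rewrite (_ : t' = t0)//; apply/eqP; rewrite eq_le andbC.
have hB : has_sup B.
  by split; [exists t0|exists T => t [/andP[]]].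
pose m := sup B.
have t0m : t0 <= m by apply: sup_upper_bound.
have mT : m <= T by apply: sup_le_ub => [|t [/andP[]]]; first by exists t0.
have below_lt t : t0 <= t < m -> below t.
  move=> /andP[t0t tm].
  have mt0 : 0 < m - t by rewrite subr_gt0.
  have [b [_ Hb] tb] := sup_adherent mt0 hB.
  by apply: Hb; rewrite t0t ltW//; move: tb; rewrite -/m opprB addrC subrK.
have bm : below m.
  have [<-//|t0m'] := eqVneq t0 m.
  by apply: below_left_closed => //; rewrite mT andbT lt_neqAle t0m'.
have Bm t : t0 <= t <= m -> below t.
  move=> /andP[t0t]; rewrite le_eqVlt => /predU1P[->//|tm].
  by apply: below_lt; rewrite t0t.
move=> t /andP[t0t tT].
have [mT'|Tm] := ltP m T; last by apply: Bm; rewrite t0t (le_trans tT).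
have mtT : t0 <= m < T by rewrite t0m.
have [tau tau0 Htau] := below_continues mtT bm.
have : B (Num.min (m + tau) T).
  split=> [|t' /andP[t0t' t't]].
    rewrite ge_min lexx orbT andbT le_min (ltW tT0) andbT.
    by rewrite (le_trans t0m)// lerDl ltW.
  have [t'm|mt'] := leP t' m; first by apply: Bm; rewrite t0t'.
  by apply: Htau; rewrite ltW//= (le_trans t't)// ge_min lexx.
move=> /(sup_upper_bound hB); rewrite -/m ge_min => /orP[|].
  by rewrite gerDl leNgt tau0.
by rewrite leNgt mT'.
Qed.

End barrier.

Theorem theorem4 (R : realType) (n k : nat) (T : R)
    (M : closed_oriented_manifold R n) (g : metric_family M T)
    (Gam : christoffel M) (V : vector_bundle M k) (h : bundle_metric V)
    (nabla : connection_family V T) (U : set (total_space V))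
    (F : forall x : M, V x -> R -> V x)
    (u : R -> chart M -> 'I_n -> forall x : M, V x -> V x)
    (K A : R -> set (total_space V)) :
  levi_civita g Gam ->
  compatible nabla h ->
  open U ->
  (forall t : R, 0 <= t <= T -> K t `<=` U) ->
  (forall t : R, 0 <= t <= T -> closed (K t)) ->
  (forall t : R, 0 <= t <= T -> parallel_invariant nabla t (K t)) ->
  (forall (t : R) (x : M), 0 <= t <= T ->
    [/\ fiber_of (K t) x !=set0, fiber_closed (fiber_of (K t) x)
      & convex_set (fiber_of (K t) x)]) ->
  (forall t : R, 0 <= t <= T -> A t `<=` K t) ->
  closed [set p : total_space V * R | 0 <= p.2 <= T /\ K p.2 p.1] ->
  closed [set p : total_space V * R | 0 <= p.2 <= T /\ A p.2 p.1] ->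
  smooth_diagonal T u ->
  continuous_field T U F ->
  lipschitz_field T h U F ->
  (forall (x : M) (t0 : R) (J : set R) (s : R -> V x),
    0 <= t0 < T -> is_interval J -> J t0 -> J `<=` `[t0, T] ->
    ode_solution U F J s ->
    fiber_of (K t0 `\` A t0) x (s t0) ->
    (forall t, J t -> fiber_of (K t) x (s t)) \/
    (exists t1, [/\ J t1,
      forall t : R, t0 <= t < t1 -> fiber_of (K t `\` A t) x (s t) &
      fiber_of (A t1) x (s t1)])) ->
  forall (t0 : R) (s : R -> section_of V),
    0 <= t0 < T ->
    pde_solution U g Gam nabla u F t0 s ->
    (forall x : M, fiber_of (K t0 `\` A t0) x (s t0 x)) ->
    (forall (x : M) (t : R), t0 <= t <= T -> ~ fiber_of (A t) x (s t x)) ->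
    forall (x : M) (t : R), t0 <= t <= T -> fiber_of (K t) x (s t x).
Proof.
move=> _ hc oU KU _ Kpar Kfib _ clK clA du cF lF ode t0 s t0T pde Ks0 sA x t tT.
have t00 : 0 <= t0 by case/andP: t0T.
have tT' : 0 <= t <= T by case/andP: tT => ? ->; rewrite (le_trans t00).
have [Cs sU _] := pde.
have [delta delta0 near_s] := near_solution_uniform t00 oU lF clA Cs sU
  (fun t x tT => sA x t tT).
have [a ax] := tdom_cover V x.
have [c c0 /nbhs_singleton[_ Hc]] := hprod_lower ax h.
have [_ /(_ a ax) clKx _] := Kfib t x tT'.
suff : (triv V a @` fiber_of (K t) x) (triv V a (s t x)).
  by move=> [v Kv /(triv_inj ax) <-].
apply: contrapT => nin.
have := open_nbhs_nbhs (conj (closed_openC clKx) nin).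
move=> /nbhs_ballP[e /= e0 He].
(* The growth factor of the barrier over [t0, T]; with E = d / L the barrier stays below [d]
   throughout. *)
pose L := expR ((delta^-1 + 2) * (T - t0)).
have L0 : 0 < L by exact: expR_gt0.
(* Squared distance at most c (e / 2)^2 means coordinate distance at most e / 2, inside the ball
   free of K. A single small E thus replaces the limit E to 0. *)
pose d := Num.min delta (c * (e / 2) ^+ 2).
have e20 : 0 < e / 2 by rewrite divr_gt0.
have d0 : 0 < d by rewrite lt_min delta0 mulr_gt0// exprn_gt0.
have E0 : 0 < d / L by rewrite divr_gt0.
have rho_d r : t0 <= r <= T -> d / L * expR ((delta^-1 + 2) * (r - t0)) <= d.
  move=> /andP[_ rT]; rewrite -mulrA ler_piMr ?(ltW d0)// ler_pdivrMl// mulr1.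
  rewrite ler_expR ler_pM2l ?lerD2r//.
  by rewrite addr_gt0// invr_gt0.
have rho_delta r : t0 <= r <= T -> d / L * expR ((delta^-1 + 2) * (r - t0)) <= delta.
  by move=> /rho_d/le_trans; apply; rewrite ge_min lexx.
have [v Kv hv] : exists2 v : V x, K t (Vec x v) & h x (s t x - v) (s t x - v) <= d.
  have Kconv r y (rT : 0 <= r <= T) : convex_set (fiber_of (K r) y).
    by have [] := Kfib r y rT.
  have [v Kv hv] := below_all hc oU KU Kpar Kconv clK du cF lF ode t0T pde delta0
    near_s E0 rho_delta (fun x => (Ks0 x).1) tT x.
  by exists v => //; apply: le_trans hv (rho_d t tT).
apply: (He (triv V a v)); last by exists v.
rewrite -ball_normE/= -trivB//.
have := Hc (triv V a (s t x - v)); rewrite trivK// => H.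
have {}H : `|triv V a (s t x - v)| <= e / 2.
  have : c * `|triv V a (s t x - v)| ^+ 2 <= c * (e / 2) ^+ 2.
    by apply: (le_trans H); apply: (le_trans hv); rewrite ge_min lexx orbT.
  by rewrite ler_pM2l// ler_pXn2r ?nnegrE//; exact: ltW.
by apply: (le_lt_trans H); rewrite ltr_pdivrMr// ltr_pMr// ltr1n.
Qed.
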